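(* Assume that $f_\varepsilon\in\mathbb{L}_2(\mathbb{R})$ and $f_\varepsilon^*(x)\neq 0$ for all $x\in\mathbb{R}$, and that $g\in\mathbb{L}_2(\mathbb{R})$ and there exists $M_2>0$ with $\int x^2g^2(x)\,dx<M_2<\infty$. Then, for every integer $m\geq 1$, $$\mathbb{E}\|g-\hat g_m^{(n)}\|^2\leq \|g-g_m\|^2+\frac{m^2(M_2+1)}{k_n}+\frac{2\Delta(m)}{n}+\frac{2R_m}{n},$$ where $$\Delta(m)=\frac{1}{2\pi}\int_{-\pi m}^{\pi m}\frac{dx}{|f_\varepsilon^*(x)|^2},\qquad R_m=\frac1\pi\sum_{k=2}^n\int_{-\pi m}^{\pi m}\left|\mathrm{Cov}\left(e^{ixX_1},e^{ixX_k}\right)\right|dx.$$ Moreover, $R_m\leq\min(R_{m,\beta},R_{m,\tau})$, where $$R_{m,\beta}=4m\sum_{k=1}^{n-1}\beta_{\mathbf{X},1}(k),\qquad R_{m,\tau}=\pi m^2\sum_{k=1}^{n-1}\tau_{\mathbf{X},1}(k)$$ (the coefficients $\tau_{\mathbf{X},1}(k)$ being defined when $\mathbb{E}|X_1|<\infty$).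
   Context: Model. One observes $Z_i=X_i+\varepsilon_i$, $i=1,\dots,n$. The sequence $\mathbf{X}=(X_i)_{i\geq1}$ of real random variables is strictly stationary (not necessarily independent) with common unknown marginal density $g$; the errors $(\varepsilon_i)_{i\ge 1}$ are i.i.d. with known density $f_\varepsilon$ and are independent of $(X_i)_{i\geq1}$. Notation. $u^*(x)=\int e^{itx}u(t)\,dt$, $\langle u,v\rangle=\int u(x)\overline{v(x)}\,dx$, $\|u\|^2=\int|u(x)|^2dx$. For complex random variables $A,B$ with finite second moment, $\mathrm{Cov}(A,B)=\mathbb{E}(A\overline{B})-\mathbb{E}(A)\overline{\mathbb{E}(B)}$ (only its modulus matters here, up to the order of the arguments). Projection spaces. $\varphi(x)=\sin(\pi x)/(\pi x)$, $\varphi_{m,j}(x)=\sqrt m\,\varphi(mx-j)$ for $j\in\mathbb{Z}$ (an orthonormal system in $\mathbb{L}_2(\mathbb{R})$). $S_m$ is the closed linear span of $\{\varphi_{m,j}:j\in\mathbb{Z}\}$ in $\mathbb{L}_2(\mathbb{R})$, and $g_m$ is the orthogonal projection of $g$ on $S_m$. For a positive integer $k_n$, $S_m^{(n)}$ is the linear span of $\{\varphi_{m,j}:|j|\leq k_n\}$. Estimator. $\hat g_m^{(n)}=\arg\min_{t\in S_m^{(n)}}\gamma_n(t)$, where $\gamma_n(t)=\frac1n\sum_{i=1}^n[\|t\|^2-2u_t^*(Z_i)]$ and $u_t(x)=\frac{1}{2\pi}\frac{t^*(-x)}{f_\varepsilon^*(x)}$. Explicitly, $\hat g_m^{(n)}=\sum_{|j|\leq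 k_n}\hat a_{m,j}\varphi_{m,j}$ with $\hat a_{m,j}=\frac1n\sum_{i=1}^n u^*_{\varphi_{m,j}}(Z_i)$. Dependence coefficients. For a $\sigma$-algebra $\mathcal{M}$ and a real random variable $Y$ with distribution $\mathbb{P}_Y$ and conditional distribution $\mathbb{P}_{Y|\mathcal{M}}$ given $\mathcal{M}$: $\beta(\mathcal{M},\sigma(Y))=\mathbb{E}\big(\sup_{A\in\mathcal{B}(\mathbb{R})}|\mathbb{P}_{Y|\mathcal{M}}(A)-\mathbb{P}_Y(A)|\big)$, and, if $\mathbb{E}|Y|<\infty$, $\tau(\mathcal{M},Y)=\mathbb{E}\big(\sup_{f}|\mathbb{P}_{Y|\mathcal{M}}(f)-\mathbb{P}_Y(f)|\big)$, the supremum being over 1-Lipschitz functions $f:\mathbb{R}\to\mathbb{R}$. Then $\beta_{\mathbf{X},1}(k)=\beta(\sigma(X_1),\sigma(X_{1+k}))$ and, if $\mathbb{E}|X_1|<\infty$, $\tau_{\mathbf{X},1}(k)=\tau(\sigma(X_1),X_{1+k})$. *)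

(* Defs.v *)
From HB Require Import structures.
From mathcomp Require Import all_boot all_order all_algebra.
From mathcomp Require Import finmap complex.
From mathcomp Require Import all_classical all_reals all_analysis measurable_realfun.

Set Implicit Arguments.
Unset Strict Implicit.
Unset Printing Implicit Defensive.

Import Order.TTheory GRing.Theory Num.Theory.
Import numFieldNormedType.Exports.

Local Open Scope classical_set_scope.
Local Open Scope complex_scope.
Local Open Scope ring_scope.

Section fourier.
Context {R : realType}.
Local Notation mu := (@lebesgue_measure R).

(* |z| as an element of R; the library norm `|z| lives in R[i]. *)
Definition cmod (z : R[i]) : R := complex.Re `|z|.

Definition expi (x : R) : R[i] := cos x +i* sin x.

Definition cintegral d (T : measurableType d)
    (nu : {measure set T -> \bar R}) (D : set T) (f : T -> R[i]) : R[i] :=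
  (\int[nu]_(x in D) complex.Re (f x))%R +i*
  (\int[nu]_(x in D) complex.Im (f x))%R.

(* The integral over the line is taken as the limit of the integrals over
   [-T, T]. It is the Lebesgue integral if u is integrable; the truncation is
   needed because sinc is square integrable but not integrable. *)
Definition fourier (u : R -> R[i]) (x : R) : R[i] :=
  let F (T : R) := cintegral mu `[- T, T] (fun t => expi (t * x) * u t) in
  lim (complex.Re (F T) @[T --> +oo]) +i* lim (complex.Im (F T) @[T --> +oo]).

Definition fourierR (u : R -> R) : R -> R[i] := fourier (fun t => (u t)%:C).

Definition sqnorm (u : R -> R) : \bar R := (\int[mu]_x ((u x) ^+ 2)%:E)%E.

Definition inner (u v : R -> R) : R := \int[mu]_x (u x * v x).

Definition sinc (x : R) : R := if x == 0 then 1 else sin (pi * x) / (pi * x).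

Definition phi (m : nat) (j : int) (x : R) : R :=
  Num.sqrt m%:R * sinc (m%:R * x - j%:~R).

Definition lin_span (m : nat) (J : set int) : set (R -> R) :=
  [set t | exists (s : seq int) (a : int -> R),
     (forall j, j \in s -> J j) /\
     t = fun x => \sum_(j <- s) a j * phi m j x].

Definition S_fin (m kn : nat) : set (R -> R) :=
  lin_span m [set j | (`|j| <= kn)%N].

Definition S_closed (m : nat) : set (R -> R) :=
  [set t : R -> R | t \in Lfun mu 2%:E /\
     forall e : R, 0 < e -> exists2 s, lin_span m setT s &
       (sqnorm (t \- s)%R < e%:E)%E].

(* An L2 class is represented by any of its members: gm is determined by g
   only up to almost everywhere equality. *)
Definition is_orth_proj (S : set (R -> R)) (g gm : R -> R) : Prop :=
  S gm /\ forall s, S s -> inner (g \- gm) s = 0.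

Definition u_ (feps t : R -> R) (x : R) : R[i] :=
  ((2 * pi)^-1)%:C * (fourierR t (- x) / fourierR feps x).

(* u_t^* is real valued for a real function t, hence the real part. *)
Definition gamma_n (feps : R -> R) (n : nat) (z : 'I_n -> R) (t : R -> R)
    : \bar R :=
  ((n%:R^-1)%:E * \sum_(i < n)
     (sqnorm t - (2 * complex.Re (fourier (u_ feps t) (z i)))%:E))%E.

Definition is_argmin (A : Type) (S : set A) (F : A -> \bar R) (a : A) : Prop :=
  S a /\ forall b, S b -> (F a <= F b)%E.

Definition Delta (feps : R -> R) (m : nat) : \bar R :=
  (((2 * pi)^-1)%:E *
   \int[mu]_(x in `[(- (pi * m%:R))%R, (pi * m%:R)%R])
     ((cmod (fourierR feps x) ^+ 2)^-1)%:E)%E.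

End fourier.

Section probability.
Context d (T : measurableType d) {R : realType} (P : probability T R).
Local Notation mu := (@lebesgue_measure R).
Implicit Types (X Y : nat -> {RV P >-> R}).

Definition has_density (Y : {RV P >-> R}) (f : R -> R) : Prop :=
  [/\ measurable_fun [set: R] f, (forall x, 0 <= f x) &
      forall A : set R, measurable A ->
        distribution P Y A = (\int[mu]_(x in A) (f x)%:E)%E].

Definition strictly_stationary X : Prop :=
  forall (h p : nat) (B : set (p.-tuple R)), measurable B ->
    P ((fun w => [tuple X (h + i)%N w | i < p]) @^-1` B) =
    P ((fun w => [tuple X i w | i < p]) @^-1` B).

Definition mutually_independent Y : Prop :=
  forall (J : {fset nat}) (A : nat -> set R), (forall i, measurable (A i)) ->
    P (\bigcap_(i in [set` J]) (Y i @^-1` A i)) =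
    (\prod_(i <- J) P (Y i @^-1` A i))%E.

Definition sigma_RV (Y : {RV P >-> R}) : set (set T) :=
  preimage_set_system setT Y measurable.

Definition sigma_seq Y : set (set T) := <<s \bigcup_i sigma_RV (Y i) >>.

Definition independent_sigma (M N : set (set T)) : Prop :=
  forall A B, M A -> N B -> P (A `&` B) = (P A * P B)%E.

Definition cexpectation (A : T -> R[i]) : R[i] := cintegral P setT A.

Definition ccov (A B : T -> R[i]) : R[i] :=
  cexpectation (fun w => A w * (B w)^*) - cexpectation A * (cexpectation B)^*.

(* X 0, X 1, ... stand for X_1, X_2, ..., so X k below is X_(k+1), and the sum
   of the Cov(exp(ixX_1), exp(ixX_k)) for 2 <= k <= n is indexed by
   1 <= k < n. *)
Definition R_ X (n m : nat) : \bar R :=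
  ((pi^-1)%:E * \sum_(1 <= k < n)
     \int[mu]_(x in `[(- (pi * m%:R))%R, (pi * m%:R)%R])
       (cmod (ccov (fun w => expi (x * X 0%N w))
                   (fun w => expi (x * X k w))))%:E)%E.

(* K is a regular version of the conditional distribution of Y given M. *)
Definition cond_distribution (M : set (set T)) (Y : {RV P >-> R})
    (K : T -> probability R R) : Prop :=
  forall A : set R, measurable A ->
    preimage_set_system setT (K ^~ A) measurable `<=` M /\
    forall C, M C -> (\int[P]_(w in C) K w A = P (C `&` Y @^-1` A))%E.

(* Two versions of the conditional distribution agree almost surely, so they
   all give the same value to the coefficients below; taking the infimum over
   the versions spares the choice of one. *)
Definition beta_coef (M : set (set T)) (Y : {RV P >-> R}) : \bar R :=
  ereal_inf [set (\int[P]_w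
      ereal_sup [set `|K w A - distribution P Y A| | A in measurable])%E
    | K in cond_distribution M Y].

Definition tau_coef (M : set (set T)) (Y : {RV P >-> R}) : \bar R :=
  ereal_inf [set (\int[P]_w
      ereal_sup [set `|\int[K w]_y (f y)%:E
                       - \int[distribution P Y]_y (f y)%:E|
                | f in [set f : R -> R | 1.-lipschitz (f : R^o -> R^o)]])%E
    | K in cond_distribution M Y].

Definition beta_X X (k : nat) : \bar R := beta_coef (sigma_RV (X 0%N)) (X k).

Definition tau_X X (k : nat) : \bar R := tau_coef (sigma_RV (X 0%N)) (X k).

Definition R_beta X (n m : nat) : \bar R :=
  ((4 * m%:R)%:E * \sum_(1 <= k < n) beta_X X k)%E.

Definition R_tau X (n m : nat) : \bar R :=
  ((pi * m%:R ^+ 2)%:E * \sum_(1 <= k < n) tau_X X k)%E.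

End probability.

(* Main.v *)
Require Import Defs.
From mathcomp Require Import all_boot all_order all_algebra.
From mathcomp Require Import finmap complex.
From mathcomp Require Import all_classical all_reals all_analysis measurable_realfun.
From mathcomp Require Import ring lra zify.

(** Write a_j for the inner product of g with [phi m j], write [A = pi m], and
call [-A, A] the band. Characteristic functions and Fourier transforms are
carried as pairs of real integrals of cos and sin.

The function [phi m j] is the inverse Fourier transform of an exponential cut
off outside the band ([phi_fourier]). Hence the [phi m j] are orthonormal
([inner_phi]), and the Fourier transform of a finite combination of them is a
trigonometric polynomial on the band and zero off it ([fourierR_comb]). As
sinc is not integrable, this transform is only a limit of truncated integrals;
it is computed from the Dirichlet integral, with a rate of convergence.

On combinations of the [phi m j] the contrast is therefore quadratic, and its
minimiser has the explicit coefficients ahat_j ([argmin_comb]). By Pythagoras,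
its squared error is at most that of gm, plus the sum of a_j^2 over |j| > kn,
plus the sum of (ahat_j - a_j)^2 over |j| <= kn ([section_risk]).

The tail is small because multiplying [phi m j] by mx - j leaves a bounded sine
over pi: j a_j is m times a coefficient of x g(x), up to a bounded term, and
Bessel for x g(x) together with the sum of 1/j^2 gives the bound
([tail_coef]).

The second sum is controlled by Bessel on the band, since ahat_j - a_j is a
Fourier coefficient of the empirical characteristic function of Z divided by
that of the errors, minus that of g ([coefficient_error]). At a fixed frequency
t and for distinct i and k, the errors multiply the covariance of exp(itX_i)
and exp(itX_k) by the squared modulus of their characteristic function. The variance of the empirical
characteristic function is thus at most 1/n plus (2/n) times that squared
modulus times the sum of the covariances ([variance_bound]). Dividing by it and
integrating over the band gives Delta(m)/n and R_m/n
([expected_coefficient_error]).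

Finally, a covariance of functions of X_1 and X_(1+k) is the expectation, over
X_1, of an integral against the difference between the conditional law and the
law of X_(1+k) ([cov_disintegration]). After a rotation that makes the
covariance real, the integrand is cos(ty - c), which has oscillation 2 and
Lipschitz constant |t|: this gives the bounds by beta ([ccov_le_beta]) and by
tau ([ccov_le_tau]), which are then integrated over the band. *)

Set Implicit Arguments.
Unset Strict Implicit.
Unset Printing Implicit Defensive.

Import Order.TTheory GRing.Theory Num.Theory.
Import numFieldNormedType.Exports.

Local Open Scope classical_set_scope.
Local Open Scope ring_scope.

(** * Integration on the line *)

Section integral_tools.
Context {R : realType}.
Local Notation mu := (@lebesgue_measure R).

(** The integral of a nonnegative function is a supremum over the simple
    functions below it, hence monotone without measurability. This matters for
    the suprema over sets and over Lipschitz functions that define the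
    dependence coefficients: they need not be measurable. *)
Lemma le_integral_ge0 d (T : measurableType d) (nu : {measure set T -> \bar R})
    (D : set T) (f1 f2 : T -> \bar R) :
  (forall x, D x -> 0 <= f1 x)%E -> (forall x, D x -> f1 x <= f2 x)%E ->
  (\int[nu]_(x in D) f1 x <= \int[nu]_(x in D) f2 x)%E.
Proof.
move=> f10 f12.
have f20 x : D x -> (0 <= f2 x)%E by move=> Dx; exact: le_trans (f10 x Dx) (f12 x Dx).
rewrite !ge0_integralE//; apply: le_ereal_sup => _ /= [h hf <-].
exists h => // x; apply: (le_trans (hf x)).
by rewrite /patch; case: ifPn => // /set_mem /f12.
Qed.

Lemma continuous_integrable_itv (f : R -> R) (a b : R) :
  continuous f -> mu.-integrable `[a, b] (EFin \o f).
Proof.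
move=> cf; apply: continuous_compact_integrable; first exact: segment_compact.
exact: continuous_subspaceT.
Qed.

Lemma Rintegral_itv_cat (f : R -> R) (a b c : R) :
  continuous f -> a <= b -> b <= c ->
  \int[mu]_(t in `[a, c]) f t =
  \int[mu]_(t in `[a, b]) f t + \int[mu]_(t in `[b, c]) f t.
Proof.
move=> cf ab bc.
have := @Rintegral_itvB R f (BLeft a) (BRight c) b (continuous_integrable_itv _ _ cf).
rewrite !bnd_simp ab bc => /(_ isT isT) H.
rewrite -(@Rintegral_itv_obnd_cbnd _ b); last first.
  apply: integrableS (continuous_integrable_itv b c cf) => //; exact: subset_itv_oc_cc.
by rewrite -H addrC subrK.
Qed.

(** Integration from a fixed point - N gives an antiderivative only to the
    right of - N. The base point may move with x, because changing it cancels
    once the value at 0 is subtracted. *)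
Lemma ex_antiderivative (f : R -> R) : continuous f ->
  exists F : R -> R, forall x, is_derive x (1 : R) F (f x).
Proof.
move=> cf.
pose G (N x : R) := \int[mu]_(t in `[- N, x]) f t.
pose F x := G (`|x| + 1) x - G (`|x| + 1) 0.
have FE N x : `|x| + 1 <= N -> F x = G N x - G N 0.
  move=> xN; rewrite /F /G.
  have h y : - (`|x| + 1) <= y ->
    \int[mu]_(t in `[- N, y]) f t = \int[mu]_(t in `[- N, - (`|x| + 1)]) f t +
    \int[mu]_(t in `[- (`|x| + 1), y]) f t.
    by move=> xy; apply: Rintegral_itv_cat => //; rewrite lerN2.
  have h0 : - (`|x| + 1) <= 0 by rewrite oppr_le0 addr_ge0.
  have hx : - (`|x| + 1) <= x by rewrite lerNl (le_trans (ler_norm _))// normrN lerDl.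
  by rewrite (h _ hx) (h _ h0); ring.
exists F => x.
pose N := `|x| + 2.
have xN : - N < x < N.
  by rewrite -ltr_norml /N ltrDl.
have [dG G'] : derivable (G N) x 1 /\ derive1 (G N) x = f x.
  case/andP: xN => Nx xN.
  have H1 : mu.-integrable `[- N, N] (EFin \o f) by exact: continuous_integrable_itv.
  have H2 : {for x, continuous f} by exact: cf.
  exact: (continuous_FTC1_closed xN H1 Nx H2).
have near_F : {near x, (fun y => G N y - G N 0) =1 F}.
  near=> y; apply/esym/FE.
  have : `|x - y| < 1 by near: y; exact: (@cvgr_dist_lt _ _ _ (nbhs x)).
  have := ler_normB x (x - y); rewrite opprB addrC subrK /N; lra.
apply: (@near_eq_is_derive _ _ _ (fun y => G N y - G N 0)) => //.
rewrite -[f x]subr0.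
apply: is_deriveB.
apply: DeriveDef => //; by rewrite -derive1E.
Unshelve. all: by end_near. Qed.

Lemma Rintegral_antiderivative (f F : R -> R) (a b : R) : continuous f ->
  (forall x, is_derive x (1 : R) F (f x)) -> a <= b ->
  \int[mu]_(t in `[a, b]) f t = F b - F a.
Proof.
move=> cf dF; rewrite le_eqVlt => /predU1P[->|ab].
  by rewrite set_itv1 Rintegral_set1 subrr.
have cF : continuous F.
  by move=> x; apply/differentiable_continuous/derivable1_diffP; have [] := dF x.
rewrite /Rintegral (@continuous_FTC2 _ _ F)//.
- exact: continuous_subspaceT.
- split.
  + by move=> x _; have [] := dF x.
  + by apply: cvg_at_right_filter; exact: cF.
  + by apply: cvg_at_left_filter; exact: cF.
- by move=> x _; rewrite derive1E; have [] := dF x.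
Qed.

Lemma antiderivative_dist_le (f F : R -> R) (a b M : R) : continuous f ->
  (forall x, is_derive x (1 : R) F (f x)) -> a <= b ->
  (forall x, a <= x <= b -> `|f x| <= M) -> `|F b - F a| <= M * (b - a).
Proof.
move=> cf dF ab fM; rewrite -(Rintegral_antiderivative cf dF ab).
have fint := continuous_integrable_itv a b cf.
apply: (le_trans (le_normr_Rintegral _ fint)) => //.
have -> : M * (b - a) = \int[mu]_(x in `[a, b]) (cst M) x.
  rewrite Rintegral_cst//= lebesgue_measure_itv/= lte_fin.
  by case: ltP => ab'; [rewrite -EFinB|rewrite (le_anti (introT andP (conj ab ab'))) subrr].
apply: le_Rintegral => //.
- apply: continuous_integrable_itv => x.
  by apply: continuous_comp; [exact: cf|exact: norm_continuous].
- by apply: continuous_integrable_itv => x; exact: cvg_cst.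
Qed.

Lemma continuous_measurable_EFin (f : R -> R) (D : set R) :
  continuous f -> measurable_fun D (EFin \o f).
Proof.
move=> cf; apply/measurable_EFinP; apply: measurable_funTS.
exact: continuous_measurable_fun.
Qed.

Lemma sin_lipschitz (x y : R) : `|sin x - sin y| <= `|x - y|.
Proof.
wlog xy : x y / y <= x.
  by move=> H; case: (leP y x) => [|/ltW] /H //; rewrite distrC (distrC y).
rewrite (ger0_norm (x := x - y)) ?subr_ge0// -[leRHS]mul1r.
apply: (@antiderivative_dist_le cos) => //; first exact: continuous_cos.
by move=> z _; exact: cos_max.
Qed.

Lemma cos_lipschitz (x y : R) : `|cos x - cos y| <= `|x - y|.
Proof.
by rewrite -2!sinDpihalf (le_trans (sin_lipschitz _ _))// opprD addrACA subrr addr0.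
Qed.

Lemma sin_le_norm (x : R) : `|sin x| <= `|x|.
Proof. by have := sin_lipschitz x 0; rewrite sin0 !subr0. Qed.

(** Every section, not almost every one, is integrable: the inner extended
    integrals are then finite and agree with the real ones. *)
Lemma Fubini_in d1 d2 (T1 : measurableType d1) (T2 : measurableType d2)
    (m1 : {sigma_finite_measure set T1 -> \bar R})
    (m2 : {sigma_finite_measure set T2 -> \bar R})
    (D1 : set T1) (D2 : set T2) (f : T1 * T2 -> R) :
  measurable D1 -> measurable D2 -> measurable_fun setT f ->
  (\int[m1]_(x in D1) \int[m2]_(y in D2) `|f (x, y)|%:E < +oo)%E ->
  (forall x, D1 x -> m2.-integrable D2 (fun y => (f (x, y))%:E)) ->
  (forall y, D2 y -> m1.-integrable D1 (fun x => (f (x, y))%:E)) ->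
  \int[m1]_(x in D1) \int[m2]_(y in D2) f (x, y) =
  \int[m2]_(y in D2) \int[m1]_(x in D1) f (x, y).
Proof.
move=> mD1 mD2 mf fin int2 int1.
pose h (z : T1 * T2) := (\1_D1 z.1 * \1_D2 z.2 * f z).
have mh : measurable_fun setT (EFin \o h).
  apply/measurable_EFinP; apply: measurable_funM => //.
  apply: measurable_funM.
    by apply: measurableT_comp => //; exact: measurable_indic.
  by apply: measurableT_comp => //; exact: measurable_indic.
have h2 x : (\int[m2]_y (h (x, y))%:E = (\1_D1 x)%:E * \int[m2]_(y in D2) (f (x, y))%:E)%E.
  rewrite [in RHS]integral_mkcond.
  rewrite indicE; case: (boolP (x \in D1)) => xD1; last first.
    by rewrite mul0e integral0_eq// => y _; rewrite /h/= indicE (negbTE xD1) !mul0r.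
  rewrite mul1e; apply: eq_integral => y _.
  by rewrite /h/= !indicE xD1 mul1r patchE;
     case: ifP; rewrite ?mul1r ?mul0r.
have h1 y : (\int[m1]_x (h (x, y))%:E = (\1_D2 y)%:E * \int[m1]_(x in D1) (f (x, y))%:E)%E.
  rewrite [in RHS]integral_mkcond.
  rewrite indicE; case: (boolP (y \in D2)) => yD2; last first.
    by rewrite mul0e integral0_eq// => x _; rewrite /h/= !indicE (negbTE yD2) mulr0 mul0r.
  rewrite mul1e; apply: eq_integral => x _.
  by rewrite /h/= !indicE yD2 mulr1 patchE;
     case: ifP; rewrite ?mul1r ?mul0r.
have ih : (m1 \x m2)%E.-integrable setT (EFin \o h).
  apply/integrable12ltyP => //; apply: le_lt_trans fin.
  rewrite [leRHS]integral_mkcond le_eqVlt; apply/orP; left; apply/eqP.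
  apply: eq_integral => x _; rewrite patchE.
  case: (boolP (x \in D1)) => xD1; last first.
    by rewrite integral0_eq// => y _; rewrite /= /h/= indicE (negbTE xD1) !mul0r normr0.
  rewrite [in RHS]integral_mkcond; apply: eq_integral => y _.
  rewrite /= /h/= !indicE xD1 mul1r patchE.
  by case: ifP; rewrite ?mul1r ?mul0r ?normr0.
have := Fubini ih; rewrite /=.
under eq_integral do rewrite h2.
under [in X in _ = X -> _]eq_integral do rewrite h1.
move=> E.
rewrite /Rintegral; congr fine; move: E.
have -> : (\int[m1]_x ((\1_D1 x)%:E * \int[m2]_(y in D2) (f (x, y))%:E) =
   \int[m1]_(x in D1) (fine (\int[m2]_(y in D2) (f (x, y))%:E))%:E)%E.
  rewrite [RHS]integral_mkcond; apply: eq_integral => x _; rewrite patchE indicE.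
  case: ifPn => xD1; last by rewrite mul0e.
  by rewrite mul1e fineK// integrable_fin_num//; apply: int2; exact: set_mem.
move=> ->.
rewrite [RHS]integral_mkcond; apply: eq_integral => y _; rewrite patchE indicE.
case: ifPn => xD1; last by rewrite mul0e.
by rewrite mul1e fineK// integrable_fin_num//; apply: int1; exact: set_mem.
Qed.

End integral_tools.

(** * The Dirichlet integral *)

Section dirichlet.
Context {R : realType}.
Local Notation mu := (@lebesgue_measure R).

(** The cardinal sine without the factor pi, so that it is the derivative of
    the sine integral. *)
Definition snc (y : R) : R := if y == 0 then 1 else sin y / y.

Lemma sncE (y : R) : snc y * y = sin y.
Proof. by rewrite /snc; case: eqVneq => [->|y0]; rewrite ?mulr0 ?sin0// divfK. Qed.

Lemma sincE (x : R) : sinc x = snc (pi * x).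
Proof.
by rewrite /sinc /snc mulf_eq0 (gt_eqF (pi_gt0 R)).
Qed.

Lemma sncN (y : R) : snc (- y) = snc y.
Proof. by rewrite /snc oppr_eq0 sinN invrN mulrNN. Qed.

Lemma snc_norm_le1 (y : R) : `|snc y| <= 1.
Proof.
rewrite /snc; case: eqVneq => [_|y0]; first by rewrite normr1.
by rewrite normrM normfV ler_pdivrMr ?normr_gt0// mul1r sin_le_norm.
Qed.

Lemma snc_norm_le (y : R) : `|snc y| * `|y| <= 1.
Proof. by rewrite -normrM sncE sin_max. Qed.

Lemma continuous_snc : continuous snc.
Proof.
move=> y; have [->|y0] := eqVneq y 0.
  apply/continuous_withinNx; rewrite {2}/snc eqxx.
  have : (fun h => h^-1 *: (sin (h *: 1 + 0) - sin 0)) @ (0 : R)^' --> (1 : R).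
    have [d E] := is_derive_sin (0 : R); rewrite cos0 in E.
    by rewrite -[X in _ --> X]E; exact: d.
  apply: cvg_trans; apply: near_eq_cvg; near=> h.
  rewrite /= sin0 subr0 addr0 /snc ifN; last by near: h; exact: nbhs_dnbhs_neq.
  by rewrite /GRing.scale/= mulr1 mulrC.
have : (fun y => sin y / y) @ y --> sin y / y.
  by apply: cvgM; [exact: continuous_sin|exact: cvgV].
rewrite /continuous_at {2}/snc (negbTE y0); apply: cvg_trans.
apply: near_eq_cvg; near=> h; rewrite /snc ifN//.
by near: h; exact: open_neq.
Unshelve. all: by end_near. Qed.

(** t exp(-ts) is the density of an exponential law. *)
Lemma integral_exp_decay (t : R) : 0 < t ->
  mu.-integrable `[0, +oo[ (fun s => (expR (- t * s))%:E) /\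
  \int[mu]_(s in `[0, +oo[) expR (- t * s) = t^-1.
Proof.
move=> t0.
have i1 := integrable_exponential_pdf t0.
have e : exponential_pdf t = (fun s => t * expR (- t * s)) \_ `[0, +oo[.
  by apply/funext => s; rewrite /exponential_pdf !patchE.
have i2 : mu.-integrable `[0, +oo[ (fun s => (t * expR (- t * s))%:E).
  apply/integrable_mkcond => //; move: i1; rewrite e.
  by apply: eq_integrable => // x _; rewrite /= !patchE; case: ifP.
have i3 : mu.-integrable `[0, +oo[ (fun s => (expR (- t * s))%:E).
  have : mu.-integrable `[0, +oo[ (fun s => (t^-1)%:E * (t * expR (- t * s))%:E)%E.
    exact: integrableZl i2.
  by apply: eq_integrable => // x _; rewrite -EFinM mulKf// gt_eqF.
split => //; apply: (mulfI (lt0r_neq0 t0)); rewrite mulfV ?gt_eqF//.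
rewrite -RintegralZl// /Rintegral.
have := integral_exponential_pdf t0; rewrite e => h.
apply: (congr1 fine (y := 1%E)); rewrite -h [LHS]integral_mkcond.
by apply: eq_integral => x _; rewrite /= !patchE; case: ifP.
Qed.

Lemma is_derive_ext (f g : R -> R) (x df dg : R) :
  is_derive x (1 : R) f df -> (forall y, f y = g y) -> df = dg ->
  is_derive x (1 : R) g dg.
Proof. by move=> fd /funext <- <-. Qed.

Lemma derive_scale (k : R) (f : R -> R) (x df : R) :
  is_derive x (1 : R) f df -> is_derive x (1 : R) (fun y => k * f y) (k * df).
Proof. by move=> fd; exact: is_deriveZ. Qed.

Lemma derive_mul (f g : R -> R) (x df dg : R) :
  is_derive x (1 : R) f df -> is_derive x (1 : R) g dg ->
  is_derive x (1 : R) (fun y => f y * g y) (f x * dg + g x * df).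
Proof. by move=> fd gd; exact: is_deriveM. Qed.

Lemma derive_add (f g : R -> R) (x df dg : R) :
  is_derive x (1 : R) f df -> is_derive x (1 : R) g dg ->
  is_derive x (1 : R) (fun y => f y + g y) (df + dg).
Proof. by move=> fd gd; exact: is_deriveD. Qed.

Lemma derive_comp (f g : R -> R) (x df dg : R) :
  is_derive (g x) (1 : R) f df -> is_derive x (1 : R) g dg ->
  is_derive x (1 : R) (fun y => f (g y)) (df * dg).
Proof. by move=> fd gd; exact: is_derive1_comp. Qed.

Lemma is_derive_laplace_sin (s t : R) :
  is_derive t (1 : R) (fun t => - (expR (- s * t) * (cos t + s * sin t)) / (1 + s ^+ 2))
    (sin t * expR (- s * t)).
Proof.
have s0 : 1 + s ^+ 2 != 0 by rewrite gt_eqF// ltr_wpDr// sqr_ge0.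
have dE := derive_comp (is_derive_expR (- s * t)) (derive_scale (- s) (is_derive_id t (1 : R))).
have dC := derive_add (is_derive_cos t) (derive_scale s (is_derive_sin t)).
have dZ := derive_scale (- (1 + s ^+ 2)^-1) (derive_mul dE dC).
by apply: (is_derive_ext dZ) => [u|] /=; field.
Qed.

Lemma integrable_inv_oneDsqr : mu.-integrable `[0, +oo[ (fun s => ((1 + s ^+ 2)^-1)%:E).
Proof.
apply/integrableP; split.
  by apply: continuous_measurable_EFin; exact: continuous_oneDsqrV.
apply: (@le_lt_trans _ _ (pi / 2)%:E); last exact: ltry.
rewrite -integral0y_oneDsqr.
apply: le_integral_ge0 => // s _.
by rewrite lee_fin ger0_norm// invr_ge0 addr_ge0// sqr_ge0.
Qed.

Lemma laplace_sin (s T : R) : 0 <= T ->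
  \int[mu]_(t in `]0, T]) (sin t * expR (- s * t)) =
  (1 + s ^+ 2)^-1 - expR (- s * T) * (cos T + s * sin T) / (1 + s ^+ 2).
Proof.
move=> T0.
have cf : continuous (fun t => sin t * expR (- s * t)).
  move=> t; apply: cvgM; first exact: continuous_sin.
  apply: continuous_comp; last exact: continuous_expR.
  by apply: cvgM; [exact: cvg_cst|exact: cvg_id].
rewrite Rintegral_itv_obnd_cbnd; last first.
  by apply: integrableS (continuous_integrable_itv 0 T cf) => //; exact: subset_itv_oc_cc.
rewrite (Rintegral_antiderivative cf (is_derive_laplace_sin s)) //.
rewrite mulr0 expR0 cos0 sin0; field.
by rewrite gt_eqF// ltr_wpDr// sqr_ge0.
Qed.

(** |cos T + s sin T| <= 1 + s <= 2 (1 + s^2). *)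
Lemma laplace_rest_le (s T : R) : 0 <= s ->
  `|expR (- s * T) * (cos T + s * sin T) / (1 + s ^+ 2)| <= 2 * expR (- T * s).
Proof.
move=> s0.
have s1 : 0 < 1 + s ^+ 2 by rewrite ltr_wpDr// sqr_ge0.
rewrite normrM normfV (gtr0_norm s1) ler_pdivrMr// normrM ger0_norm ?expR_ge0//.
rewrite !mulNr (mulrC s T) (mulrC 2) -mulrA ler_wpM2l ?expR_ge0//.
apply: (le_trans (ler_normD _ _)); rewrite normrM (ger0_norm s0).
have := cos_max T; have := sin_max T; nra.
Qed.

(** Write sin t / t as the integral of sin t exp(-ts) over s >= 0 and exchange
    the integrals. The inner one becomes 1 / (1 + s^2), whose integral is pi /
    2, minus a remainder at most 2 exp(-Ts), whose integral is 2 / T. *)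
Lemma dirichlet_integral (T : R) : 0 < T ->
  `|\int[mu]_(t in `[0, T]) snc t - pi / 2| <= 2 / T.
Proof.
move=> T0.
have mf : measurable_fun [set: R * R] (fun z : R * R => sin z.1 * expR (- z.1 * z.2)).
  apply: measurable_funM.
    by apply: measurableT_comp => //; apply: continuous_measurable_fun; exact: continuous_sin.
  apply: measurableT_comp; first exact: measurable_expR.
  by apply: measurable_funM => //; exact: measurableT_comp.
have int2 (t : R) : `]0, T]%classic t -> mu.-integrable `[0, +oo[ (fun s => (sin t * expR (- t * s))%:E).
  rewrite /= in_itv/= => /andP[t0 _].
  have : mu.-integrable `[0, +oo[ (fun s => (sin t)%:E * (expR (- t * s))%:E)%E.
    by apply: integrableZl => //; have [] := integral_exp_decay t0.
  by apply: eq_integrable.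
have int1 (s : R) : `[0, +oo[%classic s -> mu.-integrable `]0, T] (fun t => (sin t * expR (- t * s))%:E).
  move=> _; apply: (@integrableS _ _ _ mu `[0, T]) => //.
    exact: subset_itv_oc_cc.
  apply: continuous_integrable_itv => t; apply: cvgM; first exact: continuous_sin.
  apply: continuous_comp; last exact: continuous_expR.
  by apply: cvgM; [exact: cvgN|exact: cvg_cst].
have fin : (\int[mu]_(t in `]0%R, T]) \int[mu]_(s in `[0%R, +oo[) `|sin t * expR (- t * s)|%:E < +oo)%E.
  apply: (@le_lt_trans _ _ (\int[mu]_(t in `]0%R, T]) (cst 1%E) t)%E); last first.
    rewrite integral_cst//= mul1e lebesgue_measure_itv/= lte_fin T0.
    by rewrite -EFinB ltry.
  apply: le_integral_ge0 => t /=; rewrite in_itv/= => /andP[t0 tT].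
    by apply: integral_ge0 => s _; rewrite lee_fin.
  have [i e] := integral_exp_decay t0.
  under eq_integral do rewrite normrM (ger0_norm (expR_ge0 _)) EFinM.
  rewrite integralZl// -[X in (_ * X)%E]fineK ?integrable_fin_num//.
  rewrite -/(Rintegral _ _ _) e -EFinM lee_fin ler_pdivrMr// mul1r.
  by rewrite (le_trans (sin_le_norm _))// gtr0_norm.
have -> : \int[mu]_(t in `[0, T]) snc t =
  \int[mu]_(t in `]0, T]) \int[mu]_(s in `[0, +oo[) (sin t * expR (- t * s)).
  rewrite -Rintegral_itv_obnd_cbnd; last first.
    apply: integrableS (continuous_integrable_itv 0 T continuous_snc) => //; exact: subset_itv_oc_cc.
  apply: eq_Rintegral => t; rewrite inE/= in_itv/= => /andP[t0 _].
  have [i e] := integral_exp_decay t0.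
  by rewrite RintegralZl// e /snc gt_eqF.
rewrite (@Fubini_in _ _ _ _ _ mu mu `]0, T] `[0, +oo[ _ _ _ mf fin int2 int1)//.
pose r s := expR (- s * T) * (cos T + s * sin T) / (1 + s ^+ 2).
have -> : \int[mu]_(s in `[0, +oo[) \int[mu]_(t in `]0, T]) (sin t * expR (- t * s)) =
  \int[mu]_(s in `[0, +oo[) ((1 + s ^+ 2)^-1 - r s).
  apply: eq_Rintegral => s _; rewrite -(laplace_sin _ (ltW T0)).
  by apply: eq_Rintegral => t _ /=; rewrite !mulNr (mulrC t).
have [iT eT] := integral_exp_decay T0.
have i2T : mu.-integrable `[0, +oo[ (fun s => (2 * expR (- T * s))%:E).
  have : mu.-integrable `[0, +oo[ (fun s => 2%:E * (expR (- T * s))%:E)%E.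
    exact: integrableZl iT.
  by apply: eq_integrable.
have ir : mu.-integrable `[0, +oo[ (EFin \o r).
  apply: (le_integrable _ _ _ i2T) => //.
    apply/measurable_EFinP/measurable_funTS; apply: measurable_funM.
      apply: measurable_funM.
        apply: measurableT_comp; first exact: measurable_expR.
        by apply: measurable_funM => //; exact: measurableT_comp.
      by apply: measurable_funD => //; exact: measurable_funM.
    by apply: continuous_measurable_fun; exact: continuous_oneDsqrV.
  move=> s /=; rewrite in_itv/= andbT => s0; rewrite lee_fin.
  by rewrite (le_trans (laplace_rest_le _ s0))// ler_norm.
rewrite RintegralB//; last exact: integrable_inv_oneDsqr.
rewrite {1}/Rintegral integral0y_oneDsqr/= addrAC subrr add0r normrN.
apply: (le_trans (le_normr_Rintegral _ ir)) => //.
rewrite -eT -RintegralZl//; apply: le_Rintegral => //.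
  exact: integrable_norm.
by move=> s /=; rewrite in_itv/= andbT => s0; exact: laplace_rest_le.
Qed.

End dirichlet.

(** * The sine integral *)

Section sine_integral.
Context {R : realType}.
Local Notation mu := (@lebesgue_measure R).

Lemma odd_even_antiderivative (f F : R -> R) : (forall x, is_derive x (1 : R) F (f x)) ->
  (forall x, f (- x) = f x) -> F 0 = 0 -> forall x, F (- x) = - F x.
Proof.
move=> dF ef F0 x; apply/eqP; rewrite -subr_eq0 opprK; apply/eqP.
have d y : is_derive y (1 : R) (fun y => F (- y) + F y) 0.
  have dN := derive_comp (dF (- y)) (is_deriveNid y (1 : R)).
  by apply: (is_derive_ext (derive_add dN (dF y))) => //; rewrite ef mulrN1 addNr.
by rewrite (is_derive_0_is_cst x 0 d) oppr0 F0 addr0.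
Qed.

Lemma even_odd_antiderivative (f F : R -> R) : (forall x, is_derive x (1 : R) F (f x)) ->
  (forall x, f (- x) = - f x) -> forall x, F (- x) = F x.
Proof.
move=> dF ef x; apply/eqP; rewrite -subr_eq0; apply/eqP.
have d y : is_derive y (1 : R) (fun y => F (- y) + -1 * F y) 0.
  have dN := derive_comp (dF (- y)) (is_deriveNid y (1 : R)).
  apply: (is_derive_ext (derive_add dN (derive_scale (-1) (dF y)))) => //.
  by rewrite ef mulrN1 mulN1r opprK subrr.
by have := is_derive_0_is_cst x 0 d; rewrite oppr0 !mulN1r subrr.
Qed.

(** The antiderivative of snc that vanishes at 0 is odd, as snc is even. The
    uniform bound comes from the mean value inequality up to 2 and from the
    distance to pi / 2 beyond. *)
Lemma ex_sine_integral : exists S : R -> R,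
  [/\ forall x, is_derive x (1 : R) S (snc x), forall u, S (- u) = - S u,
      forall u, 0 < u -> `|S u - pi / 2| <= 2 / u & forall u, `|S u| <= 4].
Proof.
have [F dF] := ex_antiderivative (@continuous_snc R).
pose S u := F u - F 0.
have dS x : is_derive x (1 : R) S (snc x).
  have dC : is_derive x (1 : R) (fun=> - F 0) 0 by exact: is_derive_cst.
  by apply: (is_derive_ext (derive_add (dF x) dC)); rewrite ?addr0.
have S0 : S 0 = 0 by rewrite /S subrr.
have SN := odd_even_antiderivative dS (@sncN R) S0.
have Spi u : 0 < u -> `|S u - pi / 2| <= 2 / u.
  move=> u0; have := dirichlet_integral u0.
  by rewrite (Rintegral_antiderivative (@continuous_snc R) dS (ltW u0)) S0 subr0.
exists S; split => // u.
wlog u0 : u / 0 <= u.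
  move=> H; case: (leP 0 u) => [|u0]; first exact: H.
  by rewrite -normrN -SN H// oppr_ge0 ltW.
have [u2|u2] := leP u 2.
  have := antiderivative_dist_le (@continuous_snc R) dS u0 (fun x _ => snc_norm_le1 x).
  rewrite S0 !subr0; lra.
have u1 : 0 < u by lra.
have := Spi u u1; have : 2 / u <= 1 by rewrite ler_pdivrMr// mul1r ltW.
have := @pihalf_lt2 R; have := @pihalf_ge1 R; rewrite !ler_norml; lra.
Qed.

Definition Si : R -> R := sval (cid ex_sine_integral).

Lemma is_derive_Si x : is_derive x (1 : R) Si (snc x).
Proof. by rewrite /Si; case: cid => S []. Qed.

Lemma SiN u : Si (- u) = - Si u.
Proof. by rewrite /Si; case: cid => S []. Qed.

Lemma Si_norm_le u : `|Si u| <= 4.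
Proof. by rewrite /Si; case: cid => S []. Qed.

Lemma Si_dist_pihalf u : 0 < u -> `|Si u - pi / 2| <= 2 / u.
Proof. by rewrite /Si; case: cid => S [? ? h ?]; exact: h. Qed.

Lemma cvg_Si : Si u @[u --> +oo] --> pi / 2.
Proof.
apply/(@cvgrPdist_le _ R^o) => e e0; near=> u.
have u0 : 0 < u by near: u; exact: nbhs_pinfty_gt.
rewrite distrC (le_trans (Si_dist_pihalf u0))// ler_pdivrMr// -ler_pdivrMl//.
Unshelve. all: by end_near. Qed.

Lemma cvg_affine_pinfty (k b : R) : 0 < k -> k * T + b @[T --> +oo] --> +oo.
Proof.
move=> k0; apply/cvgryPge => A; near=> T.
by rewrite -lerBlDr -ler_pdivrMl.
Unshelve. all: by end_near. Qed.

Lemma cvg_Si_affine (k M b : R) : k != 0 -> 0 < M ->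
  Si (k * (M * T + b)) @[T --> +oo] --> Num.sg k * (pi / 2).
Proof.
move=> k0 M0.
have h (l : R) : 0 < l -> Si (l * (M * T + b)) @[T --> +oo] --> pi / 2.
  move=> l0; apply: cvg_comp cvg_Si.
  have := @cvg_affine_pinfty (l * M) (l * b) (mulr_gt0 l0 M0).
  by under eq_fun do rewrite -mulrA -mulrDr.
case: (ltrgtP k 0) k0 => // [kn|kp] _.
  rewrite (ltr0_sg kn) mulN1r.
  rewrite (_ : (fun T => _) = (fun T => - Si (- k * (M * T + b)))); last first.
    by apply/funext => T; rewrite mulNr SiN opprK.
  by apply: cvgN; apply: h; rewrite oppr_gt0.
by rewrite (gtr0_sg kp) mul1r; exact: h.
Qed.

End sine_integral.

(** * The Fourier transform of the shifted sinc functions *)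

Section fourier_phi.
Context {R : realType}.
Local Notation mu := (@lebesgue_measure R).

Lemma continuous_affine (k b : R) : continuous (fun t : R => k * t + b).
Proof.
move=> t; apply: cvgD; last exact: cvg_cst.
by apply: cvgM; [exact: cvg_cst|exact: cvg_id].
Qed.

Lemma continuous_comp_fun (h k : R -> R) : continuous h -> continuous k ->
  continuous (fun t => h (k t)).
Proof. by move=> ch ck t; apply: continuous_comp; [exact: ck|exact: ch]. Qed.

Lemma continuous_mul_fun (h k : R -> R) : continuous h -> continuous k ->
  continuous (fun t => h t * k t).
Proof. by move=> ch ck t; apply: cvgM; [exact: ch|exact: ck]. Qed.

Lemma continuous_scale (b : R) : continuous (fun t : R => b * t).
Proof. by move=> t; apply: cvgM; [exact: cvg_cst|exact: cvg_id]. Qed.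

Arguments continuous_scale : clear implicits.
Arguments continuous_affine : clear implicits.

Lemma phiE m (j : int) (t : R) :
  phi m j t = Num.sqrt m%:R * snc (pi * (m%:R * t - j%:~R)).
Proof. by rewrite /phi sincE. Qed.

Lemma continuous_phi m (j : int) : continuous (@phi R m j).
Proof.
rewrite (_ : phi m j = fun t => Num.sqrt m%:R * snc (pi * (m%:R * t - j%:~R))); last first.
  by apply/funext => t; exact: phiE.
apply: (continuous_comp_fun (continuous_scale (Num.sqrt m%:R))).
apply: (continuous_comp_fun (@continuous_snc R)).
exact: (continuous_comp_fun (continuous_scale pi) (continuous_affine _ _)).
Qed.

(** sin (pi y) cos (a y) is a half sum of two sines, so the left side is the
    derivative in y of a sum of sine integrals. *)
Lemma cos_snc (a y : R) : cos (a * y) * snc (pi * y) =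
  (2 * pi)^-1 * ((pi + a) * snc ((pi + a) * y) + (pi - a) * snc ((pi - a) * y)).
Proof.
have : (pi : R) != 0 by rewrite gt_eqF// pi_gt0.
move: (pi : R) => p p0; have [->|y0] := eqVneq y 0.
  by rewrite !mulr0 /snc eqxx cos0; field.
have E (k : R) : k * snc (k * y) = sin (k * y) / y.
  by rewrite -sncE; move: (snc _) => A; field.
rewrite !E (_ : snc (p * y) = sin (p * y) / y / p); last first.
  by rewrite -E mulrAC divff// mul1r.
rewrite (mulrDl p a y) (mulrBl y p a) sinD sinB.
move: (sin (p * y)) (cos (p * y)) (sin (a * y)) (cos (a * y)) => A B C D.
by field; rewrite y0 p0.
Qed.

Variables (m : nat) (j : int) (x c : R).
Hypothesis m0 : (0 < m)%N.
Let M : R := m%:R.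
Let J : R := j%:~R.
(* With y = M t - J the phase x t + c equals th + a y. Expanding its cosine
   gives a part even in y, which integrates to sine integrals, and the odd part
   q, which has an even antiderivative Q. *)
Let a := x / M.
Let th := x * J / M + c.
Let q (y : R) := sin (a * y) * snc (pi * y).

Let M0 : 0 < M. Proof. by rewrite /M ltr0n. Qed.
Let pi0 : (0 : R) < pi. Proof. exact: pi_gt0. Qed.

Let continuous_q : continuous q.
Proof.
apply: continuous_mul_fun.
  exact: (continuous_comp_fun (@continuous_sin R) (continuous_scale a)).
exact: (continuous_comp_fun (@continuous_snc R) (continuous_scale pi)).
Qed.

Let q_le (y b : R) : 0 < b -> b <= y -> `|q y| <= b^-1.
Proof.
move=> b0 yb; have y0 : 0 < y by exact: lt_le_trans yb.
rewrite -[leRHS]div1r ler_pdivlMr// /q normrM.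
have := snc_norm_le (pi * y); rewrite normrM (gtr0_norm pi0) (gtr0_norm y0).
have := sin_max (a * y); have := snc_norm_le1 (pi * y).
have := @pi_ge2 R; have := normr_ge0 (sin (a * y)); have := normr_ge0 (snc (pi * y)).
move: `|sin _| `|snc _| => A B A0 B0 p2 A1 B1 H.
have pb : b <= pi * y by nra.
have BA : B * b <= 1 by apply: le_trans H; rewrite ler_wpM2l.
by rewrite -mulrA (le_trans _ BA)// ler_piMl// mulr_ge0// ltW.
Qed.

Let trunc T := \int[mu]_(t in `[- T, T]) (cos (x * t + c) * phi m j t).

Let Q := sval (cid (ex_antiderivative continuous_q)).

Let dQ y : is_derive y (1 : R) Q (q y).
Proof. by rewrite /Q; case: cid. Qed.

Let QN y : Q (- y) = Q y.
Proof.
apply: (even_odd_antiderivative dQ) => z.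
by rewrite /q !mulrN sinN sncN mulNr.
Qed.

Let S4 T := Si ((pi + a) * (M * T - J)) + Si ((pi - a) * (M * T - J))
 + (Si ((pi + a) * (M * T + J)) + Si ((pi - a) * (M * T + J))).

Let truncE T : 0 <= T -> trunc T =
  (cos th * ((2 * pi)^-1 * S4 T) - sin th * (Q (M * T - J) - Q (M * T + J))) / Num.sqrt M.
Proof.
move=> T0.
have s0 : Num.sqrt M != 0 by rewrite gt_eqF// sqrtr_gt0.
have ssq : M = Num.sqrt M * Num.sqrt M by rewrite -expr2 sqr_sqrtr// ltW.
pose E t := (cos th * ((2 * pi)^-1 * (Si ((pi + a) * (M * t - J)) +
  Si ((pi - a) * (M * t - J)))) + - sin th * Q (M * t - J)).
have dy (t : R) : is_derive t (1 : R) (fun t => M * t - J) M.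
  have dC : is_derive t (1 : R) (fun=> - J) 0 by exact: is_derive_cst.
  have := derive_add (derive_scale M (is_derive_id t (1 : R))) dC.
  by rewrite mulr1 addr0.
have dE (t : R) : is_derive t (1 : R) (fun t => (Num.sqrt M)^-1 * E t)
    (cos (x * t + c) * phi m j t).
  have dS k := derive_comp (g := fun t => k * (M * t - J)) (is_derive_Si _) (derive_scale k (dy t)).
  have d1 := derive_scale (cos th) (derive_scale (2 * pi)^-1 (derive_add (dS (pi + a)) (dS (pi - a)))).
  have d2 := derive_scale (- sin th) (derive_comp (g := fun t => M * t - J) (dQ _) (dy t)).
  apply: (is_derive_ext (derive_scale (Num.sqrt M)^-1 (derive_add d1 d2))) => //.
  rewrite phiE -/M -/J.
  have -> : x * t + c = th + a * (M * t - J).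
    by rewrite /th /a; field; rewrite gt_eqF.
  rewrite (cosD th); set y := M * t - J.
  have := cos_snc a y; rewrite /q.
  move: (cos th) (sin th) (cos _) (sin (a * y)) => C1 C2 C3 C4.
  move: (snc (pi * y)) (snc ((pi + a) * y)) (snc ((pi - a) * y)) => B1 B2 B3 H.
  have -> : (C1 * C3 - C2 * C4) * (Num.sqrt M * B1) =
    Num.sqrt M * (C1 * (C3 * B1) - C2 * (C4 * B1)) by ring.
  rewrite H; apply: (mulfI s0); rewrite mulVKf// [RHS]mulrA -ssq.
  by move: (pi : R) => p; ring.
have cf : continuous (fun t => cos (x * t + c) * phi m j t).
  apply: continuous_mul_fun; last exact: continuous_phi.
  exact: (continuous_comp_fun (@continuous_cos R) (continuous_affine _ _)).
rewrite /trunc (Rintegral_antiderivative cf dE); last by rewrite lerNl (le_trans _ T0)// oppr_le0.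
have neg k : Si (k * (M * - T - J)) = - Si (k * (M * T + J)).
  by rewrite -SiN mulrN -opprD mulrN.
rewrite /E !neg -/M -/J (_ : M * - T - J = - (M * T + J)) ?QN; last by rewrite mulrN opprD.
by rewrite /S4 -mulrBr [RHS]mulrC; congr (_ * _); ring.
Qed.

Let Qdiff T : `|J| < M * T -> `|Q (M * T - J) - Q (M * T + J)| <= 2 * `|J| / (M * T - `|J|).
Proof.
move=> JT.
have b0 : 0 < M * T - `|J| by rewrite subr_gt0.
have Jn := ler_norm J; have JNn : - J <= `|J| by rewrite -normrN ler_norm.
rewrite [leRHS]mulrC; case: (leP 0 J) => J0.
  rewrite distrC.
  apply: (le_trans (antiderivative_dist_le (M := (M * T - `|J|)^-1) continuous_q dQ _ _)).
  - lra.
  - move=> y /andP[y1 _]; apply: q_le => //; lra.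
  rewrite ler_wpM2l ?invr_ge0 ?(ltW b0)//; lra.
apply: (le_trans (antiderivative_dist_le (M := (M * T - `|J|)^-1) continuous_q dQ _ _)).
- lra.
- move=> y /andP[y1 _]; apply: q_le => //; lra.
rewrite ler_wpM2l ?invr_ge0 ?(ltW b0)//; lra.
Qed.

(** The bound is uniform in x and T, as dominated convergence over a band of
    frequencies requires. *)
Lemma trunc_fourier_phi_le T : (`|J| + 1) / M <= T ->
  `|\int[mu]_(t in `[- T, T]) (cos (x * t + c) * phi m j t)| <= (8 + 2 * `|J|) / Num.sqrt M.
Proof.
move=> JT; have J1 : `|J| + 1 <= M * T by rewrite -ler_pdivrMl// mulrC.
have T0 : 0 <= T by rewrite (le_trans _ JT)// divr_ge0 ?ltW// addr_ge0.
have s0 : 0 < Num.sqrt M by rewrite sqrtr_gt0.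
rewrite -/(trunc T) (truncE T0) normrM normfV (gtr0_norm s0) ler_pM2r ?invr_gt0//.
apply: (le_trans (ler_normB _ _)); rewrite lerD//.
  rewrite normrM normrM normfV (@gtr0_norm _ (2 * pi)) ?mulr_gt0//.
  have S16 : `|S4 T| <= 16.
    rewrite /S4; apply: (le_trans (ler_normD _ _)).
    have := ler_normD (Si ((pi + a) * (M * T - J))) (Si ((pi - a) * (M * T - J))).
    have := ler_normD (Si ((pi + a) * (M * T + J))) (Si ((pi - a) * (M * T + J))).
    have := Si_norm_le ((pi + a) * (M * T + J)); have := Si_norm_le ((pi - a) * (M * T + J)).
    have := Si_norm_le ((pi + a) * (M * T - J)); have := Si_norm_le ((pi - a) * (M * T - J)).
    lra.
  have h : (2 * pi)^-1 * `|S4 T| <= 8.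
    rewrite ler_pdivrMl ?mulr_gt0//; have := @pi_ge2 R; lra.
  apply: le_trans h; rewrite ler_piMl ?cos_max//.
  by rewrite mulr_ge0// invr_ge0 mulr_ge0// ltW.
have JT' : `|J| < M * T by lra.
have := Qdiff JT'.
have : 2 * `|J| / (M * T - `|J|) <= 2 * `|J|.
  rewrite ler_pdivrMr; last lra.
  have := normr_ge0 J; nra.
move=> h1 h2; apply: le_trans h1; apply: le_trans h2.
by rewrite normrM ler_piMl// sin_max.
Qed.

(** Each sine integral tends to pi / 2 times the sign of pi + a or of pi - a,
    where a = x / m. The two contributions add up if |a| < pi and cancel if |a|
    > pi. The odd part is integrated over two intervals that nearly cancel: Q
    is even and its increments far out tend to 0. If |a| = pi one sine integral
    is constantly 0, and the limit is half of the value inside. *)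
Lemma cvg_trunc_fourier_phi : `|x| != pi * M ->
  \int[mu]_(t in `[- T, T]) (cos (x * t + c) * phi m j t) @[T --> +oo] -->
  if `|x| < pi * M then cos (x * J / M + c) / Num.sqrt M else 0.
Proof.
move=> xM.
have xa : x = a * M by rewrite /a divfK// gt_eqF.
have na : `|x| = `|a| * M by rewrite xa normrM (gtr0_norm M0).
have npa : pi + a != 0.
  apply: contra xM => /eqP h; rewrite na (_ : a = - pi); last by lra.
  by rewrite normrN gtr0_norm.
have nma : pi - a != 0.
  apply: contra xM => /eqP h; rewrite na (_ : a = pi); last by lra.
  by rewrite gtr0_norm.
have cS : S4 T @[T --> +oo] --> Num.sg (pi + a) * (pi / 2) + Num.sg (pi - a) * (pi / 2) +
  (Num.sg (pi + a) * (pi / 2) + Num.sg (pi - a) * (pi / 2)).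
  by apply: cvgD; apply: cvgD; exact: cvg_Si_affine.
have cQ : (Q (M * T - J) - Q (M * T + J)) @[T --> +oo] --> (0 : R).
  apply/(@cvgrPdist_le _ R^o) => e e0; near=> T; rewrite distrC subr0.
  have JT : `|J| + 2 * `|J| / e + 1 <= M * T.
    rewrite -ler_pdivrMl//; near: T; exact: nbhs_pinfty_ge.
  have Je : 0 <= 2 * `|J| / e by rewrite divr_ge0 ?mulr_ge0// ltW.
  have JT' : `|J| < M * T by lra.
  apply: (le_trans (Qdiff JT')).
  rewrite ler_pdivrMr ?subr_gt0// -ler_pdivrMl// mulrC; lra.
have : (cos th * ((2 * pi)^-1 * S4 T) - sin th * (Q (M * T - J) - Q (M * T + J))) /
    Num.sqrt M @[T --> +oo] -->
  (cos th * ((2 * pi)^-1 * (Num.sg (pi + a) * (pi / 2) + Num.sg (pi - a) * (pi / 2) +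
  (Num.sg (pi + a) * (pi / 2) + Num.sg (pi - a) * (pi / 2)))) - sin th * 0) / Num.sqrt M.
  apply: cvgM; last exact: cvg_cst.
  apply: cvgB; apply: cvgM => //; try exact: cvg_cst.
  by apply: cvgM => //; exact: cvg_cst.
rewrite mulr0 subr0 (_ : cos th * _ / Num.sqrt M =
    if `|x| < pi * M then cos (x * J / M + c) / Num.sqrt M else 0); last first.
  rewrite -/th na ltr_pM2r// ltr_norml.
  case: ifPn => [/andP[h1 h2]|].
    rewrite (gtr0_sg (x := pi + a)) ?(gtr0_sg (x := pi - a)); [|lra|lra].
    rewrite (_ : (2 * pi)^-1 * _ = 1) ?mulr1//.
    by move: (pi : R) (lt0r_neq0 pi0) => p p0; field.
  have [ap|an] := leP 0 a.
    move=> h; have h2 : pi < a.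
      rewrite ltNge; apply/negP => h2; move/negP: h; apply; apply/andP; split; first lra.
      by rewrite lt_neqAle h2 andbT; apply: contra nma => /eqP ->; rewrite subrr.
    rewrite (gtr0_sg (x := pi + a)) ?(ltr0_sg (x := pi - a)); [|lra|have := pi0; lra].
    by rewrite mulN1r mul1r subrr addr0 !mulr0 mul0r.
  move=> h; have h2 : a < - pi.
    rewrite ltNge; apply/negP => h2; move/negP: h; apply; apply/andP; split; last lra.
    by rewrite lt_neqAle h2 andbT; apply: contra npa => /eqP <-; rewrite subrr.
  rewrite (ltr0_sg (x := pi + a)) ?(gtr0_sg (x := pi - a)); [|have := pi0; lra|lra].
  by rewrite mulN1r mul1r addNr addr0 !mulr0 mul0r.
apply: cvg_trans; apply: near_eq_cvg; near=> T.
by rewrite -truncE.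
Unshelve. all: by end_near. Qed.

End fourier_phi.
Arguments continuous_scale {R}.
Arguments continuous_affine {R}.

(** * Limits of truncated integrals *)

Section truncated_integrals.
Context {R : realType}.
Local Notation mu := (@lebesgue_measure R).

(** The integrals may be infinite or undefined; Tonelli is applied to the
    positive and to the negative part. *)
Lemma measurable_integral_param d1 d2 (T1 : measurableType d1) (T2 : measurableType d2)
    (m2 : {sigma_finite_measure set T2 -> \bar R}) (D : set T2) (f : T1 * T2 -> R) :
  measurable D -> measurable_fun setT f ->
  measurable_fun setT (fun x => \int[m2]_(y in D) f (x, y)).
Proof.
move=> mD mf.
pose h (z : T1 * T2) := (\1_D z.2 * f z)%:E.
have mh : measurable_fun setT h.
  apply/measurable_EFinP; apply: measurable_funM => //.
  by apply: measurableT_comp => //; exact: measurable_indic.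
have hE x : (\int[m2]_(y in D) (f (x, y))%:E = \int[m2]_y h^\+ (x, y) - \int[m2]_y h^\- (x, y))%E.
  transitivity (\int[m2]_y h (x, y))%E; last first.
    by rewrite integralE; congr (_ - _)%E; apply: eq_integral => y _; rewrite ?funeposE ?funenegE.
  rewrite integral_mkcond.
  apply: eq_integral => y _; rewrite patchE /h/= indicE.
  by case: ifP; rewrite ?mul1r ?mul0r.
apply: (@measurableT_comp _ _ _ _ _ _ fine) => //.
rewrite [X in measurable_fun _ X](_ : _ =
    (fun x => \int[m2]_y h^\+ (x, y) - \int[m2]_y h^\- (x, y)))%E; last by apply/funext.
apply: emeasurable_funB.
  apply: (@measurable_fun_fubini_tonelli_F _ _ _ _ _ m2 (h^\+)%E) => //.
  exact: measurable_funepos.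
apply: (@measurable_fun_fubini_tonelli_F _ _ _ _ _ m2 (h^\-)%E) => //.
exact: measurable_funeneg.
Qed.

Lemma cvg_EFin_fun (u : nat -> R) (l : R) :
  u @ \oo --> l -> (u n)%:E @[n --> \oo] --> l%:E.
Proof. by move=> ul; apply: cvg_EFin => //; near=> n. Unshelve. all: by end_near. Qed.

Lemma cvg_trunc_integral (h : R -> R) : mu.-integrable setT (EFin \o h) ->
  \int[mu]_(t in `[- T, T]) h t @[T --> +oo] --> \int[mu]_t h t.
Proof.
move=> ih; apply/cvg_pinftyP => u uoo.
have [mh _] := integrableP _ _ _ ih.
pose f_ n := (EFin \o h) \_ `[- u n, u n].
have [_ _ H] : [/\ mu.-integrable setT (EFin \o h),
    [sequence \int[mu]_(x in setT) `|f_ n x - (EFin \o h) x|]_n @ \oo --> 0%E &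
    [sequence \int[mu]_(x in setT) (f_ n x)]_n @ \oo --> (\int[mu]_(x in setT) (EFin \o h) x)%E]%E.
  apply: (@dominated_convergence _ _ _ mu setT measurableT f_ (EFin \o h) (abse \o (EFin \o h))).
  - move=> n; apply/(measurable_restrictT _ _).1 => //.
    exact: measurable_funTS.
  - exact: mh.
  - apply: aeW => x _; apply: cvg_near_cst.
    have [N _ HN] : \forall n \near \oo, `|x| <= u n.
      by move/cvgryPge : uoo; exact.
    exists N => // n /HN xu; rewrite /f_ patchE ifT// inE/= in_itv/=.
    by rewrite -ler_norml.
  - exact: integrable_abse.
  - apply: aeW => x n _; rewrite /f_ patchE; case: ifP => // _.
    by rewrite abse0 abse_ge0.
have E n : (\int[mu]_x f_ n x)%E = (\int[mu]_(t in `[(- u n)%R, u n]) (h t)%:E)%E.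
  by rewrite -integral_mkcond.
apply: fine_cvg; rewrite -/(Rintegral _ _ _) fineK; last exact: integrable_fin_num.
by under eq_fun do rewrite -E.
Qed.

(** Monotone convergence along [-n, n]; that the integral over the line is
    finite is part of the conclusion. *)
Lemma trunc_integral_cvg (h : R -> R) (l : R) : (forall t, 0 <= h t) ->
  measurable_fun setT h -> (forall n : nat, mu.-integrable `[- n%:R, n%:R] (EFin \o h)) ->
  \int[mu]_(t in `[- n%:R, n%:R]) h t @[n --> \oo] --> l ->
  (\int[mu]_t (h t)%:E = l%:E)%E.
Proof.
move=> h0 mh ih hl.
pose F (n : nat) : set (measurableTypeR R) := `[- n%:R, n%:R]%classic.
have FT : \bigcup_i F i = setT.
  rewrite -subTset => x _; exists (Num.truncn `|x|).+1 => //=.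
  by rewrite /F/= in_itv/= -ler_norml ltW// truncnS_gt.
have H' : (fun i => \int[mu]_(x in F i) (EFin \o h) x)%E @ \oo -->
   (\int[mu]_x (EFin \o h) x)%E.
  rewrite -[X in (\int[mu]_(x in X) _ x)%E]FT; apply: ge0_nondecreasing_set_cvg_integral => //.
  - apply/nondecreasing_seqP => n; rewrite subsetEset; apply: subset_itv;
      by rewrite bnd_simp ?lerN2 ler_nat.
  - by move=> i; exact: measurable_itv.
  - by move=> i; apply: measurable_funTS; exact/measurable_EFinP.
  - by move=> i x _; rewrite /= lee_fin.
apply: (cvg_unique _ H') => //.
apply: cvg_EFin; last exact: hl.
by near=> n; apply: integrable_fin_num; [exact: measurable_itv|exact: ih].
Unshelve. all: by end_near. Qed.

Lemma continuous_trunc_bounded (f : R -> R) (a b : R) : continuous f ->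
  exists2 K, 0 <= K & forall x, a <= x <= b -> `|f x| <= K.
Proof.
move=> cf; have [ab|ba] := leP a b; last first.
  by exists 0 => // x /andP[ax xb]; have := le_trans ax xb; rewrite leNgt ba.
have cn : {within `[a, b], continuous (fun x => `|f x|)}.
  apply: continuous_subspaceT => x.
  by apply: continuous_comp; [exact: cf|exact: norm_continuous].
have [c _ cM] := EVT_max ab cn.
by exists `|f c| => // x xab; apply: cM; rewrite in_itv/=.
Qed.

Lemma Rintegral_itv_oo (f : R -> R) (a b : R) : measurable_fun setT f ->
  \int[mu]_(t in `[a, b]) f t = \int[mu]_(t in `]a, b[) f t.
Proof.
move=> mf; rewrite /Rintegral integral_itv_bndoo//.
by apply: measurable_funTS; exact/measurable_EFinP.
Qed.

Lemma bounded_convergence_itv (f_ : nat -> R -> R) (f : R -> R) (a b K : R) :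
  (forall n, measurable_fun setT (f_ n)) -> measurable_fun setT f ->
  (forall n x, a < x < b -> `|f_ n x| <= K) ->
  (forall x, a < x < b -> f_ n x @[n --> \oo] --> f x) ->
  \int[mu]_(t in `[a, b]) f_ n t @[n --> \oo] --> \int[mu]_(t in `[a, b]) f t.
Proof.
move=> mf_ mf bf cf.
rewrite Rintegral_itv_oo//; under eq_fun do rewrite Rintegral_itv_oo//.
have iK : mu.-integrable `]a, b[ (cst K%:E).
  apply: (@integrableS _ _ _ mu `[a, b]) => //; first exact: subset_itv_oo_cc.
  by apply: (@continuous_integrable_itv _ (cst K)) => x; exact: cvg_cst.
have [i _ H] : [/\ mu.-integrable `]a, b[ (EFin \o f),
    [sequence \int[mu]_(x in `]a, b[) `|(EFin \o f_ n) x - (EFin \o f) x|]_n @ \oo --> 0%E &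
    [sequence \int[mu]_(x in `]a, b[) ((EFin \o f_ n) x)]_n @ \oo -->
      (\int[mu]_(x in `]a, b[) (EFin \o f) x)%E]%E.
  apply: (@dominated_convergence _ _ _ mu `]a, b[ _ (fun n => EFin \o f_ n) (EFin \o f) (cst K%:E)) => //.
  - by move=> n /=; apply: measurable_funTS; apply/measurable_EFinP; exact: mf_.
  - by apply: measurable_funTS; exact/measurable_EFinP.
  - apply: aeW => x /=; rewrite in_itv/= => xab; exact: cvg_EFin_fun (cf x xab).
  - apply: aeW => x n /=; rewrite in_itv/= => xab; rewrite lee_fin; exact: bf.
apply: fine_cvg; rewrite -/(Rintegral _ _ _) fineK//.
exact: integrable_fin_num.
Qed.

End truncated_integrals.

(** * Orthonormality *)

Section orthonormal.
Context {R : realType}.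
Local Notation mu := (@lebesgue_measure R).

Lemma integral_cos_scale (b A : R) : 0 <= A ->
  \int[mu]_(t in `[- A, A]) cos (b * t) = 2 * A * snc (b * A).
Proof.
move=> A0; have cf : continuous (fun t => cos (b * t)).
  exact: (continuous_comp_fun (@continuous_cos R) (continuous_scale b)).
have AA : - A <= A by rewrite (le_trans _ A0)// oppr_le0.
have [b0|b0] := eqVneq b 0.
  rewrite {}b0 in cf *; rewrite mul0r /snc eqxx mulr1.
  have d (x : R) : is_derive x (1 : R) id (cos (0 * x)).
    by rewrite mul0r cos0; exact: is_derive_id.
  by rewrite (Rintegral_antiderivative cf d AA) opprK; ring.
have d (x : R) : is_derive x (1 : R) (fun t => b^-1 * sin (b * t)) (cos (b * x)).
  have d := derive_comp (g := fun t => b * t) (is_derive_sin _) (derive_scale b (is_derive_id x (1 : R))).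
  by apply: (is_derive_ext (derive_scale b^-1 d)) => //; field.
rewrite (Rintegral_antiderivative cf d AA) mulrN sinN -sncE.
by move: (snc _) => B; field.
Qed.

Lemma sin_pi_int (k : int) : sin (pi * k%:~R) = 0 :> R.
Proof.
have h n : sin (pi * n%:R) = 0 :> R.
  by rewrite mulr_natr -[pi *+ n]add0r (alternatingn (@sinDpi R)) sin0 mulr0.
by case: (intP k) => [|n|n]; rewrite ?mulr0 ?sin0// ?rmorphN/= ?mulrN ?sinN h ?oppr0.
Qed.

Lemma integral_cos_int (m : nat) (k : int) : (0 < m)%N ->
  \int[mu]_(t in `[- (pi * m%:R), pi * m%:R]) cos (k%:~R / m%:R * t) =
  (k == 0)%:R * (2 * pi * m%:R).
Proof.
move=> m0; rewrite integral_cos_scale ?mulr_ge0 ?pi_ge0//.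
have M0 : (m%:R : R) != 0 by rewrite pnatr_eq0 -lt0n.
have -> : k%:~R / m%:R * (pi * m%:R) = pi * k%:~R :> R by field.
rewrite /snc mulf_eq0 (gt_eqF (pi_gt0 R))/= intr_eq0 sin_pi_int mul0r.
by case: eqP; rewrite ?mulr1 ?mul1r ?mulr0 ?mul0r// mulrA.
Qed.

Variable (m : nat).
Hypothesis m0 : (0 < m)%N.
Let M : R := m%:R.
Let A := pi * M.
Let M0 : 0 < M. Proof. by rewrite /M ltr0n. Qed.
Let A0 : 0 <= A. Proof. by rewrite mulr_ge0 ?pi_ge0// ltW. Qed.
Let s0 : Num.sqrt M != 0. Proof. by rewrite gt_eqF// sqrtr_gt0. Qed.

(** phi m j is the inverse Fourier transform of an exponential cut off at
    frequency pi m; the band being symmetric, only the cosine remains. *)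
Lemma phi_fourier (j : int) (y : R) : phi m j y =
  (2 * pi * Num.sqrt M)^-1 *
  \int[mu]_(t in `[- A, A]) cos (t * y - t * j%:~R / M).
Proof.
have -> : \int[mu]_(t in `[- A, A]) cos (t * y - t * j%:~R / M) =
  \int[mu]_(t in `[- A, A]) cos ((y - j%:~R / M) * t).
  by apply: eq_Rintegral => t _; congr cos; field; rewrite gt_eqF.
rewrite integral_cos_scale// phiE -/M /A.
have -> : (y - j%:~R / M) * (pi * M) = pi * (M * y - j%:~R) by field; rewrite gt_eqF.
have ssq : M = Num.sqrt M * Num.sqrt M by rewrite -expr2 sqr_sqrtr// ltW.
move: (snc _) => B; move: (pi : R) (gt_eqF (pi_gt0 R)) => p p0.
by rewrite [in RHS](mulrA 2) {3}ssq; field; rewrite s0 p0.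
Qed.

Let cint (j : int) (n : nat) (x c : R) :=
  \int[mu]_(t in `[- n%:R, n%:R]) (cos (x * t + c) * phi m j t).

Let continuous_freq (t b : R) : continuous (fun x : R => cos (x * t - x * b / M)).
Proof.
rewrite (_ : (fun x : R => _) = fun x => cos ((t - b / M) * x)).
  exact: (continuous_comp_fun (@continuous_cos R) (continuous_scale _)).
by apply/funext => x; congr cos; ring.
Qed.

Let trunc_inner (j l : int) (n : nat) :
  \int[mu]_(t in `[- n%:R, n%:R]) (phi m j t * phi m l t) =
  (2 * pi * Num.sqrt M)^-1 * \int[mu]_(x in `[- A, A]) cint j n x (- (x * l%:~R / M)).
Proof.
pose f (z : R * R) := cos (z.2 * z.1 - z.2 * l%:~R / M) * phi m j z.1.
have mf : measurable_fun setT f.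
  apply: measurable_funM.
    apply: measurableT_comp; first exact: (continuous_measurable_fun (@continuous_cos R)).
    apply: measurable_funB; first exact: measurable_funM.
    by apply: measurable_funM => //; exact: measurable_funM.
  by apply: measurableT_comp => //; exact: (continuous_measurable_fun (@continuous_phi R m j)).
have i2 t : mu.-integrable `[- A, A] (fun x => (f (t, x))%:E).
  apply: continuous_integrable_itv.
  have ck : continuous (fun _ : R => phi m j t) by move=> x; exact: cvg_cst.
  exact: (continuous_mul_fun (@continuous_freq t l%:~R) ck).
have i1 x : mu.-integrable `[- n%:R, n%:R] (fun t => (f (t, x))%:E).
  apply: continuous_integrable_itv; apply: continuous_mul_fun; last exact: continuous_phi.
  exact: (continuous_comp_fun (@continuous_cos R) (continuous_affine x (- (x * l%:~R / M)))).
have [K K0 HK] := continuous_trunc_bounded (- n%:R) n%:R (@continuous_phi R m j).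
have fin : (\int[mu]_(t in `[(- n%:R)%R, n%:R]) \int[mu]_(x in `[(- A)%R, A]) `|f (t, x)|%:E < +oo)%E.
  apply: (@le_lt_trans _ _ (\int[mu]_(t in `[(- n%:R)%R, n%:R]) (cst (\int[mu]_(x in `[(- A)%R, A]) (cst K%:E) x)) t)%E).
    apply: le_integral_ge0 => t /=; first by move=> _; apply: integral_ge0 => x _; rewrite lee_fin.
    rewrite in_itv/= => tn; apply: le_integral_ge0 => x _; first by rewrite lee_fin.
    by rewrite lee_fin normrM (le_trans _ (HK t tn))// ler_piMl// cos_max.
  rewrite integral_cst//= integral_cst//= !lebesgue_measure_itv/=.
  by do 2 case: ifP => _; rewrite ?mule0 ?mul0e ?mule0// -?EFinB -?EFinM ltry.
rewrite -(@Fubini_in _ _ _ _ _ mu mu `[- n%:R, n%:R] `[- A, A] f _ _ mf fin)//.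
have k0 : 2 * pi * Num.sqrt M != 0 by rewrite !mulf_neq0// gt_eqF// pi_gt0.
have -> : \int[mu]_(t in `[- n%:R, n%:R]) \int[mu]_(x in `[- A, A]) f (t, x) =
  \int[mu]_(t in `[- n%:R, n%:R]) (2 * pi * Num.sqrt M * (phi m j t * phi m l t)).
  apply: eq_Rintegral => t _; rewrite /f/= RintegralZr//; last first.
    exact/continuous_integrable_itv/continuous_freq.
  by rewrite (phi_fourier l) [RHS]mulrCA mulVKf// mulrC.
rewrite RintegralZl ?mulKf//.
by apply: continuous_integrable_itv; apply: continuous_mul_fun; exact: continuous_phi.
Qed.

(** Inserting phi_fourier for one factor turns the truncated inner product into
    an integral over the band of truncated Fourier transforms of the other
    factor. These converge boundedly to an exponential, and the exponentials of
    indices j and l are orthogonal on the band. *)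
Lemma cvg_trunc_inner_phi (j l : int) :
  \int[mu]_(t in `[- n%:R, n%:R]) (phi m j t * phi m l t) @[n --> \oo] --> ((j == l)%:R : R).
Proof.
under eq_fun do rewrite trunc_inner.
have -> : ((j == l)%:R : R) = (2 * pi * Num.sqrt M)^-1 *
    \int[mu]_(x in `[- A, A]) (cos ((j - l)%:~R / M * x) * (Num.sqrt M)^-1).
  rewrite RintegralZr//; last first.
    apply: continuous_integrable_itv.
    exact: (continuous_comp_fun (@continuous_cos R) (continuous_scale _)).
  rewrite /A /M integral_cos_int// subr_eq0 -/M.
  have ssq : M = Num.sqrt M * Num.sqrt M by rewrite -expr2 sqr_sqrtr// ltW.
  case: eqP => _; last by rewrite mul0r mul0r mulr0.
  rewrite mul1r (_ : 2 * pi * M = 2 * pi * Num.sqrt M * Num.sqrt M); last first.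
    by rewrite -[RHS]mulrA -ssq.
  by rewrite mulfK// mulVf// !mulf_neq0// gt_eqF// pi_gt0.
apply: cvgM; first exact: cvg_cst.
(* from N on, the truncation level is in the range of trunc_fourier_phi_le *)
pose N := (Num.truncn ((`|j%:~R| + 1) / M : R)).+1.
rewrite -(cvg_shiftn N).
apply: (@bounded_convergence_itv _ _ _ _ _ ((8 + 2 * `|j%:~R|) / Num.sqrt M)).
- move=> n.
  pose f (z : R * R) := cos (z.1 * z.2 - z.1 * l%:~R / M) * phi m j z.2.
  apply: (@measurable_integral_param _ _ _ _ _ mu `[- (n + N)%:R, (n + N)%:R] f) => //.
  apply: measurable_funM.
    apply: measurableT_comp; first exact: (continuous_measurable_fun (@continuous_cos R)).
    apply: measurable_funB; first exact: measurable_funM.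
    by apply: measurable_funM => //; exact: measurable_funM.
  by apply: measurableT_comp => //; exact: (continuous_measurable_fun (@continuous_phi R m j)).
- apply: measurable_funM => //; apply: continuous_measurable_fun.
  exact: (continuous_comp_fun (@continuous_cos R) (continuous_scale _)).
- move=> n x _; apply: trunc_fourier_phi_le => //.
  rewrite ltW// (lt_le_trans (truncnS_gt _))// ler_nat leq_addl//.
- move=> x /andP[x1 x2].
  have xA : `|x| < pi * M by rewrite ltr_norml -/A x1.
  have := @cvg_trunc_fourier_phi _ _ j x (- (x * l%:~R / M)) m0 (negbT (lt_eqF xA)).
  rewrite xA => /cvg_pinftyP /(_ (fun n => (n + N)%:R)) H.
  rewrite (_ : cos _ * _ = cos (x * j%:~R / M - x * l%:~R / M) / Num.sqrt M).
    apply: H; rewrite (cvg_shiftn N (fun n => n%:R : R)); exact: cvgr_idn.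
  by rewrite rmorphB/=; congr (cos _ / _); ring.
Qed.

Lemma integral_phi_sqr (j : int) : (\int[mu]_t (phi m j t ^+ 2)%:E = 1%:E)%E.
Proof.
apply: trunc_integral_cvg.
- by move=> t; exact: sqr_ge0.
- by apply: measurable_funX; apply: continuous_measurable_fun; exact: continuous_phi.
- move=> n; apply: continuous_integrable_itv.
  rewrite (_ : (fun x => _) = fun x => phi m j x * phi m j x); last first.
    by apply/funext => x; rewrite expr2.
  by apply: continuous_mul_fun; exact: continuous_phi.
- rewrite (_ : (fun n : nat => _) = (fun n : nat =>
    \int[mu]_(t in `[- n%:R, n%:R]) (phi m j t * phi m j t))); last first.
    by apply/funext => n; apply: eq_Rintegral => t _; rewrite expr2.
  by have := @cvg_trunc_inner_phi j j; rewrite eqxx.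
Qed.

Lemma integrable_phi_sqr (j : int) : mu.-integrable setT (fun t => (phi m j t ^+ 2)%:E).
Proof.
apply/integrableP; split.
  apply: continuous_measurable_EFin.
  rewrite (_ : (fun x => _) = fun x => phi m j x * phi m j x); last first.
    by apply/funext => x; rewrite expr2.
  by apply: continuous_mul_fun; exact: continuous_phi.
apply: (@le_lt_trans _ _ 1%E); last exact: ltry.
rewrite -(integral_phi_sqr j); apply: le_integral_ge0 => // t _.
by rewrite lee_fin ger0_norm// sqr_ge0.
Qed.

Lemma integrable_phi_mul (j l : int) : mu.-integrable setT (fun t => (phi m j t * phi m l t)%:E).
Proof.
apply: (le_integrable _ _ _ (integrableD _ (integrable_phi_sqr j) (integrable_phi_sqr l))) => //.
  by apply: continuous_measurable_EFin; apply: continuous_mul_fun; exact: continuous_phi.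
move=> t _ /=; rewrite lee_fin [leRHS]ger0_norm ?addr_ge0 ?sqr_ge0//.
rewrite normrM -[phi m j t ^+ 2]real_normK ?num_real// -[phi m l t ^+ 2]real_normK ?num_real//.
have := normr_ge0 (phi m j t); have := normr_ge0 (phi m l t); nra.
Qed.

Lemma inner_phi (j l : int) : inner (phi m j) (phi m l) = ((j == l)%:R : R).
Proof.
have := cvg_trunc_integral (integrable_phi_mul j l).
move=> /cvg_pinftyP /(_ _ cvgr_idn) H.
exact: (cvg_unique _ H (@cvg_trunc_inner_phi j l)).
Qed.

End orthonormal.

(** * Inner products of real square integrable functions *)

Section L2.
Context d (T : measurableType d) (R : realType).
Variables (nu : {measure set T -> \bar R}) (D : set T).
Hypothesis mD : measurable D.

(** The measure and the domain are parameters: the same algebra serves the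
    line, the band of frequencies and the probability space. *)
Definition L2 (f : T -> R) : Prop :=
  measurable_fun D f /\ nu.-integrable D (fun x => (f x ^+ 2)%:E).

Definition ip (f g : T -> R) : R := \int[nu]_(x in D) (f x * g x).

Lemma L2_mul_integrable (f g : T -> R) : L2 f -> L2 g ->
  nu.-integrable D (fun x => (f x * g x)%:E).
Proof.
move=> [mf f2] [mg g2]; apply: (le_integrable _ _ _ (integrableD _ f2 g2)) => //.
  by apply/measurable_EFinP; exact: measurable_funM.
move=> t _ /=; rewrite lee_fin [leRHS]ger0_norm ?addr_ge0 ?sqr_ge0//.
rewrite normrM -[f t ^+ 2]real_normK ?num_real// -[g t ^+ 2]real_normK ?num_real//.
have := normr_ge0 (f t); have := normr_ge0 (g t); nra.
Qed.

Lemma L2_add (f g : T -> R) : L2 f -> L2 g -> L2 (fun x => f x + g x).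
Proof.
move=> Lf Lg; have [mf f2] := Lf; have [mg g2] := Lg.
split; first exact: measurable_funD.
have fg := integrableZl mD 2 (L2_mul_integrable Lf Lg).
have := integrableD mD (integrableD mD f2 g2) fg.
by apply: eq_integrable => // x _ /=; rewrite -EFinM -!EFinD; congr EFin; ring.
Qed.

Lemma L2_scale (k : R) (f : T -> R) : L2 f -> L2 (fun x => k * f x).
Proof.
move=> [mf f2]; split; first exact: measurable_funM.
have := integrableZl mD (k ^+ 2) f2.
by apply: eq_integrable => // x _ /=; rewrite -EFinM exprMn.
Qed.

Lemma L2_sub (f g : T -> R) : L2 f -> L2 g -> L2 (fun x => f x - g x).
Proof.
move=> Lf Lg; have := L2_add Lf (L2_scale (-1) Lg).
by under [X in L2 X -> _]eq_fun do rewrite mulN1r.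
Qed.

Lemma L2_0 : L2 (fun=> 0).
Proof.
split; first exact: measurable_cst.
by under eq_fun do rewrite expr0n/=; exact: integrable0.
Qed.

Lemma L2_sum (I : Type) (s : seq I) (c : I -> R) (e : I -> T -> R) :
  (forall i, L2 (e i)) -> L2 (fun x => \sum_(i <- s) c i * e i x).
Proof.
move=> Le; elim: s => [|i s IH].
  by under eq_fun do rewrite big_nil; exact: L2_0.
by under eq_fun do rewrite big_cons; apply: L2_add => //; exact: L2_scale.
Qed.

Lemma ipC f g : ip f g = ip g f.
Proof. by apply: eq_Rintegral => x _; rewrite mulrC. Qed.

Lemma ipDl f g h : L2 f -> L2 g -> L2 h ->
  ip (fun x => f x + g x) h = ip f h + ip g h.
Proof.
move=> Lf Lg Lh; rewrite /ip -RintegralD//; try exact: L2_mul_integrable.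
by apply: eq_Rintegral => x _; rewrite mulrDl.
Qed.

Lemma ipZl k f h : L2 f -> L2 h -> ip (fun x => k * f x) h = k * ip f h.
Proof.
move=> Lf Lh; rewrite /ip -RintegralZl//; last exact: L2_mul_integrable.
by apply: eq_Rintegral => x _; rewrite mulrA.
Qed.

Lemma ipBl f g h : L2 f -> L2 g -> L2 h ->
  ip (fun x => f x - g x) h = ip f h - ip g h.
Proof.
move=> Lf Lg Lh; rewrite -mulN1r -ipZl// -ipDl//; last exact: L2_scale.
by apply: eq_Rintegral => x _; rewrite mulN1r.
Qed.

Lemma ipBr f g h : L2 f -> L2 g -> L2 h ->
  ip h (fun x => f x - g x) = ip h f - ip h g.
Proof. by move=> Lf Lg Lh; rewrite ipC ipBl// !(ipC h). Qed.

Lemma ip_pythagoras f g : L2 f -> L2 g -> ip f g = 0 ->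
  ip (fun x => f x + g x) (fun x => f x + g x) = ip f f + ip g g.
Proof.
move=> Lf Lg fg; have Lfg := L2_add Lf Lg.
have E h : L2 h -> ip h (fun x => f x + g x) = ip h f + ip h g.
  by move=> Lh; rewrite ipC ipDl// !(ipC _ h).
by rewrite (ipDl Lf Lg Lfg) !E// (ipC g f) fg addr0 add0r.
Qed.

Lemma ip_suml (I : Type) (s : seq I) (c : I -> R) (e : I -> T -> R) h :
  (forall i, L2 (e i)) -> L2 h ->
  ip (fun x => \sum_(i <- s) c i * e i x) h = \sum_(i <- s) c i * ip (e i) h.
Proof.
move=> Le Lh; elim: s => [|i s IH].
  rewrite big_nil /ip (@eq_Rintegral _ _ _ _ _ (cst 0)); last first.
    by move=> x _; rewrite big_nil mul0r.
  by rewrite /Rintegral integral0.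
rewrite big_cons -IH -ipZl// -ipDl//; [|exact: L2_scale|exact: L2_sum].
by apply: eq_Rintegral => x _; rewrite big_cons.
Qed.

Lemma ip_ge0 f : 0 <= ip f f.
Proof. by apply: Rintegral_ge0 => x _; rewrite -expr2 sqr_ge0. Qed.

(** No orthogonality is assumed: both Bessel inequalities below and the
    variance of an empirical mean are instances. *)
Lemma ip_sub_sum (I : Type) (s : seq I) (c : I -> R) (e : I -> T -> R) f :
  (forall i, L2 (e i)) -> L2 f ->
  let h x := f x - \sum_(i <- s) c i * e i x in
  ip h h = ip f f - 2 * \sum_(i <- s) c i * ip f (e i) +
    \sum_(i <- s) c i * \sum_(k <- s) c k * ip (e i) (e k).
Proof.
move=> Le Lf h; have LS := L2_sum s c Le.
rewrite /h ipBl//; last exact: L2_sub.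
rewrite !ipBr// (ipC f) ip_suml// ip_suml//.
have -> : \sum_(i <- s) c i * ip (e i) (fun x => \sum_(i <- s) c i * e i x) =
   \sum_(i <- s) c i * \sum_(k <- s) c k * ip (e i) (e k).
  apply: eq_bigr => i _; rewrite ipC ip_suml//; congr (_ * _).
  by apply: eq_bigr => k _; rewrite ipC.
have -> : \sum_(i <- s) c i * ip (e i) f = \sum_(i <- s) c i * ip f (e i).
  by apply: eq_bigr => i _; rewrite ipC.
ring.
Qed.

End L2.

(** * Auxiliary sums *)

Section sums.
Context {R : realType}.

Lemma sum_kronecker (I : eqType) (s : seq I) (c : I -> R) (k : R) i :
  uniq s -> i \in s -> \sum_(l <- s) c l * (k * (i == l)%:R) = c i * k.
Proof.
move=> us si; rewrite (bigD1_seq i)//= eqxx mulr1 big1 ?addr0// => l li.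
by rewrite eq_sym (negbTE li) !mulr0.
Qed.

Lemma sum_subset_le (I : eqType) (s s' : seq I) (F : I -> R) :
  uniq s -> uniq s' -> {subset s <= s'} -> (forall i, 0 <= F i) ->
  \sum_(i <- s) F i <= \sum_(i <- s') F i.
Proof.
move=> us us' ss' F0.
rewrite (perm_big [seq x <- s' | x \in s])/=; last first.
  apply: uniq_perm => //; first exact: filter_uniq.
  move=> x; rewrite mem_filter; case: (boolP (x \in s)) => //= xs.
  by rewrite ss'.
rewrite big_filter big_mkcond/=; apply: ler_sum => i _.
by case: ifP => // _; exact: F0.
Qed.

(** 1 / i^2 <= 1 / (i - 1) - 1 / i telescopes. *)
Lemma sum_inv_sqr_iota (k N : nat) : (0 < k)%N ->
  \sum_(i <- iota k.+1 N) (i%:R ^+ 2)^-1 <= k%:R^-1 - (k + N)%:R^-1 :> R.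
Proof.
move=> k0; elim: N => [|N IH]; first by rewrite big_nil addn0 subrr.
rewrite -[N.+1]addn1 iotaD big_cat/= big_seq1 (le_trans (lerD IH (lexx _)))//.
rewrite addnA addn1 addSn.
have x0 : (0 : R) < (k + N)%:R by rewrite ltr0n addn_gt0 k0.
rewrite -[(k + N).+1]addn1 (natrD _ (k + N)); move: ((k + N)%:R : R) x0 => x x0.
have h : ((x + 1) ^+ 2)^-1 <= x^-1 - (x + 1)^-1.
  have -> : x^-1 - (x + 1)^-1 = (x * (x + 1))^-1.
    by field; apply/andP; split; rewrite gt_eqF//; lra.
  by rewrite lef_pV2 ?posrE ?mulr_gt0 ?exprn_gt0 ?addr_gt0// expr2 ler_wpM2r//; lra.
lra.
Qed.

Lemma sum_inv_sqr_int (k : nat) (s : seq int) : (0 < k)%N -> uniq s ->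
  (forall j, j \in s -> (k < `|j|)%N) ->
  \sum_(j <- s) (j%:~R ^+ 2)^-1 <= 2 / k%:R :> R.
Proof.
move=> k0 us ks.
pose N := (\max_(j <- s) `|j|)%N.
pose s' := [seq Posz i | i <- iota k.+1 N] ++ [seq - Posz i | i <- iota k.+1 N].
have us' : uniq s'.
  rewrite cat_uniq !map_inj_uniq ?iota_uniq//=; last 2 first.
  - by move=> x y /oppr_inj [].
  - by move=> x y [].
  rewrite andbT; apply/hasPn => _ /mapP[i + ->]; rewrite mem_iota => /andP[ki _].
  by apply/negP => /mapP[l _]; case: i ki.
have ss' : {subset s <= s'}.
  move=> j js; have kj := ks j js.
  have jN : (`|j| <= N)%N by rewrite /N; exact: leq_bigmax_seq.
  have jI : `|j|%N \in iota k.+1 N by rewrite mem_iota kj/= addSn ltnS (leq_trans jN)// leq_addl.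
  rewrite mem_cat; case: (intP j) jI => [|i|i] jI; apply/orP.
  - by left; apply/mapP; exists 0%N.
  - by left; apply/mapP; exists i.+1.
  - by right; apply/mapP; exists i.+1 => //; rewrite absz_nat in jI *.
apply: (le_trans (sum_subset_le us us' ss' _)).
  by move=> i; rewrite invr_ge0 sqr_ge0.
rewrite big_cat !big_map/=.
under [X in _ + X]eq_bigr do rewrite rmorphN/= sqrrN.
have := sum_inv_sqr_iota N k0.
have : 0 <= (k + N)%:R^-1 :> R by rewrite invr_ge0.
under eq_bigr do rewrite -pmulrn.
by move=> h1 h2; rewrite mulrDl !mul1r; apply: lerD; apply: (le_trans h2); rewrite lerBlDr lerDl.
Qed.

End sums.

(** * Projection on the span of the shifted sinc functions *)

Section projection.
Context {R : realType}.
Local Notation mu := (@lebesgue_measure R).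
Local Notation L2 := (L2 mu setT).
Local Notation ip := (ip mu setT).

Lemma L2_Lfun (f : R -> R) : f \in Lfun mu 2%:E -> L2 f.
Proof.
move=> fL; split; last exact: Lfun2_integrable_sqr.
by move: fL; rewrite inE => /andP[+ _]; rewrite inE.
Qed.

Lemma sqnormE (f : R -> R) : L2 f -> sqnorm f = (ip f f)%:E.
Proof.
move=> [mf f2]; rewrite /sqnorm /ip /Rintegral.
under [X in _ = (fine X)%:E]eq_integral do rewrite -expr2.
by rewrite fineK// integrable_fin_num.
Qed.

Variable m : nat.
Hypothesis m0 : (0 < m)%N.

Definition comb (b : int -> R) (s : seq int) (x : R) := \sum_(j <- s) b j * phi m j x.

Lemma L2_phi (j : int) : L2 (phi m j).
Proof.
split; last exact: integrable_phi_sqr.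
by apply: continuous_measurable_fun; exact: continuous_phi.
Qed.

Lemma L2_comb b s : L2 (comb b s).
Proof. by apply: L2_sum => // j; exact: L2_phi. Qed.

Lemma ip_sub_comb (f : R -> R) b s : L2 f -> uniq s ->
  ip (fun x => f x - comb b s x) (fun x => f x - comb b s x) =
  ip f f - 2 * \sum_(j <- s) b j * ip f (phi m j) + \sum_(j <- s) b j ^+ 2.
Proof.
move=> Lf us; have := ip_sub_sum measurableT s b L2_phi Lf; rewrite /= => ->; congr (_ + _).
rewrite big_seq [RHS]big_seq; apply: eq_bigr => j js.
transitivity (b j * \sum_(k <- s) b k * (1 * (j == k)%:R)).
  by congr (_ * _); apply: eq_bigr => k _; rewrite mul1r; congr (_ * _); exact: inner_phi.
by rewrite sum_kronecker// mulr1 expr2.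
Qed.

Lemma bessel_phi (f : R -> R) s : L2 f -> uniq s ->
  \sum_(j <- s) ip f (phi m j) ^+ 2 <= ip f f.
Proof.
move=> Lf us.
have := ip_ge0 mu setT (fun x => f x - comb (fun j => ip f (phi m j)) s x).
rewrite ip_sub_comb//; under eq_bigr do rewrite -expr2; lra.
Qed.

Lemma ip_comb b s : uniq s -> ip (comb b s) (comb b s) = \sum_(j <- s) b j ^+ 2.
Proof.
move=> us; have := ip_sub_comb b (L2_0 mu setT) us.
have z f : ip (fun=> 0) f = 0.
  rewrite /ip (@eq_Rintegral _ _ _ _ _ (cst 0)); last by move=> x _; rewrite mul0r.
  by rewrite /Rintegral integral0.
under [X in _ - 2 * X]eq_bigr do rewrite z mulr0.
rewrite z big1// mulr0 subrr add0r => <-.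
by apply: eq_Rintegral => x _; rewrite !sub0r mulrNN.
Qed.

Lemma comb_extend b s s' : uniq s -> uniq s' -> {subset s <= s'} ->
  comb b s = comb (fun j => if j \in s then b j else 0) s'.
Proof.
move=> us us' ss'; apply/funext => x; rewrite /comb.
rewrite (perm_big [seq x <- s' | x \in s])/=; last first.
  apply: uniq_perm => //; first exact: filter_uniq.
  by move=> y; rewrite mem_filter; case: (boolP (y \in s)) => //= ys; rewrite ss'.
rewrite big_filter big_mkcond/=; apply: eq_bigr => j _.
by case: ifP => //; rewrite mul0r.
Qed.

(** The coefficients are indexed by the integers themselves, so a repeated
    index amounts to a multiplicity. *)
Lemma lin_span_comb (J : set int) t : lin_span m J t ->
  exists s b, [/\ uniq s, (forall j, j \in s -> J j) & t = comb b s].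
Proof.
move=> [s [a [sJ ->]]].
exists (undup s), (fun j => (count_mem j s)%:R * a j); split.
- exact: undup_uniq.
- by move=> j; rewrite mem_undup; exact: sJ.
- apply/funext => x; rewrite /comb -big_undup_iterop_count/=.
  apply: eq_bigr => j _; rewrite -mulrA; move: (count_mem j s) => n.
  by rewrite Monoid.iteropE mulr_natl; elim: n => //= n ->; rewrite mulrS.
Qed.

Lemma comb_lin_span (J : set int) b s : (forall j, j \in s -> J j) ->
  lin_span m J (comb b s).
Proof. by move=> sJ; exists s, b. Qed.

Lemma Lfun_L2 (f : R -> R) : L2 f -> f \in Lfun mu 2%:E.
Proof.
move=> [mf f2]; rewrite inE; apply/andP; split; first by rewrite inE.
rewrite inE/= /finite_norm unlock poweR_lty//.
have -> : (\int[mu]_x `|(EFin \o f) x| `^ 2 = \int[mu]_x (f x ^+ 2)%:E)%E.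
  by apply: eq_integral => x _ /=; rewrite powR_mulrn// -normrX ger0_norm// sqr_ge0.
by have := integrable_lty measurableT f2.
Qed.

Lemma sqnorm_ext (f h : R -> R) : f =1 h -> sqnorm f = sqnorm h.
Proof. by move=> fh; apply: eq_integral => x _; rewrite fh. Qed.

Lemma sub_comb_S_closed f b s : uniq s -> S_closed m f ->
  S_closed m (fun x => f x - comb b s x).
Proof.
move=> us [fL fS]; split.
  by apply: Lfun_L2; apply: L2_sub => //; [exact: L2_Lfun|exact: L2_comb].
move=> e /fS [_ /lin_span_comb[u [c [uu _ ->]]] h].
pose v := undup (u ++ s).
have uv : uniq v by exact: undup_uniq.
have Ec := @comb_extend c u v uu uv _; have Es := @comb_extend b s v us uv _.
exists (fun x => comb c u x - comb b s x).
  exists v, (fun j => (if j \in u then c j else 0) - (if j \in s then b j else 0)); split=> //.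
  apply/funext => x; rewrite Ec ?Es; last 2 first.
  - by move=> j ju; rewrite mem_undup mem_cat ju orbT.
  - by move=> j ju; rewrite mem_undup mem_cat ju.
  by rewrite /comb -sumrB; apply: eq_bigr => j _; rewrite mulrBl.
rewrite (sqnorm_ext (h := f \- comb c u))// => x /=.
by rewrite opprB addrA subrK.
Qed.

Lemma comb_S_closed b s : uniq s -> S_closed m (comb b s).
Proof.
move=> us; split; first by apply: Lfun_L2; exact: L2_comb.
move=> e e0; exists (comb b s); first exact: comb_lin_span.
rewrite (sqnorm_ext (h := fun=> 0)); last by move=> x /=; rewrite subrr.
rewrite /sqnorm (eq_integral (fun=> 0%E)) ?integral0 ?lte_fin//.
by move=> x _; rewrite expr0n.
Qed.

(** As g - gm is orthogonal to S_m, the functions g and gm have the same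
    coefficients a_j, and |g - t|^2 = |g - gm|^2 + |gm - t|^2 for t in S_m. For
    t = comb b s, the last term is at most the sum of (b_j - a_j)^2 over s plus
    a sum of a_j^2 off s: gm is a limit of finite combinations, so |gm|^2 is at
    most the supremum of the finite sums of a_j^2. *)
Lemma section_risk (g gm : R -> R) (B : R) (b : int -> R) (s : seq int) :
  L2 g -> is_orth_proj (S_closed m) g gm -> uniq s ->
  (forall u, uniq u -> (forall j, j \in u -> j \notin s) ->
     \sum_(j <- u) ip g (phi m j) ^+ 2 <= B) ->
  (sqnorm (g \- comb b s)%R <= sqnorm (g \- gm)%R +
    (B + \sum_(j <- s) (b j - ip g (phi m j)) ^+ 2)%:E)%E.
Proof.
move=> Lg [Sgm orth] us HB.
have Lgm : L2 gm by have [gL _] := Sgm; exact: L2_Lfun.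
have LD : L2 (g \- gm)%R by exact: L2_sub.
have Lc := L2_comb b s.
have Ldc : L2 (fun x => gm x - comb b s x) by exact: L2_sub.
have ga (j : int) : ip gm (phi m j) = ip g (phi m j).
  have Sj : S_closed m (phi m j : R -> R).
    have E : comb (fun=> 1) [:: j] = phi m j.
      by apply/funext => x; rewrite /comb big_seq1 mul1r.
    rewrite -E; exact: comb_S_closed.
  have := orth _ Sj; rewrite -[inner _ _]/(ip (fun x => g x - gm x) (phi m j)).
  by rewrite ipBl//; [lra|exact: L2_phi].
have -> : sqnorm (g \- comb b s)%R = (sqnorm (g \- gm)%R + sqnorm (fun x => gm x - comb b s x)%R)%E.
  rewrite (sqnorm_ext (h := fun x => (g x - gm x) + (gm x - comb b s x))); last first.
    by move=> x /=; rewrite addrA subrK.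
  rewrite !sqnormE//; last exact: L2_add.
  rewrite -EFinD; congr EFin.
  apply: (ip_pythagoras measurableT LD Ldc).
  by apply: (orth (fun x => gm x - comb b s x)); exact: sub_comb_S_closed.
apply: leeD => //.
rewrite sqnormE// lee_fin; apply/ler_addgt0Pr => e e0.
have [_ H] := Sgm; have [_ /lin_span_comb[u [c [uu _ ->]]]] := H e e0.
pose v := undup (u ++ s).
have uv : uniq v by exact: undup_uniq.
rewrite (comb_extend c uu uv); last by move=> j ju; rewrite mem_undup mem_cat ju.
set c' := fun j => _.
rewrite sqnormE; last by apply: L2_sub => //; exact: L2_comb.
rewrite lte_fin ip_sub_comb// => Hv; rewrite ip_sub_comb//.
have h3 (t : seq int) (a : int -> R) : \sum_(j <- t) (a j - ip g (phi m j)) ^+ 2 =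
   \sum_(j <- t) a j ^+ 2 - 2 * \sum_(j <- t) a j * ip gm (phi m j) + \sum_(j <- t) ip g (phi m j) ^+ 2.
  rewrite mulr_sumr -sumrB -big_split/=; apply: eq_bigr => j _.
  by rewrite ga; ring.
have h1 : ip gm gm - \sum_(j <- v) ip g (phi m j) ^+ 2 < e.
  apply: le_lt_trans Hv; have := h3 v c'.
  have : 0 <= \sum_(j <- v) (c' j - ip g (phi m j)) ^+ 2 by apply: sumr_ge0 => j _; exact: sqr_ge0.
  lra.
have h2 : \sum_(j <- v) ip g (phi m j) ^+ 2 <= B + \sum_(j <- s) ip g (phi m j) ^+ 2.
  rewrite (bigID (mem s))/= addrC lerD//.
    rewrite -big_filter; apply: HB; first exact: filter_uniq.
    by move=> j; rewrite mem_filter => /andP[].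
  rewrite -big_filter; apply: sum_subset_le => //; first exact: filter_uniq.
    by move=> j; rewrite mem_filter => /andP[].
  by move=> j; rewrite sqr_ge0.
have := h3 s b; lra.
Qed.

(** Multiplying phi m j by pi (m x - j) leaves sqrt m sin (pi (m x - j)), so j
    a_j = m <x g, phi m j> - (sqrt m / pi) c_j with |c_j| <= 1. By (X - Y)^2 <=
    2 X^2 + 2 Y^2, with j^2 >= 4 k in front of the first square and pi >= 2 in
    the second, a_j^2 <= m^2 / (2 k) <x g, phi m j>^2 + m / (2 j^2). Bessel for
    x g sums the first terms, and the sum of 1 / j^2 over |j| > k is at most 2
    / k. *)
Lemma tail_coef (g : R -> R) (M2 : R) (k : nat) (s : seq int) :
  (0 < k)%N -> L2 g -> (forall x, 0 <= g x) -> (\int[mu]_x (g x)%:E = 1)%E ->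
  (\int[mu]_x (x ^+ 2 * g x ^+ 2)%:E < M2%:E)%E ->
  uniq s -> (forall j, j \in s -> (k < `|j|)%N) ->
  \sum_(j <- s) ip g (phi m j) ^+ 2 <= m%:R ^+ 2 * (M2 + 1) / k%:R.
Proof.
move=> k0 Lg g0 g1 xg us ks.
have [mg g2] := Lg.
have mid : measurable_fun setT (fun x : R => x * g x) by exact: measurable_funM.
have E2 : (\int[mu]_x ((x * g x) ^+ 2)%:E = \int[mu]_x (x ^+ 2 * g x ^+ 2)%:E)%E.
  by apply: eq_integral => x _; rewrite exprMn.
have Lxg : L2 (fun x => x * g x).
  split => //; apply/integrableP; split.
    by apply/measurable_EFinP; exact: measurable_funX.
  apply: (le_lt_trans _ (lt_trans xg (ltry M2))); rewrite -E2.
  by apply: le_integral_ge0 => // x _; rewrite lee_fin ger0_norm// sqr_ge0.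
have nxg : ip (fun x => x * g x) (fun x => x * g x) <= M2.
  by rewrite -lee_fin -sqnormE// /sqnorm E2 ltW.
have ig : mu.-integrable setT (EFin \o g).
  apply/integrableP; split; first exact/measurable_EFinP.
  apply: (@le_lt_trans _ _ 1%E); last exact: ltry.
  by rewrite -g1; apply: le_integral_ge0 => // x _; rewrite lee_fin ger0_norm.
pose c (j : int) := \int[mu]_x (sin (pi * (m%:R * x - j%:~R)) * g x).
have isg (j : int) : mu.-integrable setT (fun x => (sin (pi * (m%:R * x - j%:~R)) * g x)%:E).
  apply: (le_integrable _ _ _ ig) => //.
    apply/measurable_EFinP; apply: measurable_funM => //.
    apply: continuous_measurable_fun; apply: (continuous_comp_fun (@continuous_sin R)).
    exact: (continuous_comp_fun (continuous_scale pi) (continuous_affine _ _)).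
  by move=> x _ /=; rewrite lee_fin normrM ler_piMl// sin_max.
have cle (j : int) : `|c j| <= 1.
  apply: (le_trans (le_normr_Rintegral measurableT (isg j))).
  rewrite [leRHS](_ : 1 = \int[mu]_x g x); last by rewrite /Rintegral g1.
  apply: le_Rintegral => //; first exact: (integrable_norm (isg j)).
  by move=> x _; rewrite normrM (ger0_norm (g0 x)) ler_piMl// sin_max.
have key (j : int) : j%:~R * ip g (phi m j) =
   m%:R * ip (fun x => x * g x) (phi m j) - Num.sqrt m%:R / pi * c j.
  rewrite /ip /c -!RintegralZl//; try exact: isg;
    try by apply: L2_mul_integrable => //; exact: L2_phi.
  rewrite -RintegralB//; last 2 first.
  - have := L2_mul_integrable measurableT (L2_scale measurableT m%:R Lxg) (L2_phi j).
    by apply: eq_integrable => // x _ /=; rewrite -mulrA.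
  - have := integrableZl measurableT (Num.sqrt m%:R / pi) (isg j).
    by apply: eq_integrable => // x _ /=; rewrite EFinM.
  apply: eq_Rintegral => x _; rewrite phiE -sncE.
  move: (snc _) (Num.sqrt _) (gt_eqF (pi_gt0 R)) => B r; move: (pi : R) => p p0.
  by field; rewrite p0.
have h (j : int) : j \in s -> ip g (phi m j) ^+ 2 <=
   m%:R ^+ 2 / (2 * k%:R) * ip (fun x => x * g x) (phi m j) ^+ 2 + m%:R / 2 * (j%:~R ^+ 2)^-1.
  move=> js.
  have kj : (k%:R : R) + 1 <= `|j%:~R|.
    by rewrite natr1 -intr_norm -abszE -pmulrn ler_nat ks.
  have j2 : (k%:R + 1) ^+ 2 <= j%:~R ^+ 2 :> R.
    by rewrite -[leRHS]real_normK ?num_real// lerXn2r ?nnegrE// addr_ge0.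
  have k1 : (1 : R) <= k%:R by rewrite ler1n.
  have j4 : 4 * k%:R <= j%:~R ^+ 2 :> R.
    by apply: le_trans j2; have := sqr_ge0 (k%:R - 1 : R); lra.
  have jp : (0 : R) < j%:~R ^+ 2 by apply: lt_le_trans j4; lra.
  have r2 : Num.sqrt m%:R ^+ 2 = m%:R :> R by rewrite sqr_sqrtr.
  have e1 : (j%:~R * ip g (phi m j)) ^+ 2 <=
     2 * m%:R ^+ 2 * ip (fun x => x * g x) (phi m j) ^+ 2 + m%:R / 2.
    rewrite key; set X := m%:R * _; set Y := _ / pi * _.
    have Y2 : Y ^+ 2 <= m%:R / 4.
      rewrite /Y !exprMn r2 -mulrA ler_wpM2l// exprVn -[_^-1]mul1r.
      rewrite mulrAC ler_pdivrMr ?exprn_gt0 ?pi_gt0// mul1r.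
      have c1 : c j ^+ 2 <= 1 by rewrite -[leLHS]real_normK ?num_real// expr_le1.
      have p2 : 2 ^+ 2 <= pi ^+ 2 :> R by rewrite lerXn2r ?nnegrE ?pi_ge0 ?pi_ge2.
      lra.
    have -> : 2 * m%:R ^+ 2 * ip (fun x => x * g x) (phi m j) ^+ 2 = 2 * X ^+ 2.
      by rewrite /X; move: (ip _ _) => I; ring.
    have := sqr_ge0 (X + Y); lra.
  rewrite exprMn in e1.
  have -> : ip g (phi m j) ^+ 2 = (j%:~R ^+ 2 * ip g (phi m j) ^+ 2) * (j%:~R ^+ 2)^-1.
    by rewrite mulrAC mulfV ?mul1r// gt_eqF.
  apply: (le_trans (ler_wpM2r (ltW _) e1)); first by rewrite invr_gt0.
  rewrite mulrDl lerD2r mulrAC ler_wpM2r ?sqr_ge0//.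
  rewrite mulrAC mulrC ler_wpM2l ?exprn_ge0// ler_pdivrMr// ler_pdivlMl; lra.
apply: (@le_trans _ _ (\sum_(j <- s) (m%:R ^+ 2 / (2 * k%:R) * ip (fun x => x * g x) (phi m j) ^+ 2 + m%:R / 2 * (j%:~R ^+ 2)^-1))).
  by rewrite big_seq [leRHS]big_seq; apply: ler_sum => j; exact: h.
rewrite big_split/= -!mulr_sumr.
have k0' : (0 : R) < k%:R by rewrite ltr0n.
have h1 : m%:R ^+ 2 / (2 * k%:R) * \sum_(j <- s) ip (fun x => x * g x) (phi m j) ^+ 2 <= m%:R ^+ 2 / k%:R * M2.
  have b1 := bessel_phi Lxg us.
  have b2 : 0 <= \sum_(j <- s) ip (fun x => x * g x) (phi m j) ^+ 2 by apply: sumr_ge0 => j _; exact: sqr_ge0.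
  have A0 : 0 <= m%:R ^+ 2 / (2 * k%:R) :> R by rewrite divr_ge0 ?exprn_ge0// mulr_ge0.
  have A1 : m%:R ^+ 2 / (2 * k%:R) <= m%:R ^+ 2 / k%:R :> R.
    by rewrite ler_wpM2l ?exprn_ge0// lef_pV2 ?posrE ?mulr_gt0// ler_peMl ?ler1n// ltW.
  by apply: ler_pM => //; apply: le_trans b1 nxg.
have h2 : m%:R / 2 * \sum_(j <- s) (j%:~R ^+ 2)^-1 <= m%:R ^+ 2 / k%:R :> R.
  have h3 := @sum_inv_sqr_int R k s k0 us ks.
  have m2 : 0 <= m%:R / 2 :> R by rewrite divr_ge0.
  apply: (le_trans (ler_wpM2l m2 h3)).
  have -> : m%:R / 2 * (2 / k%:R) = m%:R / k%:R :> R by field; rewrite gt_eqF.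
  by rewrite ler_pM2r ?invr_gt0// expr2 ler_peMl// ler1n.
have -> : m%:R ^+ 2 * (M2 + 1) / k%:R = m%:R ^+ 2 / k%:R * M2 + m%:R ^+ 2 / k%:R.
  by field; rewrite gt_eqF.
exact: lerD.
Qed.

End projection.

(** * From indicators to bounded measurable functions *)

Section layer_cake.
Context d (T : measurableType d) (R : realType).

Definition bounded_measurable (f : T -> R) : Prop :=
  measurable_fun setT f /\ exists K, forall x, `|f x| <= K.

Lemma bm_cst (k : R) : bounded_measurable (fun=> k).
Proof. by split; [exact: measurable_cst|exists `|k|]. Qed.

Lemma bm_add (f g : T -> R) : bounded_measurable f -> bounded_measurable g ->
  bounded_measurable (fun x => f x + g x).
Proof.
move=> [mf [K fK]] [mg [L gL]]; split; first exact: measurable_funD.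
by exists (K + L) => x; rewrite (le_trans (ler_normD _ _))// lerD.
Qed.

Lemma bm_mul (f g : T -> R) : bounded_measurable f -> bounded_measurable g ->
  bounded_measurable (fun x => f x * g x).
Proof.
move=> [mf [K fK]] [mg [L gL]]; split; first exact: measurable_funM.
by exists (K * L) => x; rewrite normrM ler_pM.
Qed.

Lemma bm_scale (k : R) (f : T -> R) : bounded_measurable f ->
  bounded_measurable (fun x => k * f x).
Proof. by move=> bf; apply: bm_mul => //; exact: bm_cst. Qed.

Lemma bm_sub (f g : T -> R) : bounded_measurable f -> bounded_measurable g ->
  bounded_measurable (fun x => f x - g x).
Proof.
move=> bf bg; have := bm_add bf (bm_scale (-1) bg).
by under [X in bounded_measurable X -> _]eq_fun do rewrite mulN1r.
Qed.

Lemma bm_indic (A : set T) : measurable A -> bounded_measurable (\1_A : T -> R).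
Proof.
move=> mA; split; first exact: measurable_indic.
by exists 1 => x; rewrite indicE; case: (_ \in _); rewrite ?normr1 ?normr0.
Qed.

Lemma bm_sum (I : Type) (s : seq I) (f : I -> T -> R) :
  (forall i, bounded_measurable (f i)) ->
  bounded_measurable (fun x => \sum_(i <- s) f i x).
Proof.
move=> bf; elim: s => [|i s IH].
  by under eq_fun do rewrite big_nil; exact: bm_cst.
by under eq_fun do rewrite big_cons; exact: bm_add.
Qed.

Definition level (N i : nat) (h : T -> R) : set T := [set x | i.+1%:R / N%:R <= h x].

(** A lower approximation in which all N level sets have the same weight 1 / N:
    a functional bounded by S on indicators is then bounded by S on it. *)
Definition staircase (N : nat) (h : T -> R) (x : T) : R :=
  \sum_(i <- iota 0 N) N%:R^-1 * \1_(level N i h) x.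

Lemma measurable_level N i h : measurable_fun setT h -> measurable (level N i h).
Proof.
move=> mh; have := mh measurableT `[i.+1%:R / N%:R, +oo[%classic (measurable_itv _).
by rewrite setTI; congr measurable; apply/seteqP; split => x; rewrite /level/= in_itv/= andbT.
Qed.

Lemma staircase_dist N h x : (0 < N)%N -> 0 <= h x <= 1 ->
  `|h x - staircase N h x| <= N%:R^-1.
Proof.
move=> N0 /andP[h0 h1]; have N0' : (0 : R) < N%:R by rewrite ltr0n.
pose t := Num.truncn (N%:R * h x).
have Nh : 0 <= N%:R * h x by rewrite mulr_ge0// ltW.
have tN : (t <= N)%N.
  rewrite -(ler_nat R) (le_trans _ (_ : N%:R * h x <= N%:R))//.
    by rewrite truncn_le.
  by rewrite ler_piMr// ltW.
have -> : staircase N h x = t%:R / N%:R.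
  rewrite /staircase -mulr_sumr mulrC; congr (_ / _).
  transitivity (\sum_(i <- iota 0 N) ((i < t)%N%:R : R)).
    apply: eq_bigr => i _; rewrite indicE; congr (nat_of_bool _)%:R.
    apply/idP/idP.
      by rewrite inE /level/= ler_pdivrMr// mulrC truncn_ge_nat.
    by rewrite truncn_ge_nat// => H; rewrite inE /level/= ler_pdivrMr// mulrC.
  rewrite -natr_sum; congr (_%:R).
  rewrite -[in X in iota _ X](subnKC tN) iotaD big_cat/= add0n.
  have -> : (\sum_(i <- iota 0 t) (i < t) = \sum_(i <- iota 0 t) 1)%N.
    by apply: eq_big_seq => i; rewrite mem_iota add0n => /andP[_ ->].
  rewrite sum1_size size_iota big1_seq ?addn0// => i /andP[_].
  by rewrite mem_iota => /andP[ti _]; rewrite ltnNge ti.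
have /andP[t1 t2] := truncn_itv Nh.
rewrite -(ler_pM2l N0') mulfV ?gt_eqF// -{1}(gtr0_norm N0') -normrM mulrBr.
rewrite mulrCA mulfV ?gt_eqF// mulr1 ger0_norm ?subr_ge0//.
by rewrite lerBlDr (le_trans (ltW t2))// -natr1 addrC.
Qed.

Lemma bm_staircase N h : measurable_fun setT h -> bounded_measurable (staircase N h).
Proof.
by move=> mh; apply: bm_sum => i; apply/bm_scale/bm_indic; exact: measurable_level.
Qed.

(** Continuity for the supremum norm. The constant C serves the passage to the
    limit from staircases. *)
Definition linear_bounded (Phi : (T -> R) -> R) : Prop :=
  [/\ forall f g, bounded_measurable f -> bounded_measurable g ->
        Phi (fun x => f x + g x) = Phi f + Phi g,
      forall k f, bounded_measurable f -> Phi (fun x => k * f x) = k * Phi f &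
      exists2 C : R, 0 <= C & forall (f : T -> R) (K : R), measurable_fun setT f -> (forall x, `|f x| <= K) ->
        `|Phi f| <= C * K].

Lemma linear_bounded_sub (Phi Psi : (T -> R) -> R) :
  linear_bounded Phi -> linear_bounded Psi -> linear_bounded (fun f => Phi f - Psi f).
Proof.
move=> [Phi1 Phi2 [C C0 Phi3]] [Psi1 Psi2 [D D0 Psi3]]; split.
- by move=> f g bf bg; rewrite Phi1// Psi1//; ring.
- by move=> k f bf; rewrite Phi2// Psi2// mulrBr.
- exists (C + D); first exact: addr_ge0.
  by move=> f K mf fK; rewrite (le_trans (ler_normB _ _))// mulrDl lerD ?Phi3 ?Psi3.
Qed.

Lemma layer_bound_unit (Phi : (T -> R) -> R) (S : R) (h : T -> R) : linear_bounded Phi ->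
  (forall A, measurable A -> `|Phi \1_A| <= S) ->
  measurable_fun setT h -> (forall x, 0 <= h x <= 1) -> `|Phi h| <= S.
Proof.
move=> [Phi1 Phi2 [C C0 Phi3]] PhiS mh h01.
apply/ler_addgt0Pr => e e0.
pose N := (Num.truncn (C / e)).+1.
have N0 : (0 < N)%N by [].
have CN : C * N%:R^-1 <= e.
  rewrite ler_pdivrMr ?ltr0n// mulrC -ler_pdivrMr// ltW// /N truncnS_gt//.
have bs := bm_staircase N mh.
have bh : bounded_measurable h.
  by split => //; exists 1 => x; have /andP[? ?] := h01 x; rewrite ger0_norm.
have -> : h = (fun x => staircase N h x + (h x - staircase N h x)).
  by apply/funext => x; rewrite addrC subrK.
have bd := bm_sub bh bs.
rewrite Phi1//; apply: (le_trans (ler_normD _ _)); apply: lerD; last first.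
  apply: le_trans CN; apply: Phi3; first by have [] := bd.
  by move=> x; apply: staircase_dist.
have sumE (s : seq nat) : `|Phi (fun x => \sum_(i <- s) N%:R^-1 * \1_(level N i h) x)| <= (size s)%:R * (N%:R^-1 * S).
  elim: s => [|i s IH].
    under eq_fun do rewrite big_nil.
    rewrite (_ : (fun=> 0) = (fun x => 0 * (cst 0) x :> R)); last by apply/funext => x; rewrite mul0r.
    by rewrite Phi2 ?mul0r ?normr0//; exact: bm_cst.
  under eq_fun do rewrite big_cons.
  have bi : bounded_measurable (fun x => N%:R^-1 * \1_(level N i h) x).
    by apply/bm_scale/bm_indic; exact: measurable_level.
  rewrite Phi1//; last first.
    by apply: bm_sum => l; apply/bm_scale/bm_indic; exact: measurable_level.
  rewrite (le_trans (ler_normD _ _))//= -natr1 mulrDl addrC lerD// mul1r.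
  rewrite Phi2; last by apply/bm_indic; exact: measurable_level.
  by rewrite normrM ger0_norm ?invr_ge0// ler_wpM2l ?invr_ge0// PhiS//; exact: measurable_level.
have := sumE (iota 0 N); rewrite size_iota mulVKf ?pnatr_eq0//.
Qed.

(** The factor 2 is the length of [-1, 1]: h is rescaled to (h + 1) / 2, and
    Phi does not see the added constant. *)
Lemma layer_bound (Phi : (T -> R) -> R) (S : R) (h : T -> R) : linear_bounded Phi ->
  (forall A, measurable A -> `|Phi \1_A| <= S) -> Phi (fun=> 1) = 0 ->
  measurable_fun setT h -> (forall x, `|h x| <= 1) -> `|Phi h| <= 2 * S.
Proof.
move=> lPhi PhiS Phi0 mh h1.
pose h' x := 2^-1 * (h x + 1).
have bh : bounded_measurable h by split => //; exists 1.
have b1 := bm_cst 1.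
have mh' : measurable_fun setT h' by have [] := bm_scale 2^-1 (bm_add bh b1).
have h01 x : 0 <= h' x <= 1 by have := h1 x; rewrite ler_norml /h'; lra.
have := layer_bound_unit lPhi PhiS mh' h01.
have [Phi1 Phi2 _] := lPhi.
rewrite /h' Phi2 ?Phi1 ?Phi0//; last exact: bm_add.
by rewrite addr0 normrM ger0_norm ?invr_ge0// ler_pdivrMl.
Qed.

(** The case S = 0 of layer_bound for the difference, in place of a monotone
    class argument. *)
Lemma agree_on_indic (Phi Psi : (T -> R) -> R) (h : T -> R) :
  linear_bounded Phi -> linear_bounded Psi ->
  (forall A, measurable A -> Phi \1_A = Psi \1_A) ->
  measurable_fun setT h -> (forall x, `|h x| <= 1) -> Phi h = Psi h.
Proof.
move=> lPhi lPsi PhiPsi mh h1; apply/eqP; rewrite -subr_eq0 -normr_eq0 eq_le normr_ge0 andbT.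
have := @layer_bound _ 0 h (linear_bounded_sub lPhi lPsi) _ _ mh h1.
rewrite mulr0; apply.
  by move=> A mA; rewrite PhiPsi// subrr normr0.
rewrite (_ : (fun=> 1) = \1_setT) ?PhiPsi ?subrr//.
by apply/funext => x; rewrite indicE in_setT.
Qed.

Lemma bm_integrable (nu : {measure set T -> \bar R}) (f : T -> R) :
  (nu setT < +oo)%E -> bounded_measurable f -> nu.-integrable setT (EFin \o f).
Proof.
move=> nuT [mf [K fK]]; apply: measurable_bounded_integrable => //.
exists K; split; first exact: num_real.
by move=> M KM x _; rewrite /= (le_trans (fK x))// ltW.
Qed.

End layer_cake.

(** * Expectations *)

Section expectations.
Context d d' (T : measurableType d) (S : measurableType d') (R : realType).
Local Notation mu := (@lebesgue_measure R).

Lemma linear_bounded_integral (nu : {measure set T -> \bar R}) (Y : T -> S) (k : T -> R) :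
  measurable_fun setT Y -> nu.-integrable setT (EFin \o k) ->
  linear_bounded (fun f : S -> R => \int[nu]_w (f (Y w) * k w)).
Proof.
move=> mY ik.
have mk : measurable_fun setT k by have [+ _] := integrableP _ _ _ ik => /measurable_EFinP.
have ifk (f : S -> R) (K : R) : measurable_fun setT f -> (forall x, `|f x| <= K) ->
    nu.-integrable setT (EFin \o (fun w => f (Y w) * k w)).
  move=> mf fK.
  apply: (le_integrable _ _ _ (integrableZl _ K ik)) => //.
    by apply/measurable_EFinP; apply: measurable_funM => //; exact: measurableT_comp.
  move=> w _ /=; rewrite lee_fin !normrM ler_wpM2r//.
  by rewrite (le_trans (fK _))// ler_norm.
split.
- move=> f g [mf [K fK]] [mg [L gL]].
  rewrite -RintegralD//; [|exact: (ifk _ K)|exact: (ifk _ L)].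
  by apply: eq_Rintegral => w _; rewrite mulrDl.
- move=> c f [mf [K fK]]; rewrite -RintegralZl//; last exact: (ifk _ K).
  by apply: eq_Rintegral => w _; rewrite mulrA.
- exists (\int[nu]_w `|k w|); first by apply: Rintegral_ge0.
  move=> f K mf fK; apply: (le_trans (le_normr_Rintegral measurableT (ifk f K mf fK))).
  rewrite mulrC -RintegralZl//; last exact: (integrable_norm ik).
  apply: le_Rintegral => //.
  + exact: (integrable_norm (ifk f K mf fK)).
  + have := integrableZl measurableT K (integrable_norm ik).
    by apply: eq_integrable.
  + by move=> w _; rewrite normrM ler_wpM2r.
Qed.

Lemma linear_bounded_scale (Phi : (S -> R) -> R) (c : R) :
  linear_bounded Phi -> linear_bounded (fun f => Phi f * c).
Proof.
move=> [Phi1 Phi2 [C C0 Phi3]]; split.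
- by move=> f g bf bg; rewrite Phi1// mulrDl.
- by move=> k f bf; rewrite Phi2// mulrA.
- exists (C * `|c|); first exact: mulr_ge0.
  by move=> f K mf fK; rewrite normrM mulrAC ler_wpM2r// Phi3.
Qed.

End expectations.

Section probability_tools.
Context d (T : measurableType d) (R : realType) (P : probability T R).
Local Notation mu := (@lebesgue_measure R).
Implicit Types (Y U V : T -> R) (p q h : R -> R).

Lemma prob_integrable (f : T -> R) : bounded_measurable f -> P.-integrable setT (EFin \o f).
Proof.
move=> bf; apply: bm_integrable => //.
by apply: (@le_lt_trans _ _ 1%E); [exact: probability_le1|exact: ltry].
Qed.

Lemma bm_comp Y h : measurable_fun setT Y -> measurable_fun setT h -> (forall x, `|h x| <= 1) ->
  bounded_measurable (fun w => h (Y w)).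
Proof. by move=> mY mh h1; split; [exact: measurableT_comp|exists 1]. Qed.

Lemma Rintegral_indic_comp Y (A : set R) (k : T -> R) :
  \int[P]_w (\1_A (Y w) * k w) = \int[P]_(w in Y @^-1` A) k w.
Proof.
rewrite [RHS]Rintegral_mkcond; apply: eq_Rintegral => w _; rewrite patchE indicE.
have -> : (w \in Y @^-1` A) = (Y w \in A).
  by apply/idP/idP; rewrite !inE.
by case: ifP => _; rewrite ?mul1r ?mul0r.
Qed.

Lemma Rintegral_prob1 (A : set T) : measurable A -> \int[P]_(w in A) (1 : R) = fine (P A).
Proof. by move=> mA; rewrite Rintegral_cst// mul1r. Qed.

(** Both sides are bounded linear functionals of p, and of q, so the product
    rule extends from indicators one factor at a time. *)
Lemma expectation_prod_indep U V p q :
  measurable_fun setT U -> measurable_fun setT V ->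
  (forall A B, measurable A -> measurable B ->
     P (U @^-1` A `&` V @^-1` B) = (P (U @^-1` A) * P (V @^-1` B))%E) ->
  measurable_fun setT p -> (forall x, `|p x| <= 1) ->
  measurable_fun setT q -> (forall x, `|q x| <= 1) ->
  \int[P]_w (p (U w) * q (V w)) = \int[P]_w p (U w) * \int[P]_w q (V w).
Proof.
move=> mU mV ind mp p1 mq q1.
have mpre (W : T -> R) (A : set R) : measurable_fun setT W -> measurable A -> measurable (W @^-1` A).
  by move=> mW mA; rewrite -[X in measurable X]setTI; exact: mW.
have i1 : P.-integrable setT (EFin \o (fun _ : T => 1 : R)) by apply: prob_integrable; exact: (@bm_cst _ T R 1).
have iq (A : set R) : measurable A -> P.-integrable setT (EFin \o (fun w => \1_A (V w))).
  move=> mA; apply: prob_integrable; apply: (@bm_comp V \1_A) => //.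
  by move=> x; rewrite indicE; case: (_ \in _); rewrite ?normr1 ?normr0.
have E1 (W : T -> R) (A : set R) : measurable_fun setT W -> measurable A -> \int[P]_w \1_A (W w) = fine (P (W @^-1` A)).
  move=> mW mA; rewrite -Rintegral_prob1; last exact: mpre.
  rewrite -(Rintegral_indic_comp W A (fun=> 1)).
  by apply: eq_Rintegral => w _; rewrite mulr1.
(* p is extended first, against an indicator in place of q *)
have step1 (B : set R) : measurable B ->
    \int[P]_w (p (U w) * \1_B (V w)) = \int[P]_w p (U w) * \int[P]_w \1_B (V w).
  move=> mB; have L1 := linear_bounded_integral mU (iq B mB).
  have := linear_bounded_scale (\int[P]_w \1_B (V w)) (linear_bounded_integral mU i1).
  under [X in linear_bounded X -> _]eq_fun do under eq_Rintegral do rewrite mulr1.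
  move=> L2; apply: (agree_on_indic L1 L2) => // A mA.
  rewrite Rintegral_indic_comp !E1// Rintegral_mkcond.
  rewrite (_ : _ \_ _ = (\1_(U @^-1` A `&` V @^-1` B) : T -> R)); last first.
    apply/funext => w; rewrite patchE !indicE in_setI.
    have -> : (w \in V @^-1` B) = (V w \in B) by apply/idP/idP; rewrite !inE.
    by case: ifP.
  rewrite /Rintegral integral_indic//; last by apply: measurableI; exact: mpre.
  rewrite setIT -fineM; [|exact/fin_num_measure/mpre|exact/fin_num_measure/mpre].
  by congr fine; exact: ind.
have ip : P.-integrable setT (EFin \o (fun w => p (U w))) by apply: prob_integrable; exact: bm_comp.
have L1 := linear_bounded_integral mV ip.
have := linear_bounded_scale (\int[P]_w p (U w)) (linear_bounded_integral mV i1).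
under [X in linear_bounded X -> _]eq_fun do under eq_Rintegral do rewrite mulr1.
move=> L2; rewrite mulrC.
have := @agree_on_indic _ _ _ _ _ q L1 L2 _ mq q1 => <-.
  by apply: eq_Rintegral => w _; rewrite mulrC.
move=> B mB; rewrite [RHS]mulrC -step1//.
by apply: eq_Rintegral => w _; rewrite mulrC.
Qed.

Lemma density_integral (Y : {RV P >-> R}) (f : R -> R) : has_density Y f ->
  (\int[mu]_x (f x)%:E = 1)%E /\ mu.-integrable setT (EFin \o f).
Proof.
move=> [mf f0 fY].
have f1 : (\int[mu]_x (f x)%:E = 1)%E.
  by rewrite -fY// /distribution/= /pushforward preimage_setT probability_setT.
split => //; apply/integrableP; split; first exact/measurable_EFinP.
apply: (@le_lt_trans _ _ 1%E); last exact: ltry.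
by rewrite -f1; apply: le_integral_ge0 => // x _; rewrite lee_fin ger0_norm.
Qed.

(** Both sides are bounded linear functionals of h that agree on indicators by
    definition of the density. *)
Lemma expectation_density (Y : {RV P >-> R}) (f h : R -> R) : has_density Y f ->
  measurable_fun setT h -> (forall x, `|h x| <= 1) ->
  \int[P]_w h (Y w) = \int[mu]_x (h x * f x).
Proof.
move=> fY mh h1; have [f1 fi] := density_integral fY; have [mf f0 fYA] := fY.
have i1 : P.-integrable setT (EFin \o (fun _ : T => 1 : R)) by apply: prob_integrable; exact: (@bm_cst _ T R 1).
have mY : measurable_fun setT (Y : T -> R) by [].
have := linear_bounded_integral mY i1.
under [X in linear_bounded X -> _]eq_fun do under eq_Rintegral do rewrite mulr1.
move=> L1; have mid := @measurable_id _ (measurableTypeR R) setT.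
have L2 := linear_bounded_integral mid fi.
apply: (agree_on_indic L1 L2) => // A mA /=.
transitivity (\int[P]_w (\1_A (Y w) * 1)); first by apply: eq_Rintegral => w _; rewrite mulr1.
rewrite Rintegral_indic_comp Rintegral_prob1; last first.
  by have := mY measurableT A mA; rewrite setTI.
rewrite -[P _]/(distribution P Y A) fYA// integral_mkcond; congr fine.
apply: eq_integral => x _; rewrite patchE indicE.
by case: ifP; rewrite ?mul1r ?mul0r.
Qed.

End probability_tools.

(** * Characteristic functions *)

Section covariance.
Context d (T : measurableType d) (R : realType) (P : probability T R).
Local Notation mu := (@lebesgue_measure R).
Implicit Types (Y U V W : T -> R).

(** Ecos and Esin are the real and imaginary parts of the characteristic
    function of Y. *)
Definition Ecos Y (t : R) : R := \int[P]_w cos (t * Y w).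
Definition Esin Y (t : R) : R := \int[P]_w sin (t * Y w).

Lemma measurable_cos_scale (t : R) : measurable_fun setT (fun x : R => cos (t * x)).
Proof.
apply: continuous_measurable_fun.
exact: (continuous_comp_fun (@continuous_cos R) (continuous_scale t)).
Qed.

Lemma measurable_sin_scale (t : R) : measurable_fun setT (fun x : R => sin (t * x)).
Proof.
apply: continuous_measurable_fun.
exact: (continuous_comp_fun (@continuous_sin R) (continuous_scale t)).
Qed.

Lemma bm_cos Y t : measurable_fun setT Y -> bounded_measurable (fun w => cos (t * Y w)).
Proof.
move=> mY; apply: (@bm_comp _ T R Y (fun x => cos (t * x))) => // [|x].
  exact: measurable_cos_scale.
exact: cos_max.
Qed.

Lemma bm_sin Y t : measurable_fun setT Y -> bounded_measurable (fun w => sin (t * Y w)).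
Proof.
move=> mY; apply: (@bm_comp _ T R Y (fun x => sin (t * x))) => // [|x].
  exact: measurable_sin_scale.
exact: sin_max.
Qed.

Lemma ED (f g : T -> R) : bounded_measurable f -> bounded_measurable g ->
  \int[P]_w (f w + g w) = \int[P]_w f w + \int[P]_w g w.
Proof. by move=> bf bg; rewrite RintegralD//; exact: prob_integrable. Qed.

Lemma EB (f g : T -> R) : bounded_measurable f -> bounded_measurable g ->
  \int[P]_w (f w - g w) = \int[P]_w f w - \int[P]_w g w.
Proof. by move=> bf bg; rewrite RintegralB//; exact: prob_integrable. Qed.

Lemma cmodE (z : R[i]) : cmod z = Num.sqrt (complex.Re z ^+ 2 + complex.Im z ^+ 2).
Proof. by rewrite /cmod normc_def. Qed.

Lemma Re_le_cmod (z : R[i]) : complex.Re z <= cmod z.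
Proof.
rewrite cmodE (le_trans (ler_norm _))// -sqrtr_sqr.
by rewrite ler_wsqrtr// lerDl sqr_ge0.
Qed.

(** exp(itY) times the conjugate of exp(itW) is exp(it(Y - W)). *)
Lemma ccov_expi (t : R) Y W : measurable_fun setT Y -> measurable_fun setT W ->
  ccov P (fun w => expi (t * Y w)) (fun w => expi (t * W w)) =
  Complex (Ecos (fun w => Y w - W w) t - (Ecos Y t * Ecos W t + Esin Y t * Esin W t))
          (Esin (fun w => Y w - W w) t - (Esin Y t * Ecos W t - Ecos Y t * Esin W t)).
Proof.
move=> mY mW; rewrite /ccov /cexpectation /cintegral /=.
have -> : \int[P]_w complex.Re (expi (t * Y w) * (expi (t * W w))^*) =
    Ecos (fun w => Y w - W w) t.
  by apply: eq_Rintegral => w _ /=; rewrite mulrBr cosB; ring.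
have -> : \int[P]_w complex.Im (expi (t * Y w) * (expi (t * W w))^*) =
    Esin (fun w => Y w - W w) t.
  by apply: eq_Rintegral => w _ /=; rewrite mulrBr sinB; ring.
rewrite -/(Ecos Y t) -/(Esin Y t) -/(Ecos W t) -/(Esin W t).
by apply/eqP; rewrite eq_complex /=; apply/andP; split; apply/eqP; ring.
Qed.

(** The characteristic function of a sum of independent variables is the
    product, here in real and imaginary parts. *)
Lemma cos_addE (t : R) U V : measurable_fun setT U -> measurable_fun setT V ->
  (forall A B, measurable A -> measurable B ->
     P (U @^-1` A `&` V @^-1` B) = (P (U @^-1` A) * P (V @^-1` B))%E) ->
  Ecos (fun w => U w + V w) t = Ecos U t * Ecos V t - Esin U t * Esin V t /\
  Esin (fun w => U w + V w) t = Esin U t * Ecos V t + Ecos U t * Esin V t.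
Proof.
move=> mU mV ind.
have pr (p q : R -> R) : measurable_fun setT p -> (forall x, `|p x| <= 1) ->
    measurable_fun setT q -> (forall x, `|q x| <= 1) ->
    \int[P]_w (p (U w) * q (V w)) = \int[P]_w p (U w) * \int[P]_w q (V w).
  by move=> *; exact: expectation_prod_indep.
have mc := measurable_cos_scale t; have ms := measurable_sin_scale t.
have c1 x : `|cos (t * x)| <= 1 by exact: cos_max.
have s1 x : `|sin (t * x)| <= 1 by exact: sin_max.
split.
  rewrite /Ecos /Esin -(pr _ _ mc c1 mc c1) -(pr _ _ ms s1 ms s1) -EB; last 2 first.
  - by apply: bm_mul; exact: bm_cos.
  - by apply: bm_mul; exact: bm_sin.
  by apply: eq_Rintegral => w _; rewrite mulrDr cosD.
rewrite /Ecos /Esin -(pr _ _ ms s1 mc c1) -(pr _ _ mc c1 ms s1) -ED; last 2 first.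
- by apply: bm_mul; [exact: bm_sin|exact: bm_cos].
- by apply: bm_mul; [exact: bm_cos|exact: bm_sin].
by apply: eq_Rintegral => w _; rewrite mulrDr sinD.
Qed.

Lemma EcosN Y t : Ecos (fun w => - Y w) t = Ecos Y t.
Proof. by apply: eq_Rintegral => w _; rewrite mulrN cosN. Qed.

Lemma EsinN Y t : measurable_fun setT Y -> Esin (fun w => - Y w) t = - Esin Y t.
Proof.
move=> mY; rewrite -mulN1r /Esin -RintegralZl//; last exact/prob_integrable/bm_sin.
by apply: eq_Rintegral => w _; rewrite mulrN sinN mulN1r.
Qed.

Lemma Ecos_law U V t : measurable_fun setT U -> measurable_fun setT V ->
  (forall A, measurable A -> P (U @^-1` A) = P (V @^-1` A)) -> Ecos U t = Ecos V t.
Proof.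
move=> mU mV UV.
have i1 : P.-integrable setT (EFin \o (fun _ : T => 1 : R)).
  by apply: prob_integrable; exact: (@bm_cst _ T R 1).
have L1 := linear_bounded_integral mU i1; have L2 := linear_bounded_integral mV i1.
transitivity (\int[P]_w (cos (t * U w) * 1)); first by apply: eq_Rintegral => w _; rewrite mulr1.
transitivity (\int[P]_w (cos (t * V w) * 1)); last by apply: eq_Rintegral => w _; rewrite mulr1.
apply: (@agree_on_indic _ _ _ _ _ (fun x => cos (t * x)) L1 L2) => [A mA||x].
- rewrite !Rintegral_indic_comp !Rintegral_prob1 ?UV//.
  + by have := mV measurableT A mA; rewrite setTI.
  + by have := mU measurableT A mA; rewrite setTI.
- exact: measurable_cos_scale.
- exact: cos_max.
Qed.

End covariance.

(** * Consequences of independence and stationarity *)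

Section model.
Context d (T : measurableType d) (R : realType) (P : probability T R).
Local Notation mu := (@lebesgue_measure R).

Lemma sigma_seq_measurable (Y : nat -> {RV P >-> R}) (f : T -> R) :
  measurable_fun setT (f : g_sigma_algebraType (\bigcup_i sigma_RV (Y i)) -> R) ->
  forall A, measurable A -> sigma_seq Y (f @^-1` A).
Proof. by move=> mf A mA; have := mf measurableT A mA; rewrite setTI. Qed.

Lemma measurable_sigma_seq (Y : nat -> {RV P >-> R}) (i : nat) :
  measurable_fun setT (Y i : g_sigma_algebraType (\bigcup_i sigma_RV (Y i)) -> R).
Proof.
move=> _ A mA; apply: sub_sigma_algebra; exists i => //.
by exists A.
Qed.

Lemma sigma_seq_RV (Y : nat -> {RV P >-> R}) (i : nat) (A : set R) :
  measurable A -> sigma_seq Y (Y i @^-1` A).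
Proof. by move=> mA; apply: sigma_seq_measurable => //; exact: measurable_sigma_seq. Qed.

Lemma sigma_seq_sub (Y : nat -> {RV P >-> R}) (i k : nat) (A : set R) :
  measurable A -> sigma_seq Y ((fun w => Y i w - Y k w) @^-1` A).
Proof.
move=> mA; apply: sigma_seq_measurable => //.
by apply: measurable_funB; exact: measurable_sigma_seq.
Qed.

Lemma mutually_independent_pair (Y : nat -> {RV P >-> R}) (i k : nat) (A B : set R) :
  mutually_independent Y -> i != k -> measurable A -> measurable B ->
  P (Y i @^-1` A `&` Y k @^-1` B) = (P (Y i @^-1` A) * P (Y k @^-1` B))%E.
Proof.
move=> indY ik mA mB.
pose C l := if l == i then A else B.
have mC l : measurable (C l) by rewrite /C; case: ifP.
have := indY [fset i; k]%fset C mC.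
have iNk : i \notin [fset k]%fset by rewrite inE.
rewrite big_fsetU1//= big_seq_fset1 {2 3}/C eqxx eq_sym (negbTE ik) => <-.
congr (P _); apply/seteqP; split => [w [wA wB] l /=|w H].
  by rewrite !inE => /orP[|] /eqP ->; rewrite /C ?eqxx// eq_sym (negbTE ik).
split; first by have := H i; rewrite /= /C eqxx; apply; rewrite !inE eqxx.
by have := H k; rewrite /= /C eq_sym (negbTE ik); apply; rewrite !inE eqxx orbT.
Qed.

Lemma stationary_sub (X : nat -> {RV P >-> R}) (i k : nat) (A : set R) :
  strictly_stationary X -> (i <= k)%N -> measurable A ->
  P ((fun w => X k w - X i w) @^-1` A) = P ((fun w => X (k - i)%N w - X 0%N w) @^-1` A).
Proof.
move=> sX ik mA.
pose B : set ((k - i).+1.-tuple R) := (fun b => tnth b ord_max - tnth b ord0) @^-1` A.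
have mB : measurable B.
  rewrite -[B]setTI; apply: measurable_funB => //; exact: measurable_tnth.
have := sX i (k - i).+1 B mB.
by rewrite /B /preimage /=; under eq_fun do rewrite !tnth_mktuple /= addn0 subnKC//;
  under [in RHS]eq_fun do rewrite !tnth_mktuple /=.
Qed.

End model.

Section sum_dist.
Context {R : realType}.

(** Each lag l occurs at most twice, for k = i - l and for k = i + l. *)
Lemma sum_dist_le (kap : nat -> R) (n i : nat) : (forall l, 0 <= kap l) -> (i < n)%N ->
  \sum_(0 <= k < n | k != i) kap ((i - k) + (k - i))%N <= 2 * \sum_(1 <= l < n) kap l.
Proof.
move=> k0 ni.
have E : index_iota 0 n = iota 0 i ++ i :: iota i.+1 (n - i.+1).
  have E1 : iota 0 i.+1 = iota 0 i ++ [:: i] by rewrite -addn1 iotaD.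
  by rewrite /index_iota subn0 -[in LHS](subnKC ni) iotaD E1 -catA add0n.
rewrite E big_cat big_cons eqxx/= mulrDl !mul1r; apply: lerD.
- rewrite [leLHS]big_seq_cond [leLHS](eq_bigr (fun k => kap (i - k)%N)); last first.
    by move=> k; rewrite mem_iota => H; congr kap; lia.
  rewrite [leLHS](eq_bigl (fun k => k \in iota 0 i)); last first.
    by move=> k; rewrite mem_iota; apply/idP/idP; lia.
  rewrite -[leLHS]big_seq -[leLHS](big_map (fun k => (i - k)%N) xpredT kap).
  apply: sum_subset_le => //.
  + rewrite map_inj_in_uniq ?iota_uniq// => x y; rewrite !mem_iota; lia.
  + exact: iota_uniq.
  + move=> l /mapP[k]; rewrite !mem_iota => H ->; lia.
- rewrite [leLHS]big_seq_cond [leLHS](eq_bigr (fun k => kap (k - i)%N)); last first.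
    by move=> k; rewrite mem_iota => H; congr kap; lia.
  rewrite [leLHS](eq_bigl (fun k => k \in iota i.+1 (n - i.+1))); last first.
    by move=> k; rewrite mem_iota; apply/idP/idP; lia.
  rewrite -[leLHS]big_seq -[leLHS](big_map (fun k => (k - i)%N) xpredT kap).
  apply: sum_subset_le => //.
  + rewrite map_inj_in_uniq ?iota_uniq// => x y; rewrite !mem_iota; lia.
  + exact: iota_uniq.
  + move=> l /mapP[k]; rewrite !mem_iota => H ->; lia.
Qed.

End sum_dist.

(** * Variance of the empirical characteristic function *)

Section variance.
Context d (T : measurableType d) (R : realType) (P : probability T R).
Local Notation mu := (@lebesgue_measure R).
Variables (X eps : nat -> {RV P >-> R}) (g feps : R -> R).
Hypothesis statX : strictly_stationary X.
Hypothesis gX : forall i, has_density (X i) g.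
Hypothesis indE : mutually_independent eps.
Hypothesis fE : forall i, has_density (eps i) feps.
Hypothesis indXE : independent_sigma P (sigma_seq X) (sigma_seq eps).

Definition charR (f : R -> R) (t : R) : R := \int[mu]_x (cos (t * x) * f x).
Definition charI (f : R -> R) (t : R) : R := \int[mu]_x (sin (t * x) * f x).

Variable t : R.

Let mX i : measurable_fun setT (X i : T -> R). Proof. by []. Qed.
Let mE i : measurable_fun setT (eps i : T -> R). Proof. by []. Qed.

Lemma Ecos_density (Y : {RV P >-> R}) f : has_density Y f -> Ecos P Y t = charR f t.
Proof.
move=> fY; apply: (expectation_density (h := fun x => cos (t * x)) fY).
  exact: measurable_cos_scale.
by move=> x; exact: cos_max.
Qed.

Lemma Esin_density (Y : {RV P >-> R}) f : has_density Y f -> Esin P Y t = charI f t.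
Proof.
move=> fY; apply: (expectation_density (h := fun x => sin (t * x)) fY).
  exact: measurable_sin_scale.
by move=> x; exact: sin_max.
Qed.

Let fc := charR feps t.
Let fs := charI feps t.
Let gc := charR g t.
Let gs := charI g t.
Let F := fc ^+ 2 + fs ^+ 2.
Let G := gc ^+ 2 + gs ^+ 2.
Let kap l := cmod (ccov P (fun w => expi (t * X 0%N w)) (fun w => expi (t * X l w))).
Let Z i w := X i w + eps i w.
Let mu1 := gc * fc - gs * fs.
Let mu2 := gs * fc + gc * fs.

Let mZ i : measurable_fun setT (Z i). Proof. by apply: measurable_funD. Qed.

Let EZ i : Ecos P (Z i) t = mu1 /\ Esin P (Z i) t = mu2.
Proof.
have ind A B : measurable A -> measurable B ->
    P (X i @^-1` A `&` eps i @^-1` B) = (P (X i @^-1` A) * P (eps i @^-1` B))%E.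
  by move=> mA mB; apply: indXE; exact: sigma_seq_RV.
have [c s] := cos_addE t (mX i) (mE i) ind; rewrite -/(Z i) in c s.
rewrite c s.
by rewrite !(Ecos_density (gX i)) !(Ecos_density (fE i)) !(Esin_density (gX i)) !(Esin_density (fE i)).
Qed.

Let Eeps i k : i != k ->
  Ecos P (fun w => eps i w - eps k w) t = F /\ Esin P (fun w => eps i w - eps k w) t = 0.
Proof.
move=> ik; have mN : measurable_fun setT (fun w => - eps k w) by exact: measurableT_comp.
have ind A B : measurable A -> measurable B ->
    P (eps i @^-1` A `&` (fun w => - eps k w) @^-1` B) =
    (P (eps i @^-1` A) * P ((fun w => - eps k w)%R @^-1` B))%E.
  move=> mA mB.
  have mB' : measurable (-%R @^-1` B).
    have mo : measurable_fun setT (fun x : R => - x) by exact: measurableT_comp.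
    by have := mo measurableT B mB; rewrite setTI.
  exact: (mutually_independent_pair indE ik mA mB').
have [c s] := cos_addE t (mE i) mN ind.
rewrite c s EcosN EsinN// !(Ecos_density (fE _)) !(Esin_density (fE _)) -/fc -/fs /F.
by split; ring.
Qed.

Let kap_ge0 l : 0 <= kap l.
Proof. by rewrite /kap cmodE sqrtr_ge0. Qed.

Let EX_lag l : Ecos P (fun w => X 0%N w - X l w) t <= kap l + G.
Proof.
have := Re_le_cmod (ccov P (fun w => expi (t * X 0%N w)) (fun w => expi (t * X l w))).
rewrite -/(kap l) ccov_expi//= !(Ecos_density (gX _)) !(Esin_density (gX _)) -/gc -/gs /G.
lra.
Qed.

Let Ecos_sym (U V : T -> R) : Ecos P (fun w => U w - V w) t = Ecos P (fun w => V w - U w) t.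
Proof. by apply: eq_Rintegral => w _; rewrite -cosN -mulrN opprB. Qed.

Let EX i k : Ecos P (fun w => X i w - X k w) t <= kap ((i - k) + (k - i))%N + G.
Proof.
wlog ki : i k / (k <= i)%N.
  move=> H; case: (leqP k i) => [|/ltnW] ik; first exact: H.
  by rewrite Ecos_sym addnC; exact: H.
rewrite (_ : (k - i)%N = 0%N) ?addn0; last by apply/eqP; rewrite subn_eq0.
rewrite (@Ecos_law _ _ _ P _ (fun w => X (i - k)%N w - X 0%N w)); last first.
- by move=> A mA; exact: stationary_sub.
- exact: measurable_funB.
- exact: measurable_funB.
by rewrite Ecos_sym; exact: EX_lag.
Qed.

Let EZZ i k : Ecos P (fun w => Z i w - Z k w) t <=
  (if k == i then 1 else F * kap ((i - k) + (k - i))%N) + F * G.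
Proof.
have F0 : 0 <= F by rewrite addr_ge0 ?sqr_ge0.
have G0 : 0 <= G by rewrite addr_ge0 ?sqr_ge0.
case: eqVneq => [->|ki].
  rewrite /Ecos (_ : \int[P]_w _ = 1) ?lerDl ?mulr_ge0//.
  rewrite (@eq_Rintegral _ _ _ _ _ (fun=> 1)); last by move=> w _; rewrite subrr mulr0 cos0.
  by rewrite Rintegral_prob1// probability_setT.
have ik : i != k by rewrite eq_sym.
have -> : Ecos P (fun w => Z i w - Z k w) t =
    Ecos P (fun w => (X i w - X k w) + (eps i w - eps k w)) t.
  by apply: eq_Rintegral => w _; congr (cos (t * _)); rewrite /Z; ring.
have mU : measurable_fun setT (fun w => X i w - X k w) by exact: measurable_funB.
have mV : measurable_fun setT (fun w => eps i w - eps k w) by exact: measurable_funB.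
have ind A B : measurable A -> measurable B ->
    P ((fun w => X i w - X k w) @^-1` A `&` (fun w => eps i w - eps k w) @^-1` B) =
    (P ((fun w => X i w - X k w)%R @^-1` A) * P ((fun w => eps i w - eps k w)%R @^-1` B))%E.
  by move=> mA mB; apply: indXE; exact: sigma_seq_sub.
have [-> _] := cos_addE t mU mV ind.
have [-> ->] := Eeps ik; rewrite mulr0 subr0 mulrC -mulrDr.
by rewrite ler_wpM2l.
Qed.

Let L2_bm (f : T -> R) : bounded_measurable f -> L2 P setT f.
Proof.
move=> bf; split; first by have [] := bf.
have := prob_integrable P (bm_mul bf bf).
by apply: eq_integrable => // w _ /=; rewrite expr2.
Qed.

(** The mean of exp(itZ_i) is mu1 + i mu2, the product of the transforms of g
    and feps, and the left side is the variance of the empirical mean, that is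
    n^-2 times the sum of E cos(t (Z_i - Z_k)), minus F G. The diagonal terms
    are 1. Off the diagonal the errors contribute the factor F, and the real
    part of E exp(it(X_i - X_k)) is at most |Cov| + G; the terms F G cancel,
    and stationarity reduces the covariances to the lag |i - k|. *)
Lemma variance_bound (n : nat) : (0 < n)%N ->
  \int[P]_w ((mu1 - \sum_(i <- iota 0 n) n%:R^-1 * cos (t * Z i w)) ^+ 2 +
             (mu2 - \sum_(i <- iota 0 n) n%:R^-1 * sin (t * Z i w)) ^+ 2) <=
  n%:R^-1 + 2 / n%:R * (F * \sum_(1 <= l < n) kap l).
Proof.
move=> n0; have n0' : (n%:R : R) != 0 by rewrite pnatr_eq0 -lt0n.
have np : (0 : R) < n%:R by rewrite ltr0n.
have F0 : 0 <= F by rewrite addr_ge0 ?sqr_ge0.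
have bc i := bm_cos t (mZ i); have bs i := bm_sin t (mZ i).
have Lc i := L2_bm (bc i); have Ls i := L2_bm (bs i).
have L1 := L2_bm (@bm_cst _ T R mu1); have L2' := L2_bm (@bm_cst _ T R mu2).
have E1 := @ip_sub_sum _ T R P setT measurableT _ (iota 0 n) (fun=> n%:R^-1) _ _ Lc L1.
have E2 := @ip_sub_sum _ T R P setT measurableT _ (iota 0 n) (fun=> n%:R^-1) _ _ Ls L2'.
rewrite /= in E1 E2.
set h1 := fun w => mu1 - _ in E1; set h2 := fun w => mu2 - _ in E2.
have Lh1 : L2 P setT h1 by apply: L2_sub => //; exact: L2_sum.
have Lh2 : L2 P setT h2 by apply: L2_sub => //; exact: L2_sum.
have -> : \int[P]_w ((mu1 - \sum_(i <- iota 0 n) n%:R^-1 * cos (t * Z i w)) ^+ 2 +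
             (mu2 - \sum_(i <- iota 0 n) n%:R^-1 * sin (t * Z i w)) ^+ 2) =
   ip P setT h1 h1 + ip P setT h2 h2.
  by rewrite /ip -RintegralD//; exact: L2_mul_integrable.
have cstint (c : R) (f : T -> R) : bounded_measurable f ->
    ip P setT (fun=> c) f = c * \int[P]_w f w.
  by move=> bf; rewrite /ip RintegralZl//; exact: prob_integrable.
have cst1 (c : R) : ip P setT (fun=> c) (fun=> c) = c ^+ 2.
  rewrite cstint; last exact: (@bm_cst _ T R c).
  by rewrite Rintegral_cst// -[X in fine X]/(P setT) probability_setT/= mulr1 expr2.
have sumc (c : R) : \sum_(i <- iota 0 n) n%:R^-1 * c = c.
  by rewrite -mulr_sumr big_const_seq count_predT size_iota iter_addr_0 -[c *+ n]mulr_natl mulKf.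
have S1 : \sum_(i <- iota 0 n) n%:R^-1 * ip P setT (fun=> mu1) (fun w => cos (t * Z i w)) = mu1 ^+ 2.
  rewrite -[RHS]sumc; apply: eq_bigr => i _; rewrite cstint// -/(Ecos P (Z i) t).
  by rewrite (EZ i).1 expr2.
have S2 : \sum_(i <- iota 0 n) n%:R^-1 * ip P setT (fun=> mu2) (fun w => sin (t * Z i w)) = mu2 ^+ 2.
  rewrite -[RHS]sumc; apply: eq_bigr => i _; rewrite cstint// -/(Esin P (Z i) t).
  by rewrite (EZ i).2 expr2.
rewrite E1 E2 S1 S2 !cst1.
rewrite addrACA -big_split/=.
have -> : mu1 ^+ 2 - 2 * mu1 ^+ 2 + (mu2 ^+ 2 - 2 * mu2 ^+ 2) = - (F * G).
  by rewrite /mu1 /mu2 /F /G; ring.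
rewrite addrC lerBlDr.
have inner_le i : i \in iota 0 n ->
    n%:R^-1 * (\sum_(k <- iota 0 n) n%:R^-1 * ip P setT (fun w => cos (t * Z i w)) (fun w => cos (t * Z k w))) +
    n%:R^-1 * (\sum_(k <- iota 0 n) n%:R^-1 * ip P setT (fun w => sin (t * Z i w)) (fun w => sin (t * Z k w)))
    <= n%:R^-1 * (n%:R^-1 + 2 / n%:R * (F * \sum_(1 <= l < n) kap l) + F * G).
  rewrite mem_iota add0n => /andP[_ ni].
  rewrite -mulrDr ler_wpM2l ?invr_ge0// -big_split/=.
  have -> : \sum_(k <- iota 0 n) (n%:R^-1 * ip P setT (fun w => cos (t * Z i w)) (fun w => cos (t * Z k w)) +
      n%:R^-1 * ip P setT (fun w => sin (t * Z i w)) (fun w => sin (t * Z k w))) =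
     \sum_(k <- iota 0 n) n%:R^-1 * Ecos P (fun w => Z i w - Z k w) t.
    apply: eq_bigr => k _; rewrite -mulrDr; congr (_ * _).
    rewrite /ip -ED; [|by apply: bm_mul|by apply: bm_mul].
    by apply: eq_Rintegral => w _; rewrite mulrBr cosB.
  apply: (@le_trans _ _ (\sum_(k <- iota 0 n) n%:R^-1 *
     ((if k == i then 1 else F * kap ((i - k) + (k - i))%N) + F * G))).
    by apply: ler_sum => k _; rewrite ler_wpM2l ?invr_ge0.
  rewrite [leLHS](eq_bigr (fun k => n%:R^-1 *
     (if k == i then 1 else F * kap ((i - k) + (k - i))%N) + n%:R^-1 * (F * G))); last first.
    by move=> k _; rewrite mulrDr.
  rewrite big_split/= sumc lerD2r -mulr_sumr.
  set K := \sum_(1 <= l < n) kap l.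
  have -> : n%:R^-1 + 2 / n%:R * (F * K) = n%:R^-1 * (1 + F * (2 * K)) by ring.
  rewrite ler_wpM2l ?invr_ge0// (bigD1_seq i) ?iota_uniq ?mem_iota//= eqxx lerD2l.
  rewrite [leLHS](eq_bigr (fun k => F * kap ((i - k) + (k - i))%N)); last by move=> k /negbTE ->.
  rewrite -mulr_sumr ler_wpM2l//.
  by have := sum_dist_le kap_ge0 ni; rewrite /index_iota subn0.
rewrite -[leRHS]sumc big_seq [leRHS]big_seq.
by apply: ler_sum.
Qed.

End variance.

(** * Fourier transforms of densities and of combinations *)

Section transforms.
Context {R : realType}.
Local Notation mu := (@lebesgue_measure R).

(** The exceptional points will be the ends of the band, where the transform of
    phi m j has another value than on either side. *)
Lemma Rintegral_off_points (f h : R -> R) (p q a b : R) : measurable_fun setT h ->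
  (forall x, x != p -> x != q -> f x = h x) ->
  \int[mu]_(x in `[a, b]) f x = \int[mu]_(x in `[a, b]) h x.
Proof.
move=> mh fh.
pose f' x := if x == p then f p else if x == q then f q else h x.
have -> : f = f'.
  apply/funext => x; rewrite /f'; case: eqVneq => [->//|xp]; case: eqVneq => [->//|xq].
  exact: fh.
have meq r : measurable_fun setT (fun x : R => x == r).
  by apply: measurable_fun_eqr => //; exact: measurable_cst.
have mf' : measurable_fun setT f'.
  by apply: measurable_fun_ifT => //; apply: measurable_fun_ifT.
rewrite /Rintegral; congr fine; apply: ae_eq_integral => //.
- by apply: measurable_funTS; exact/measurable_EFinP.
- by apply: measurable_funTS; exact/measurable_EFinP.
exists [set p; q]; split.
- exact: measurableU.
- apply: countable_lebesgue_measure0; apply: finite_set_countable.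
  by rewrite finite_setU; split; exact: finite_set1.
- move=> x /=; apply: contra_notP => /not_orP[/eqP xp /eqP xq] _.
  by rewrite /f' (negbTE xp) (negbTE xq).
Qed.

Lemma Rintegral_patch_itv (W : R -> R) (A T : R) : measurable_fun setT W -> A <= T ->
  \int[mu]_(x in `[- T, T]) (W \_ `]- A, A[) x = \int[mu]_(x in `[- A, A]) W x.
Proof.
move=> mW AT; rewrite -Rintegral_mkcondr Rintegral_itv_oo//; congr (Rintegral _ _ _).
apply/seteqP; split => [x []//|x xA]; split => //.
by apply: subset_itv xA; rewrite bnd_simp ?lerN2.
Qed.

(** By dominated convergence the truncation disappears for an integrable
    function. *)
Lemma fourierR_integrable (f : R -> R) (x : R) : mu.-integrable setT (EFin \o f) ->
  fourierR f x = Complex (charR f x) (charI f x).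
Proof.
move=> fi; have mf : measurable_fun setT f by have [+ _] := integrableP _ _ _ fi => /measurable_EFinP.
have trig (h : R -> R) : measurable_fun setT h -> (forall y, `|h y| <= 1) ->
    mu.-integrable setT (EFin \o (fun y => h y * f y)).
  move=> mh h1; apply: (le_integrable _ _ _ fi) => //.
    by apply/measurable_EFinP; exact: measurable_funM.
  by move=> y _ /=; rewrite lee_fin normrM ler_piMl.
rewrite /fourierR /fourier /cintegral /=; congr Complex.
  apply/cvg_lim => //.
  have := cvg_trunc_integral (trig (fun y => cos (x * y)) (measurable_cos_scale x) (fun y => cos_max _)).
  apply: cvg_trans; apply: near_eq_cvg; near=> T.
  by apply: eq_Rintegral => y _ /=; rewrite mulr0 subr0 (mulrC x).
apply/cvg_lim => //.
have := cvg_trunc_integral (trig (fun y => sin (x * y)) (measurable_sin_scale x) (fun y => sin_max _)).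
apply: cvg_trans; apply: near_eq_cvg; near=> T.
by apply: eq_Rintegral => y _ /=; rewrite mulr0 add0r (mulrC x).
Unshelve. all: by end_near. Qed.

Lemma continuous_char (f : R -> R) : mu.-integrable setT (EFin \o f) ->
  continuous (charR f) /\ continuous (charI f).
Proof.
move=> fi; have mf : measurable_fun setT f by have [+ _] := integrableP _ _ _ fi => /measurable_EFinP.
have main (h : R -> R) : continuous h -> (forall y, `|h y| <= 1) ->
    continuous (fun t : R => \int[mu]_x (h (t * x) * f x)).
  move=> ch h1 a.
  have int_f x : `]a - 1, a + 1[%classic x ->
      mu.-integrable setT (EFin \o (fun y => h (x * y) * f y)).
    move=> _; apply: (le_integrable _ _ _ fi) => //.
      apply/measurable_EFinP; apply: measurable_funM => //.
      apply: continuous_measurable_fun.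
      exact: (continuous_comp_fun ch (continuous_scale x)).
    by move=> y _ /=; rewrite lee_fin normrM ler_piMl.
  apply: (@continuity_under_integral _ _ _ mu (fun t x => h (t * x) * f x) setT measurableT
     (a - 1) (a + 1) int_f _ (fun y => `|f y|)).
  - apply: aeW => y _ z _.
    have cy : continuous (fun t : R => t * y).
      by move=> u; apply: cvgM; [exact: cvg_id|exact: cvg_cst].
    have ck : continuous (fun _ : R => f y) by move=> u; exact: cvg_cst.
    have H := continuous_mul_fun (continuous_comp_fun ch cy) ck; exact: H.
  - exact: (integrable_norm fi).
  - by move=> x _; apply: aeW => y _; rewrite normrM ler_piMl.
  - by rewrite inE/= in_itv/=; apply/andP; split; lra.
split.
  by apply: (main cos); [exact: continuous_cos|exact: cos_max].
by apply: (main sin); [exact: continuous_sin|exact: sin_max].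
Qed.

Variable m : nat.
Hypothesis m0 : (0 < m)%N.
Let M : R := m%:R.

Lemma continuous_comb (b : int -> R) (s : seq int) : continuous (comb m b s).
Proof.
elim: s => [|j s IH].
  by rewrite (_ : comb m b [::] = fun=> 0); [move=> x; exact: cvg_cst|
    apply/funext => x; rewrite /comb big_nil].
rewrite (_ : comb m b (j :: s) = fun x => b j * phi m j x + comb m b s x); last first.
  by apply/funext => x; rewrite /comb big_cons.
move=> x; apply: cvgD; last exact: IH.
by apply: cvgM; [exact: cvg_cst|exact: continuous_phi].
Qed.

(** The phase c gives the real part for c = 0 and the imaginary part for c = -
    pi / 2. *)
Lemma cvg_trunc_comb (b : int -> R) (s : seq int) (x c : R) : `|x| != pi * M ->
  \int[mu]_(t in `[- T, T]) (cos (x * t + c) * comb m b s t) @[T --> +oo] -->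
  if `|x| < pi * M then \sum_(j <- s) b j * (cos (x * j%:~R / M + c) / Num.sqrt M) else 0.
Proof.
move=> xM; elim: s => [|j s IH].
  rewrite big_nil if_same; apply: cvg_near_cst; near=> T.
  rewrite (@eq_Rintegral _ _ _ _ _ (fun=> 0)).
    by rewrite /Rintegral integral0.
  by move=> t _; rewrite /comb big_nil mulr0.
have H0 := @cvg_trunc_fourier_phi _ _ j x c m0 xM.
have H : (b j * \int[mu]_(t in `[- T, T]) (cos (x * t + c) * phi m j t) +
    \int[mu]_(t in `[- T, T]) (cos (x * t + c) * comb m b s t)) @[T --> +oo] -->
    b j * (if `|x| < pi * M then cos (x * j%:~R / M + c) / Num.sqrt M else 0) +
    (if `|x| < pi * M then \sum_(k <- s) b k * (cos (x * k%:~R / M + c) / Num.sqrt M) else 0).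
  by apply: cvgD => //; apply: cvgM => //; exact: cvg_cst.
rewrite big_cons.
have -> : (if `|x| < pi * M then b j * (cos (x * j%:~R / M + c) / Num.sqrt M) +
   \sum_(k <- s) b k * (cos (x * k%:~R / M + c) / Num.sqrt M) else 0) =
   b j * (if `|x| < pi * M then cos (x * j%:~R / M + c) / Num.sqrt M else 0) +
   (if `|x| < pi * M then \sum_(k <- s) b k * (cos (x * k%:~R / M + c) / Num.sqrt M) else 0).
  by case: ifP; rewrite ?mulr0 ?addr0.
move: H; apply: cvg_trans; apply: near_eq_cvg; near=> T.
have cc : continuous (fun t : R => cos (x * t + c)).
  exact: (continuous_comp_fun (@continuous_cos R) (continuous_affine x c)).
rewrite /= -RintegralZl//; last first.
  by apply: continuous_integrable_itv; apply: continuous_mul_fun => //; exact: continuous_phi.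
rewrite -RintegralD//; last 2 first.
- apply: continuous_integrable_itv; apply: (continuous_comp_fun (continuous_scale (b j))).
  by apply: continuous_mul_fun => //; exact: continuous_phi.
- by apply: continuous_integrable_itv; apply: continuous_mul_fun => //; exact: continuous_comb.
by apply: eq_Rintegral => t _; rewrite /comb big_cons mulrDr mulrCA.
Unshelve. all: by end_near. Qed.

Lemma fourierR_comb (b : int -> R) (s : seq int) (x : R) : `|x| != pi * M ->
  fourierR (comb m b s) x =
  if `|x| < pi * M then
    Complex (\sum_(j <- s) b j * (cos (x * j%:~R / M) / Num.sqrt M))
            (\sum_(j <- s) b j * (sin (x * j%:~R / M) / Num.sqrt M))
  else 0.
Proof.
move=> xM; rewrite /fourierR /fourier /cintegral /=.
have -> : (if `|x| < pi * M then
    Complex (\sum_(j <- s) b j * (cos (x * j%:~R / M) / Num.sqrt M))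
            (\sum_(j <- s) b j * (sin (x * j%:~R / M) / Num.sqrt M))
  else 0) =
  Complex (if `|x| < pi * M then \sum_(j <- s) b j * (cos (x * j%:~R / M + 0) / Num.sqrt M) else 0)
    (if `|x| < pi * M then \sum_(j <- s) b j * (cos (x * j%:~R / M + (- (pi / 2))) / Num.sqrt M) else 0).
  case: ifP => _ //; congr Complex; apply: eq_bigr => j _; first by rewrite addr0.
  by rewrite cosBpihalf.
congr Complex; apply/cvg_lim => //.
  have := @cvg_trunc_comb b s x 0 xM.
  apply: cvg_trans; apply: near_eq_cvg; near=> T.
  by apply: eq_Rintegral => t _ /=; rewrite mulr0 subr0 addr0 (mulrC x).
have := @cvg_trunc_comb b s x (- (pi / 2)) xM.
apply: cvg_trans; apply: near_eq_cvg; near=> T.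
by apply: eq_Rintegral => t _ /=; rewrite mulr0 add0r cosBpihalf (mulrC x).
Unshelve. all: by end_near. Qed.

End transforms.

(** * The estimated coefficients *)

Section finite_sums.
Context {R : realType} (I : Type) (c : I -> R) (e : I -> R -> R).
Local Notation mu := (@lebesgue_measure R).
Hypothesis ce : forall i, continuous (e i).

Lemma continuous_sum_fun (s : seq I) : continuous (fun x => \sum_(i <- s) c i * e i x).
Proof.
elim: s => [|i s IH].
  by under eq_fun do rewrite big_nil; move=> x; exact: cvg_cst.
under eq_fun do rewrite big_cons.
move=> x; apply: cvgD; last exact: IH.
by apply: cvgM; [exact: cvg_cst|exact: ce].
Qed.

Lemma Rintegral_itv_sum (s : seq I) (a b : R) :
  \int[mu]_(x in `[a, b]) (\sum_(i <- s) c i * e i x) =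
  \sum_(i <- s) c i * \int[mu]_(x in `[a, b]) e i x.
Proof.
elim: s => [|i s IH].
  rewrite big_nil (@eq_Rintegral _ _ _ _ _ (fun=> 0)); last by move=> x _; rewrite big_nil.
  by rewrite /Rintegral integral0.
rewrite big_cons -IH -RintegralZl//; last exact: continuous_integrable_itv.
rewrite -RintegralD//; last 2 first.
- by apply: continuous_integrable_itv; exact: (continuous_comp_fun (continuous_scale (c i)) (@ce i)).
- by apply: continuous_integrable_itv; exact: continuous_sum_fun.
by apply: eq_Rintegral => x _; rewrite big_cons.
Qed.

End finite_sums.

Section estimator.
Context {R : realType}.
Local Notation mu := (@lebesgue_measure R).
Variables (feps : R -> R) (m : nat).
Hypothesis fi : mu.-integrable setT (EFin \o feps).
Hypothesis f0 : forall x, fourierR feps x != 0.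
Hypothesis m0 : (0 < m)%N.
Let M : R := m%:R.
Let A := pi * M.
Let M0 : 0 < M. Proof. by rewrite /M ltr0n. Qed.
Let s0 : Num.sqrt M != 0. Proof. by rewrite gt_eqF// sqrtr_gt0. Qed.

(** The squared modulus of the transform of feps; q1 + i q2 is the inverse of
    the conjugate of that transform. *)
Definition charsq (x : R) : R := charR feps x ^+ 2 + charI feps x ^+ 2.
Definition q1 (x : R) : R := charR feps x / charsq x.
Definition q2 (x : R) : R := charI feps x / charsq x.

Lemma charsq_gt0 x : 0 < charsq x.
Proof.
rewrite lt_neqAle addr_ge0 ?sqr_ge0// andbT eq_sym.
have := f0 x; rewrite fourierR_integrable//; apply: contraNN.
rewrite paddr_eq0 ?sqr_ge0// !sqrf_eq0 => /andP[/eqP -> /eqP ->].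
by rewrite eq_complex /= !eqxx.
Qed.

Lemma cmod_fourierR x : cmod (fourierR feps x) ^+ 2 = charsq x.
Proof.
by rewrite fourierR_integrable// cmodE sqr_sqrtr//= addr_ge0 ?sqr_ge0.
Qed.

Lemma continuous_charsq : continuous charsq.
Proof.
have [cR cI] := continuous_char fi.
rewrite (_ : charsq = fun x => charR feps x * charR feps x + charI feps x * charI feps x).
  by move=> x; apply: cvgD; [exact: (continuous_mul_fun cR cR)|exact: (continuous_mul_fun cI cI)].
by apply/funext => x; rewrite /charsq !expr2.
Qed.

Lemma continuous_q : continuous q1 /\ continuous q2.
Proof.
have [cR cI] := continuous_char fi.
have cV : continuous (fun x => (charsq x)^-1).
  by move=> x; apply: cvgV; [rewrite gt_eqF// charsq_gt0|exact: continuous_charsq].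
by split; [exact: (continuous_mul_fun cR cV)|exact: (continuous_mul_fun cI cV)].
Qed.

(** The real part of exp(i(xz - xj/m)) divided by the transform of feps at x.
    *)
Definition coef_kernel (j : int) (z x : R) : R :=
  cos (x * z - x * j%:~R / M) * q1 x + sin (x * z - x * j%:~R / M) * q2 x.

(** The value at z of the Fourier transform of u_t for t = phi m j. *)
Definition coef (j : int) (z : R) : R :=
  (2 * pi * Num.sqrt M)^-1 * \int[mu]_(x in `[- A, A]) coef_kernel j z x.

Lemma continuous_phase (z : R) (j : int) : continuous (fun x : R => x * z - x * j%:~R / M).
Proof.
rewrite (_ : (fun x => _) = fun x : R => (z - j%:~R / M) * x); first exact: continuous_scale.
by apply/funext => x; ring.
Qed.

Lemma continuous_coef_kernel j z : continuous (coef_kernel j z).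
Proof.
have [c1 c2] := continuous_q.
have cc := continuous_comp_fun (@continuous_cos R) (@continuous_phase z j).
have cs := continuous_comp_fun (@continuous_sin R) (@continuous_phase z j).
by move=> x; apply: cvgD; [exact: (continuous_mul_fun cc c1)|exact: (continuous_mul_fun cs c2)].
Qed.

Lemma Re_u_comb (b : int -> R) (s : seq int) (z x : R) : x != A -> x != - A ->
  complex.Re (expi (x * z) * u_ feps (comb m b s) x) =
  ((fun x => \sum_(j <- s) (b j * (2 * pi * Num.sqrt M)^-1) * coef_kernel j z x) \_ `]- A, A[) x.
Proof.
move=> xA xNA.
have A0 : 0 <= A by rewrite mulr_ge0 ?pi_ge0// ltW.
have nx : `|- x| != pi * M.
  rewrite normrN -/A; apply/negP => /eqP h.
  by have := normr_id x; case: (ler0P x) h => _ h _; move: xA xNA; rewrite -h ?opprK eqxx.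
have pos := charsq_gt0 x; have c0 : charsq x != 0 by rewrite gt_eqF.
rewrite /u_ fourierR_comb// fourierR_integrable// normrN patchE.
have -> : (x \in (`]- A, A[%classic : set R)) = (`|x| < pi * M).
  by apply/idP/idP; rewrite inE/= in_itv/= -ltr_norml.
case: ifP => _; last by rewrite mul0r mulr0 mulr0.
rewrite /q1 /q2 /= !mul0r !subr0 !addr0.
rewrite -/(charsq x).
rewrite /coef_kernel /q1 /q2.
transitivity ((2 * pi)^-1 * (charR feps x / charsq x * (\sum_(j <- s) b j * (cos (x * z - x * j%:~R / M) / Num.sqrt M)) +
   charI feps x / charsq x * (\sum_(j <- s) b j * (sin (x * z - x * j%:~R / M) / Num.sqrt M)))).
  have -> : \sum_(j <- s) b j * (cos (x * z - x * j%:~R / M) / Num.sqrt M) =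
     cos (x * z) * (\sum_(j <- s) b j * (cos (x * j%:~R / M) / Num.sqrt M)) +
     sin (x * z) * (\sum_(j <- s) b j * (sin (x * j%:~R / M) / Num.sqrt M)).
    rewrite !mulr_sumr -big_split/=; apply: eq_bigr => j _.
    by rewrite cosB; ring.
  have -> : \sum_(j <- s) b j * (sin (x * z - x * j%:~R / M) / Num.sqrt M) =
     sin (x * z) * (\sum_(j <- s) b j * (cos (x * j%:~R / M) / Num.sqrt M)) -
     cos (x * z) * (\sum_(j <- s) b j * (sin (x * j%:~R / M) / Num.sqrt M)).
    rewrite !mulr_sumr -sumrB/=; apply: eq_bigr => j _.
    by rewrite sinB; ring.
  have -> : \sum_(j <- s) b j * (cos (- x * j%:~R / M) / Num.sqrt M) =
     \sum_(j <- s) b j * (cos (x * j%:~R / M) / Num.sqrt M).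
    by apply: eq_bigr => j _; rewrite !mulNr cosN.
  have -> : \sum_(j <- s) b j * (sin (- x * j%:~R / M) / Num.sqrt M) =
     - \sum_(j <- s) b j * (sin (x * j%:~R / M) / Num.sqrt M).
    by rewrite -sumrN; apply: eq_bigr => j _; rewrite !mulNr sinN mulNr mulrN.
  by ring.
rewrite !mulr_sumr -big_split/= mulr_sumr; apply: eq_bigr => j _.
rewrite (invfM (2 * pi)); move: ((2 * pi)^-1) (Num.sqrt M)^-1 => i r.
by ring.
Qed.

(** Up to the two ends of the band, u_t vanishes off the band: the truncated
    integrals are constant as soon as T >= pi m. *)
Lemma Re_fourier_u_comb (b : int -> R) (s : seq int) (z : R) :
  complex.Re (fourier (u_ feps (comb m b s)) z) = \sum_(j <- s) b j * coef j z.
Proof.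
pose W x := \sum_(j <- s) (b j * (2 * pi * Num.sqrt M)^-1) * coef_kernel j z x.
have cW : continuous W by apply: continuous_sum_fun => j; exact: continuous_coef_kernel.
have WE : \int[mu]_(x in `[- A, A]) W x = \sum_(j <- s) b j * coef j z.
  rewrite Rintegral_itv_sum; last by move=> j; exact: continuous_coef_kernel.
  by apply: eq_bigr => j _; rewrite mulrA.
rewrite -WE /fourier /=; apply/cvg_lim => //; apply: cvg_near_cst; near=> T.
have AT : A <= T.
  by near: T; apply: nbhs_pinfty_ge; rewrite num_real.
rewrite /cintegral /=; have mW := continuous_measurable_fun cW.
rewrite -(Rintegral_patch_itv mW AT).
apply: (@Rintegral_off_points _ _ _ A (- A)).
  by apply/(measurable_restrictT _ _).1 => //; exact: measurable_funTS.
by move=> x xA xNA; rewrite -(Re_u_comb b s z xA xNA).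
Unshelve. all: by end_near. Qed.

End estimator.

(** * The minimiser of the contrast *)

Section argmin.
Context {R : realType}.
Local Notation mu := (@lebesgue_measure R).
Variables (feps : R -> R) (m : nat).
Hypothesis fi : mu.-integrable setT (EFin \o feps).
Hypothesis f0 : forall x, fourierR feps x != 0.
Hypothesis m0 : (0 < m)%N.
Let M : R := m%:R.
Let A := pi * M.
Let M0 : 0 < M. Proof. by rewrite /M ltr0n. Qed.
Let A0 : 0 <= A. Proof. by rewrite mulr_ge0 ?pi_ge0// ltW. Qed.
Let s0 : Num.sqrt M != 0. Proof. by rewrite gt_eqF// sqrtr_gt0. Qed.

Definition centered (k : nat) : seq int :=
  [seq Posz i | i <- iota 0 k.+1] ++ [seq - Posz i | i <- iota 1 k].

Lemma mem_centered k j : (j \in centered k) = (`|j| <= k)%N.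
Proof.
rewrite mem_cat; apply/orP/idP => [[/mapP [i + ->]|/mapP [i + ->]]|jk].
- by rewrite mem_iota => /andP[_ ik]; rewrite absz_nat.
- by rewrite mem_iota => /andP[_ ik]; rewrite abszN absz_nat -ltnS.
case: (intP j) jk => [|i|i] jk.
- by left; apply/mapP; exists 0%N.
- by left; apply/mapP; exists i.+1 => //; rewrite mem_iota.
- by right; apply/mapP; exists i.+1 => //; rewrite mem_iota; rewrite abszN absz_nat in jk.
Qed.

Lemma uniq_centered k : uniq (centered k).
Proof.
rewrite cat_uniq !map_inj_uniq ?iota_uniq//=; last 2 first.
- by move=> x y /oppr_inj [].
- by move=> x y [].
rewrite andbT; apply/hasPn => _ /mapP [i + ->]; rewrite mem_iota => /andP[i0 _].
by apply/negP; rewrite in_cons => /orP[/eqP|/mapP [l _]]; case: i i0.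
Qed.

(** The coefficients ahat_j of the estimator built on the observations z_0,
    ..., z_(n-1). *)
Definition coef_mean (n : nat) (z : nat -> R) (j : int) : R :=
  n%:R^-1 * \sum_(i <- iota 0 n) coef feps m j (z i).

Lemma gamma_n_comb (n : nat) (z : nat -> R) (b : int -> R) (s : seq int) :
  (0 < n)%N -> uniq s ->
  gamma_n feps (fun i : 'I_n => z i) (comb m b s) =
  (\sum_(j <- s) b j ^+ 2 - 2 * \sum_(j <- s) b j * coef_mean n z j)%:E.
Proof.
move=> n0 us; rewrite /gamma_n sqnormE; last exact: L2_comb.
rewrite ip_comb//.
have n0' : (n%:R : R) != 0 by rewrite pnatr_eq0 -lt0n.
under eq_bigr do rewrite Re_fourier_u_comb//= -EFinB.
rewrite sumEFin -EFinM; congr EFin.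
set S := \sum_(j <- s) b j ^+ 2.
rewrite sumrB sumr_const card_ord -[S *+ n]mulr_natl mulrBr mulKf//; congr (_ - _).
rewrite -mulr_sumr mulrCA; congr (_ * _).
rewrite exchange_big/= mulr_sumr; apply: eq_bigr => j _.
rewrite -mulr_sumr mulrCA; congr (_ * (_ * _)).
by rewrite -(big_mkord xpredT (fun i => coef feps m j (z i))) /index_iota subn0.
Qed.

(** Up to a constant the contrast is the sum of (b_j - ahat_j)^2, so its
    minimiser on the span is unique. *)
Lemma argmin_comb (n k : nat) (z : nat -> R) (t : R -> R) : (0 < n)%N ->
  is_argmin (S_fin m k) (gamma_n feps (fun i : 'I_n => z i)) t ->
  t = comb m (coef_mean n z) (centered k).
Proof.
move=> n0 [St Ht].
have uc := uniq_centered k.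
have [s [b [us sk E]]] := lin_span_comb St.
have sc : {subset s <= centered k} by move=> j /sk; rewrite mem_centered.
rewrite (comb_extend m b us uc sc) in E.
set b' := fun j => _ in E.
have /Ht : S_fin m k (comb m (coef_mean n z) (centered k)).
  by apply: comb_lin_span => j; rewrite mem_centered.
rewrite E !gamma_n_comb// lee_fin => H.
have H2 : \sum_(j <- centered k) (b' j - coef_mean n z j) ^+ 2 <= 0.
  have -> : \sum_(j <- centered k) (b' j - coef_mean n z j) ^+ 2 =
    \sum_(j <- centered k) b' j ^+ 2 - 2 * \sum_(j <- centered k) b' j * coef_mean n z j +
    \sum_(j <- centered k) coef_mean n z j ^+ 2.
    rewrite mulr_sumr -sumrB -big_split/=; apply: eq_bigr => j _; ring.
  move: H; rewrite (eq_bigr (fun j => coef_mean n z j ^+ 2) (fun j _ => esym (expr2 (coef_mean n z j)))).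
  lra.
apply/funext => x; rewrite /comb big_seq [RHS]big_seq; apply: eq_bigr => j jc.
congr (_ * _); apply/eqP; rewrite -subr_eq0 -sqrf_eq0 eq_le sqr_ge0 andbT.
apply: le_trans H2; rewrite (bigD1_seq j)//= lerDl.
by apply: sumr_ge0 => i _; exact: sqr_ge0.
Qed.

(** The exponentials exp(itj/m) form an orthogonal family of the real Hilbert
    space of complex functions on the band, each of squared norm 2 A; the sums
    are their inner products with D1 + i D2. *)
Lemma bessel_trig (D1 D2 : R -> R) (s : seq int) : continuous D1 -> continuous D2 -> uniq s ->
  \sum_(j <- s) (\int[mu]_(t in `[- A, A])
     (cos (t * j%:~R / M) * D1 t + sin (t * j%:~R / M) * D2 t)) ^+ 2 <=
  2 * A * \int[mu]_(t in `[- A, A]) (D1 t ^+ 2 + D2 t ^+ 2).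
Proof.
move=> c1 c2 us.
have Lc (h : R -> R) : continuous h -> L2 mu `[- A, A] h.
  move=> ch; split; first by apply: measurable_funTS; exact: continuous_measurable_fun.
  have := continuous_integrable_itv (- A) A (continuous_mul_fun ch ch).
  by apply: eq_integrable => // x _ /=; rewrite expr2.
pose ec (j : int) (t : R) := cos (t * j%:~R / M).
pose es (j : int) (t : R) := sin (t * j%:~R / M).
have cph (j : int) : continuous (fun t : R => t * j%:~R / M).
  rewrite (_ : (fun t => _) = fun t : R => (j%:~R / M) * t); first exact: continuous_scale.
  by apply/funext => t; ring.
have cec j : continuous (ec j) := continuous_comp_fun (@continuous_cos R) (cph j).
have ces j : continuous (es j) := continuous_comp_fun (@continuous_sin R) (cph j).
have Lec j := Lc _ (cec j); have Les j := Lc _ (ces j).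
have L1 := Lc _ c1; have L2' := Lc _ c2.
have mI : measurable (`[- A, A]%classic : set R) by exact: measurable_itv.
pose I (j : int) := \int[mu]_(t in `[- A, A]) (cos (t * j%:~R / M) * D1 t + sin (t * j%:~R / M) * D2 t).
rewrite -/(\sum_(j <- s) I j ^+ 2).
have IE j : I j =
   ip mu `[- A, A] D1 (ec j) + ip mu `[- A, A] D2 (es j).
  rewrite /ip -RintegralD//; try exact: L2_mul_integrable.
  by apply: eq_Rintegral => t _; rewrite /ec /es; ring.
have NE : \int[mu]_(t in `[- A, A]) (D1 t ^+ 2 + D2 t ^+ 2) =
    ip mu `[- A, A] D1 D1 + ip mu `[- A, A] D2 D2.
  by rewrite /ip -RintegralD//; exact: L2_mul_integrable.
have OE j l : ip mu `[- A, A] (ec j) (ec l) + ip mu `[- A, A] (es j) (es l) = 2 * A * (j == l)%:R.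
  rewrite /ip -RintegralD//; try exact: L2_mul_integrable.
  have -> : 2 * A * (j == l)%:R = (j - l == 0)%:R * (2 * pi * m%:R).
    by rewrite subr_eq0 mulrC /A mulrA.
  rewrite -(@integral_cos_int R _ (j - l) m0).
  apply: eq_Rintegral => t _; rewrite /ec /es -cosB; congr cos.
  by rewrite rmorphB/=; ring.
have Ap : 0 < 2 * A by rewrite !mulr_gt0// pi_gt0.
pose c j := (2 * A)^-1 * I j.
have E1 := @ip_sub_sum _ _ _ mu `[- A, A] mI _ s c _ _ Lec L1.
have E2 := @ip_sub_sum _ _ _ mu `[- A, A] mI _ s c _ _ Les L2'.
rewrite /= in E1 E2.
have := ip_ge0 mu `[- A, A] (fun x => D2 x - \sum_(i <- s) c i * es i x).
have := ip_ge0 mu `[- A, A] (fun x => D1 x - \sum_(i <- s) c i * ec i x).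
rewrite E1 E2 => h1 h2; have {h1 h2} := addr_ge0 h1 h2.
have -> : ip mu `[- A, A] D1 D1 - 2 * (\sum_(i <- s) c i * ip mu `[- A, A] D1 (ec i)) +
    \sum_(i <- s) c i * (\sum_(k <- s) c k * ip mu `[- A, A] (ec i) (ec k)) +
   (ip mu `[- A, A] D2 D2 - 2 * (\sum_(i <- s) c i * ip mu `[- A, A] D2 (es i)) +
    \sum_(i <- s) c i * (\sum_(k <- s) c k * ip mu `[- A, A] (es i) (es k))) =
   (ip mu `[- A, A] D1 D1 + ip mu `[- A, A] D2 D2) - 2 * (\sum_(i <- s) c i * I i) +
   \sum_(i <- s) c i * (\sum_(k <- s) c k * (2 * A * (i == k)%:R)).
  have -> : \sum_(i <- s) c i * I i = \sum_(i <- s) c i * ip mu `[- A, A] D1 (ec i) +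
      \sum_(i <- s) c i * ip mu `[- A, A] D2 (es i).
    by rewrite -big_split/=; apply: eq_bigr => i _; rewrite IE mulrDr.
  have -> : \sum_(i <- s) c i * (\sum_(k <- s) c k * (2 * A * (i == k)%:R)) =
     \sum_(i <- s) c i * (\sum_(k <- s) c k * ip mu `[- A, A] (ec i) (ec k)) +
     \sum_(i <- s) c i * (\sum_(k <- s) c k * ip mu `[- A, A] (es i) (es k)).
    rewrite -big_split/=; apply: eq_bigr => i _; rewrite -mulrDr; congr (_ * _).
    by rewrite -big_split/=; apply: eq_bigr => k _; rewrite -OE mulrDr.
  ring.
have -> : \sum_(i <- s) c i * (\sum_(k <- s) c k * (2 * A * (i == k)%:R)) = \sum_(i <- s) c i * I i.
  rewrite big_seq [RHS]big_seq; apply: eq_bigr => i si; rewrite sum_kronecker//.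
  by congr (_ * _); rewrite /c mulrAC mulVf ?mul1r// gt_eqF.
have -> : \sum_(i <- s) c i * I i = (2 * A)^-1 * \sum_(i <- s) I i ^+ 2.
  by rewrite mulr_sumr; apply: eq_bigr => i _; rewrite /c -mulrA expr2.
rewrite -NE => H.
rewrite -ler_pdivrMl//; lra.
Qed.

End argmin.

(** * Error on the coefficients *)

Section coefficient_error.
Context {R : realType}.
Local Notation mu := (@lebesgue_measure R).
Variables (feps g : R -> R) (m : nat).
Hypothesis fi : mu.-integrable setT (EFin \o feps).
Hypothesis f0 : forall x, fourierR feps x != 0.
Hypothesis gi : mu.-integrable setT (EFin \o g).
Hypothesis m0 : (0 < m)%N.
Let M : R := m%:R.
Let A := pi * M.
Let M0 : 0 < M. Proof. by rewrite /M ltr0n. Qed.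
Let A0 : 0 <= A. Proof. by rewrite mulr_ge0 ?pi_ge0// ltW. Qed.
Let s0 : Num.sqrt M != 0. Proof. by rewrite gt_eqF// sqrtr_gt0. Qed.
Let mg : measurable_fun setT g.
Proof. by have [+ _] := integrableP _ _ _ gi => /measurable_EFinP. Qed.

(** Parseval. It reduces to Fubini because phi m j is the transform of a
    bounded function on a bounded band. *)
Lemma ip_phi_fourier (j : int) : ip mu setT g (phi m j) =
  (2 * pi * Num.sqrt M)^-1 * \int[mu]_(t in `[- A, A])
    (cos (t * j%:~R / M) * charR g t + sin (t * j%:~R / M) * charI g t).
Proof.
pose f (z : R * R) := cos (z.2 * z.1 - z.2 * j%:~R / M) * g z.1.
have mf : measurable_fun setT f.
  apply: measurable_funM; last exact: measurableT_comp.
  apply: measurableT_comp; first exact: (continuous_measurable_fun (@continuous_cos R)).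
  apply: measurable_funB; first exact: measurable_funM.
  by apply: measurable_funM => //; exact: measurable_funM.
have cph (y : R) := continuous_comp_fun (@continuous_cos R) (@continuous_phase R m y j).
have i2 y : mu.-integrable `[- A, A] (fun t => (f (y, t))%:E).
  apply: continuous_integrable_itv.
  have ck : continuous (fun _ : R => g y) by move=> u; exact: cvg_cst.
  exact: (continuous_mul_fun (cph y) ck).
have bnd (h : R -> R) : measurable_fun setT h -> (forall y, `|h y| <= 1) ->
    mu.-integrable setT (fun y => (h y * g y)%:E).
  move=> mh h1; apply: (le_integrable _ _ _ gi) => //.
    by apply/measurable_EFinP; exact: measurable_funM.
  by move=> y _ /=; rewrite lee_fin normrM ler_piMl.
have i1 t : mu.-integrable setT (fun y => (f (y, t))%:E).
  apply: (bnd (fun y => cos (t * y - t * j%:~R / M))); last by move=> y; exact: cos_max.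
  apply: continuous_measurable_fun.
  exact: (continuous_comp_fun (@continuous_cos R) (continuous_affine t (- (t * j%:~R / M)))).
have fin : (\int[mu]_(y in setT) \int[mu]_(t in `[(- A)%R, A]) `|f (y, t)|%:E < +oo)%E.
  have ig2 := integrableZl measurableT (2 * A) (integrable_norm gi).
  have [_ fin2] := integrableP _ _ _ ig2.
  apply: le_lt_trans fin2; apply: le_integral_ge0 => y _.
    by apply: integral_ge0 => t _; rewrite lee_fin.
  apply: (@le_trans _ _ (\int[mu]_(t in `[(- A)%R, A]) (cst `|g y|%:E) t)%E).
    apply: le_integral_ge0 => t _; rewrite lee_fin// normrM ler_piMl//; exact: cos_max.
  rewrite integral_cst//= lebesgue_measure_itv/= lte_fin.
  case: ifP => _; last by rewrite mule0 lee_fin.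
  have A2 : 0 <= 2 * A := mulr_ge0 (ler0n _ 2) A0.
  by rewrite -EFinB -EFinM lee_fin opprK normrM normr_id (ger0_norm A2) mulrC mulr_natl.
have := @Fubini_in _ _ _ _ _ mu mu setT `[- A, A] f measurableT (measurable_itv _) mf fin
  (fun y _ => i2 y) (fun t _ => i1 t).
have -> : \int[mu]_y \int[mu]_(t in `[- A, A]) f (y, t) =
   \int[mu]_y ((2 * pi * Num.sqrt M) * (g y * phi m j y)).
  apply: eq_Rintegral => y _; rewrite /f/= RintegralZr//; last first.
    exact: (continuous_integrable_itv _ _ (cph y)).
  rewrite (phi_fourier m0 j y) -/M -/A [g y * _]mulrC !mulrA mulfV ?mul1r//.
  by rewrite !mulf_neq0// gt_eqF// pi_gt0.
rewrite RintegralZl//; last first.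
  apply: (le_integrable _ _ _ (integrableZl measurableT (Num.sqrt M) gi)) => //.
    apply/measurable_EFinP; apply: measurable_funM => //.
    exact: (continuous_measurable_fun (@continuous_phi R m j)).
  move=> y _ /=; rewrite lee_fin !normrM mulrC; apply: ler_wpM2r => //.
  by rewrite sincE ler_piMr// snc_norm_le1.
move=> E; apply: (mulfI (_ : 2 * pi * Num.sqrt M != 0)); first by rewrite !mulf_neq0// gt_eqF// pi_gt0.
rewrite /ip E mulVKf; last by rewrite !mulf_neq0// gt_eqF// pi_gt0.
apply: eq_Rintegral => t _; rewrite /f/=.
have bc := bnd _ (measurable_cos_scale t) (fun y => cos_max _).
have bs := bnd _ (measurable_sin_scale t) (fun y => sin_max _).
rewrite /charR /charI -!RintegralZl// -RintegralD//.
- by apply: eq_Rintegral => y _; rewrite cosB; ring.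
- exact: (integrableZl measurableT _ bc).
- exact: (integrableZl measurableT _ bs).
Qed.

(** Up to the factor 1 / (2 pi sqrt m), the error of index j is the inner
    product of exp(itj/m) with D = D1 + i D2, where D is the empirical
    characteristic function of z divided by the transform of feps, minus the
    transform of g. Bessel bounds the sum of squares by the integral of |D|^2,
    which is the integrand on the right. *)
Lemma coefficient_error (n : nat) (z : nat -> R) (s : seq int) : (0 < n)%N -> uniq s ->
  \sum_(j <- s) (coef_mean feps m n z j - ip mu setT g (phi m j)) ^+ 2 <=
  (2 * pi)^-1 * \int[mu]_(t in `[- A, A])
   (((charR g t * charR feps t - charI g t * charI feps t
       - \sum_(i <- iota 0 n) n%:R^-1 * cos (t * z i)) ^+ 2 +
     (charI g t * charR feps t + charR g t * charI feps t
       - \sum_(i <- iota 0 n) n%:R^-1 * sin (t * z i)) ^+ 2) / charsq feps t).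
Proof.
move=> n0 us.
have [cfR cfI] := continuous_char fi; have [cgR cgI] := continuous_char gi.
have [cq1 cq2] := continuous_q fi f0.
pose A1 t := \sum_(i <- iota 0 n) n%:R^-1 * cos (t * z i).
pose A2 t := \sum_(i <- iota 0 n) n%:R^-1 * sin (t * z i).
have czi (y : R) : continuous (fun t : R => t * y).
  by move=> u; apply: cvgM; [exact: cvg_id|exact: cvg_cst].
have cA1 : continuous A1.
  by apply: continuous_sum_fun => i; exact: (continuous_comp_fun (@continuous_cos R) (czi _)).
have cA2 : continuous A2.
  by apply: continuous_sum_fun => i; exact: (continuous_comp_fun (@continuous_sin R) (czi _)).
pose D1 t := A1 t * q1 feps t + A2 t * q2 feps t - charR g t.
pose D2 t := A2 t * q1 feps t - A1 t * q2 feps t - charI g t.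
have cD1 : continuous D1.
  move=> t; apply: cvgB; last exact: cgR.
  by apply: cvgD; [exact: (continuous_mul_fun cA1 cq1)|exact: (continuous_mul_fun cA2 cq2)].
have cD2 : continuous D2.
  move=> t; apply: cvgB; last exact: cgI.
  by apply: cvgB; [exact: (continuous_mul_fun cA2 cq1)|exact: (continuous_mul_fun cA1 cq2)].
have k0 : 2 * pi * Num.sqrt M != 0 by rewrite !mulf_neq0// gt_eqF// pi_gt0.
pose I (j : int) := \int[mu]_(t in `[- A, A]) (cos (t * j%:~R / M) * D1 t + sin (t * j%:~R / M) * D2 t).
have cph (j : int) : continuous (fun t : R => t * j%:~R / M).
  rewrite (_ : (fun t => _) = fun t : R => (j%:~R / M) * t); first exact: continuous_scale.
  by apply/funext => t; ring.
have cc (j : int) := continuous_comp_fun (@continuous_cos R) (cph j).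
have cs (j : int) := continuous_comp_fun (@continuous_sin R) (cph j).
have IE j : coef_mean feps m n z j - ip mu setT g (phi m j) = (2 * pi * Num.sqrt M)^-1 * I j.
  rewrite ip_phi_fourier /coef_mean /coef -mulr_sumr mulrCA -mulrBr; congr (_ * _).
  rewrite mulr_sumr -Rintegral_itv_sum; last first.
    by move=> i; exact: (continuous_coef_kernel fi f0).
  rewrite -RintegralB//; last 2 first.
  - apply: continuous_integrable_itv; apply: continuous_sum_fun => i; exact: (continuous_coef_kernel fi f0).
  - apply: continuous_integrable_itv => t.
    by apply: cvgD; [exact: (continuous_mul_fun (cc j) cgR)|exact: (continuous_mul_fun (cs j) cgI)].
  apply: eq_Rintegral => t _.
  have -> : \sum_(i <- iota 0 n) n%:R^-1 * coef_kernel feps m j (z i) t =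
     cos (t * j%:~R / M) * (A1 t * q1 feps t + A2 t * q2 feps t) +
     sin (t * j%:~R / M) * (A2 t * q1 feps t - A1 t * q2 feps t).
    rewrite /A1 /A2 mulrBr !mulrDr !mulr_suml !mulr_sumr -big_split -sumrB -big_split/=.
    apply: eq_bigr => i _; rewrite /coef_kernel cosB sinB; ring.
  by rewrite /D1 /D2; ring.
have -> : \sum_(j <- s) (coef_mean feps m n z j - ip mu setT g (phi m j)) ^+ 2 =
  (2 * pi * Num.sqrt M) ^- 2 * \sum_(j <- s) I j ^+ 2.
  by rewrite mulr_sumr; apply: eq_bigr => j _; rewrite IE exprMn exprVn.
have K2 : 0 <= (2 * pi * Num.sqrt M) ^- 2 by rewrite invr_ge0 sqr_ge0.
apply: (le_trans (ler_wpM2l K2 (bessel_trig m0 cD1 cD2 us))).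
rewrite -/M -/A le_eqVlt; apply/orP; left; apply/eqP.
rewrite mulrA; congr (_ * _).
  have ssq : Num.sqrt M ^+ 2 = M by rewrite sqr_sqrtr// ltW.
  rewrite !exprMn ssq /A; move: (pi : R) (gt_eqF (pi_gt0 R)) => p p0.
  by field; rewrite p0 gt_eqF.
apply: eq_Rintegral => t _.
have c0 : charsq feps t != 0 by rewrite gt_eqF// charsq_gt0.
rewrite /D1 /D2 -/(A1 t) -/(A2 t) /q1 /q2 /charsq.
move: c0; rewrite /charsq; move: (A1 t) (A2 t) => a1 a2.
move: (charR feps t) (charI feps t) (charR g t) (charI g t) => fc fs gc gs c0.
by field.
Qed.

End coefficient_error.

(** * Expected error on the coefficients *)

Lemma Tonelli_in d1 d2 (T1 : measurableType d1) (T2 : measurableType d2) (R : realType)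
    (m1 : {sigma_finite_measure set T1 -> \bar R})
    (m2 : {sigma_finite_measure set T2 -> \bar R})
    (D : set T2) (f : T1 * T2 -> R) :
  measurable D -> measurable_fun setT f -> (forall z, 0 <= f z) ->
  (\int[m1]_x \int[m2]_(y in D) (f (x, y))%:E =
   \int[m2]_(y in D) \int[m1]_x (f (x, y))%:E)%E.
Proof.
move=> mD mf f0.
pose h (z : T1 * T2) := (\1_D z.2 * f z)%:E.
have mh : measurable_fun setT h.
  apply/measurable_EFinP; apply: measurable_funM => //.
  by apply: measurableT_comp => //; exact: measurable_indic.
have h0 z : (0 <= h z)%E by rewrite lee_fin mulr_ge0.
transitivity (\int[m1]_x \int[m2]_y h (x, y))%E.
  apply: eq_integral => x _; rewrite integral_mkcond.
  by apply: eq_integral => y _; rewrite patchE /h/= indicE; case: ifP; rewrite ?mul1r ?mul0r.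
rewrite (@fubini_tonelli _ _ T1 T2 R m1 m2 h mh h0) [in RHS]integral_mkcond.
apply: eq_integral => y _; rewrite patchE /h/= indicE; case: ifP => _.
  by apply: eq_integral => x _; rewrite mul1r.
by rewrite integral0_eq// => x _; rewrite mul0r.
Qed.

Lemma measurable_coef (R : realType) (feps : R -> R) :
  (@lebesgue_measure R).-integrable setT (EFin \o feps) ->
  (forall x, fourierR feps x != 0) ->
  forall (m : nat) (j : int), measurable_fun setT (coef feps m j).
Proof.
move=> fi f0 m j; have [c1 c2] := continuous_q fi f0.
have mp : measurable_fun setT (fun z : R * R => z.2 * z.1 - z.2 * j%:~R / m%:R).
  apply: measurable_funB; first exact: measurable_funM.
  by apply: measurable_funM => //; exact: measurable_funM.
have mk : measurable_fun setT (fun z : R * R => coef_kernel feps m j z.1 z.2).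
  apply: measurable_funD; apply: measurable_funM.
  - exact: (measurableT_comp (continuous_measurable_fun (@continuous_cos R)) mp).
  - exact: (measurableT_comp (continuous_measurable_fun c1)).
  - exact: (measurableT_comp (continuous_measurable_fun (@continuous_sin R)) mp).
  - exact: (measurableT_comp (continuous_measurable_fun c2)).
apply: measurable_funM => //.
exact: (measurable_integral_param lebesgue_measure (measurable_itv _) mk).
Qed.

Section expected_error.
Context d (T : measurableType d) (R : realType) (P : probability T R).
Local Notation mu := (@lebesgue_measure R).

Lemma measurable_Ecos_Esin (Y : T -> R) : measurable_fun setT Y ->
  measurable_fun setT (Ecos P Y) /\ measurable_fun setT (Esin P Y).
Proof.
move=> mY.
have mp : measurable_fun setT (fun z : R * T => z.1 * Y z.2).
  by apply: measurable_funM => //; exact: measurableT_comp.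
have mc := measurableT_comp (continuous_measurable_fun (@continuous_cos R)) mp.
have ms := measurableT_comp (continuous_measurable_fun (@continuous_sin R)) mp.
by split; [exact: (measurable_integral_param P measurableT mc)|
           exact: (measurable_integral_param P measurableT ms)].
Qed.

Lemma measurable_cmod_ccov (Y W : T -> R) : measurable_fun setT Y -> measurable_fun setT W ->
  measurable_fun setT (fun t : R =>
    cmod (ccov P (fun w => expi (t * Y w)) (fun w => expi (t * W w)))).
Proof.
move=> mY mW.
have [c1 s1] := measurable_Ecos_Esin mY; have [c2 s2] := measurable_Ecos_Esin mW.
have [c3 s3] := measurable_Ecos_Esin (measurable_funB mY mW).
rewrite (_ : (fun t => _) = fun t => Num.sqrt
   ((Ecos P (fun w => Y w - W w) t - (Ecos P Y t * Ecos P W t + Esin P Y t * Esin P W t)) ^+ 2 +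
    (Esin P (fun w => Y w - W w) t - (Esin P Y t * Ecos P W t - Ecos P Y t * Esin P W t)) ^+ 2));
  last by apply/funext => t; rewrite ccov_expi// cmodE.
apply: measurableT_comp; first exact: (continuous_measurable_fun (@sqrt_continuous R)).
apply: measurable_funD; apply: measurable_funX; apply: measurable_funB => //.
  by apply: measurable_funD; exact: measurable_funM.
by apply: measurable_funB; exact: measurable_funM.
Qed.

Variables (X eps : nat -> {RV P >-> R}) (g feps : R -> R).
Hypothesis statX : strictly_stationary X.
Hypothesis gX : forall i, has_density (X i) g.
Hypothesis indE : mutually_independent eps.
Hypothesis fE : forall i, has_density (eps i) feps.
Hypothesis indXE : independent_sigma P (sigma_seq X) (sigma_seq eps).
Hypothesis fi : mu.-integrable setT (EFin \o feps).
Hypothesis f0 : forall x, fourierR feps x != 0.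
Hypothesis gi : mu.-integrable setT (EFin \o g).
Variable m : nat.
Hypothesis m0 : (0 < m)%N.

(** Tonelli brings the expectation inside the integral over frequencies, where
    the variance bound divided by the squared modulus of the transform of feps
    applies pointwise. *)
Lemma expected_coefficient_error (n : nat) (s : seq int) : (0 < n)%N -> uniq s ->
  (\int[P]_w (\sum_(j <- s) (coef_mean feps m n (fun i => X i w + eps i w) j
       - ip mu setT g (phi m j)) ^+ 2)%:E
   <= (n%:R^-1)%:E * Delta feps m + (n%:R^-1)%:E * R_ X n m)%E.
Proof.
move=> n0 us; have n0' : 0 <= (n%:R : R)^-1 by rewrite invr_ge0.
have [cfR cfI] := continuous_char fi; have [cgR cgI] := continuous_char gi.
have c0 t : charsq feps t != 0 by rewrite gt_eqF// charsq_gt0.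
have c1 t : 0 <= charsq feps t by rewrite ltW// charsq_gt0.
pose A : R := pi * m%:R.
pose Z i w := X i w + eps i w.
have mZ i : measurable_fun setT (Z i) by apply: measurable_funD.
pose mu1 t := charR g t * charR feps t - charI g t * charI feps t.
pose mu2 t := charI g t * charR feps t + charR g t * charI feps t.
pose N (z : T * R) :=
  ((mu1 z.2 - \sum_(i <- iota 0 n) n%:R^-1 * cos (z.2 * Z i z.1)) ^+ 2 +
   (mu2 z.2 - \sum_(i <- iota 0 n) n%:R^-1 * sin (z.2 * Z i z.1)) ^+ 2) / charsq feps z.2.
have N0 z : 0 <= N z by rewrite divr_ge0// addr_ge0// sqr_ge0.
have cmu1 : continuous mu1.
  by move=> t; apply: cvgB; [exact: (continuous_mul_fun cgR cfR)|exact: (continuous_mul_fun cgI cfI)].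
have cmu2 : continuous mu2.
  by move=> t; apply: cvgD; [exact: (continuous_mul_fun cgI cfR)|exact: (continuous_mul_fun cgR cfI)].
have cV : continuous (fun t => (charsq feps t)^-1).
  by move=> x; apply: cvgV; [exact: c0|exact: continuous_charsq].
have cN w : continuous (fun t => N (w, t)).
  have czi i : continuous (fun t : R => t * Z i w).
    by move=> u; apply: cvgM; [exact: cvg_id|exact: cvg_cst].
  have cA : continuous (fun t => mu1 t - \sum_(i <- iota 0 n) n%:R^-1 * cos (t * Z i w)).
    move=> t; apply: cvgB; first exact: cmu1.
    by apply: continuous_sum_fun => i; exact: (continuous_comp_fun (@continuous_cos R) (czi _)).
  have cB : continuous (fun t => mu2 t - \sum_(i <- iota 0 n) n%:R^-1 * sin (t * Z i w)).
    move=> t; apply: cvgB; first exact: cmu2.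
    by apply: continuous_sum_fun => i; exact: (continuous_comp_fun (@continuous_sin R) (czi _)).
  rewrite /N/=; move=> t; apply: cvgM; last exact: cV.
  by apply: cvgD; [exact: (continuous_mul_fun cA cA)|exact: (continuous_mul_fun cB cB)].
have mN : measurable_fun setT N.
  have mz i : measurable_fun setT (fun z : T * R => z.2 * Z i z.1).
    by apply: measurable_funM => //; exact: measurableT_comp.
  apply: measurable_funM; last exact: (measurableT_comp (continuous_measurable_fun cV)).
  apply: measurable_funD; apply: measurable_funX; apply: measurable_funB.
  - exact: (measurableT_comp (continuous_measurable_fun cmu1)).
  - apply: measurable_sum => i; apply: measurable_funM => //.
    exact: (measurableT_comp (continuous_measurable_fun (@continuous_cos R)) (mz i)).
  - exact: (measurableT_comp (continuous_measurable_fun cmu2)).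
  - apply: measurable_sum => i; apply: measurable_funM => //.
    exact: (measurableT_comp (continuous_measurable_fun (@continuous_sin R)) (mz i)).
pose kap l t := cmod (ccov P (fun w => expi (t * X 0%N w)) (fun w => expi (t * X l w))).
have kap0 l t : 0 <= kap l t by rewrite /kap cmodE sqrtr_ge0.
have mkap l : measurable_fun setT (kap l) by exact: measurable_cmod_ccov.
have pi2 : 0 <= ((2 * pi)^-1 : R) by rewrite invr_ge0 mulr_ge0// pi_ge0.
apply: (@le_trans _ _ (\int[P]_w (((2 * pi)^-1)%:E * \int[mu]_(t in `[(- A)%R, A]) (N (w, t))%:E))%E).
  apply: le_integral_ge0 => w _; first by rewrite lee_fin sumr_ge0// => j _; exact: sqr_ge0.
  have Ni := continuous_integrable_itv (- A) A (cN w).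
  rewrite -[X in (_ * X)%E]fineK; last exact: integrable_fin_num.
  rewrite -EFinM lee_fin.
  exact: (@coefficient_error _ feps g m fi f0 gi m0 n (fun i => Z i w) s n0 us).
rewrite ge0_integralZl//; last 2 first.
- rewrite (_ : (fun w => _) = EFin \o (fun w => \int[mu]_(t in `[- A, A]) N (w, t)) :> (T -> \bar R)).
    apply: (measurableT_comp (@EFin_measurable R setT)).
    exact: (measurable_integral_param mu (measurable_itv _) mN).
  apply/funext => w /=; rewrite fineK//; apply: integrable_fin_num => //.
  exact: continuous_integrable_itv.
- by move=> w _; apply: integral_ge0 => t _; rewrite lee_fin.
rewrite Tonelli_in//.
have bound t : (\int[P]_w (N (w, t))%:E <=
    (n%:R^-1 * (charsq feps t)^-1 + 2 / n%:R * \sum_(1 <= l < n) kap l t)%:E)%E.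
  have bS : bounded_measurable (fun w =>
      (mu1 t - \sum_(i <- iota 0 n) n%:R^-1 * cos (t * Z i w)) ^+ 2 +
      (mu2 t - \sum_(i <- iota 0 n) n%:R^-1 * sin (t * Z i w)) ^+ 2).
    apply: bm_add; under eq_fun do rewrite expr2; apply: bm_mul; apply: bm_sub;
      try exact: bm_cst; apply: bm_sum => i; apply: bm_scale; [exact: bm_cos|exact: bm_cos|exact: bm_sin|exact: bm_sin].
  have bN : bounded_measurable (fun w => N (w, t)).
    by rewrite /N/=; apply: bm_mul => //; exact: bm_cst.
  rewrite -[leLHS]fineK; last by apply: integrable_fin_num => //; exact: prob_integrable.
  rewrite lee_fin.
  have V := variance_bound statX gX indE fE indXE t n0.
  rewrite -/(Rintegral P setT (fun w => N (w, t))) /N/= RintegralZr//; last exact: prob_integrable.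
  rewrite ler_pdivrMr ?charsq_gt0//; apply: le_trans V _.
  rewrite -/(charsq feps t) [leRHS](_ : _ = n%:R^-1 * ((charsq feps t)^-1 * charsq feps t)
    + 2 / n%:R * (charsq feps t * \sum_(1 <= l < n) kap l t)); last by ring.
  by rewrite mulVf// mulr1.
apply: (@le_trans _ _ (((2 * pi)^-1)%:E * \int[mu]_(t in `[(- A)%R, A])
   ((n%:R^-1)%:E * ((charsq feps t)^-1)%:E + (2 / n%:R)%:E * \sum_(1 <= l < n) (kap l t)%:E))%E).
  apply: lee_wpmul2l; first by rewrite lee_fin.
  apply: le_integral_ge0 => t _; first by apply: integral_ge0 => w _; rewrite lee_fin.
  by rewrite sumEFin -!EFinM -EFinD; exact: bound.
have mV : measurable_fun `[- A, A] (fun t => ((charsq feps t)^-1)%:E).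
  by apply/measurable_EFinP; apply: measurable_funTS; exact: continuous_measurable_fun.
have mk l : measurable_fun `[- A, A] (fun t => (kap l t)%:E).
  by apply/measurable_EFinP; apply: measurable_funTS.
have V0 t : (0 <= ((charsq feps t)^-1)%:E)%E by rewrite lee_fin invr_ge0.
have k0 l t : (0 <= (kap l t)%:E)%E by rewrite lee_fin.
have S0 t : (0 <= \sum_(1 <= l < n) (kap l t)%:E)%E by apply: sume_ge0 => l _; exact: k0.
have mS : measurable_fun `[- A, A] (fun t => \sum_(1 <= l < n) (kap l t)%:E)%E.
  by apply: emeasurable_sum => l.
have n2 : 0 <= 2 / (n%:R : R) by rewrite divr_ge0.
rewrite ge0_integralD//=; last 4 first.
- by move=> t _; rewrite mule_ge0// lee_fin.
- exact: measurable_funeM.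
- by move=> t _; rewrite mule_ge0// lee_fin.
- exact: measurable_funeM.
rewrite !ge0_integralZl ?lee_fin//.
have IV : (0 <= \int[mu]_(t in `[(- A)%R, A]) ((charsq feps t)^-1)%:E)%E by apply: integral_ge0.
have IS : (0 <= \int[mu]_(t in `[(- A)%R, A]) \sum_(1 <= l < n) (kap l t)%:E)%E.
  by apply: integral_ge0 => t _; exact: S0.
rewrite ge0_muleDr; last 2 first.
- by rewrite mule_ge0// lee_fin.
- by rewrite mule_ge0// lee_fin.
rewrite le_eqVlt; apply/orP; left; apply/eqP; congr (_ + _)%E.
  rewrite muleCA /Delta; congr (_ * (_ * _))%E.
  by apply: eq_integral => t _; rewrite cmod_fourierR.
rewrite /R_ ge0_integral_sum// !muleA -!EFinM; congr (_%:E * _)%E.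
by move: (pi : R) (gt_eqF (pi_gt0 R)) => p p0; field; rewrite p0 pnatr_eq0 -lt0n.
Qed.

End expected_error.

(** * Conditional distributions *)

Section disintegration.
Context d (T : measurableType d) (R : realType) (P : probability T R).
Variables (U W : {RV P >-> R}) (K : T -> probability R R).
Hypothesis HK : cond_distribution (sigma_RV U) W K.

Let mU : measurable_fun setT (U : T -> R). Proof. by []. Qed.
Let mW : measurable_fun setT (W : T -> R). Proof. by []. Qed.

Lemma measurable_cond_distribution (A : set R) : measurable A ->
  measurable_fun setT (fun w => K w A).
Proof.
move=> mA _ B mB; have [+ _] := HK mA => /(_ (setT `&` (K ^~ A) @^-1` B)).
by case=> [|C mC <-]; [exists B|exact: mU].
Qed.

Lemma integral_cond_le1 (h : R -> R) w : (forall y, `|h y| <= 1) -> measurable_fun setT h ->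
  `|\int[K w]_y h y| <= 1.
Proof.
move=> h1 mh; have bh : bounded_measurable h by split => //; exists 1.
apply: (le_trans (le_normr_Rintegral measurableT (prob_integrable (K w) bh))).
rewrite [leRHS](_ : _ = \int[K w]_y (1 : R)); last by rewrite Rintegral_prob1// probability_setT.
apply: le_Rintegral => //; last exact: (prob_integrable (K w) (@bm_cst _ R R 1)).
exact: (integrable_norm (prob_integrable (K w) bh)).
Qed.

(** The integral of the nonnegative function h + 1 against the kernel K is
    measurable in w. *)
Lemma bm_cond_integral (h : R -> R) : measurable_fun setT h -> (forall y, `|h y| <= 1) ->
  bounded_measurable (fun w => \int[K w]_y h y).
Proof.
move=> mh h1; split; last by exists 1 => w; exact: integral_cond_le1.
have bh : bounded_measurable h by split => //; exists 1.
have b1 := @bm_cst _ R R 1.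
rewrite (_ : (fun w => _) = (fun w => fine (\int[K w]_y (h y + 1)%:E)%E - 1)); last first.
  apply/funext => w; rewrite -/(Rintegral (K w) setT (fun y => h y + 1)).
  by rewrite ED// Rintegral_prob1// probability_setT/= addrK.
apply: measurable_funB => //.
apply: (measurableT_comp (@fine_measurable R setT measurableT)).
apply: (measurable_fun_integral_kernel (l := K : T -> {measure set R -> \bar R})).
- by move=> A mA; exact: measurable_cond_distribution.
- move=> y; rewrite lee_fin; have := h1 y; rewrite ler_norml => /andP[+ _]; lra.
- by apply/measurable_EFinP; exact: measurable_funD.
Qed.

(** Both sides are bounded linear functionals of p, and of h. For p and h the
    indicators of A and B the identity is the defining property of the
    conditional distribution on the event that U is in A. *)
Lemma disintegration (p h : R -> R) :
  measurable_fun setT p -> (forall x, `|p x| <= 1) ->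
  measurable_fun setT h -> (forall y, `|h y| <= 1) ->
  \int[P]_w (p (U w) * h (W w)) = \int[P]_w (p (U w) * \int[K w]_y h y).
Proof.
move=> mp p1 mh h1.
have bp : bounded_measurable (fun w => p (U w)) by exact: bm_comp.
have i1 (A : set R) : measurable A -> (forall x, `|\1_A x| <= 1 :> R).
  by move=> mA x; rewrite indicE; case: (_ \in _); rewrite ?normr1 ?normr0.
transitivity (\int[P]_w (h (W w) * p (U w))).
  by apply: eq_Rintegral => w _; rewrite mulrC.
have L1 := linear_bounded_integral mW (prob_integrable P bp).
pose Psi (f : R -> R) := \int[P]_w (p (U w) * \int[K w]_y f y).
have bK (f : R -> R) : bounded_measurable f -> bounded_measurable (fun w => \int[K w]_y f y).
  move=> [mf [k fk]]; pose k' := `|k| + 1.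
  have k0 : 0 < k' by rewrite ltr_wpDl.
  have fk' y : `|k'^-1 * f y| <= 1.
    rewrite normrM gtr0_norm ?invr_gt0// ler_pdivrMl// mulr1.
    by rewrite (le_trans (fk y))// (le_trans (ler_norm k))// lerDl.
  have mf' : measurable_fun setT (fun y => k'^-1 * f y) by exact: measurable_funM.
  have := bm_scale k' (bm_cond_integral mf' fk').
  congr bounded_measurable; apply/funext => w.
  rewrite RintegralZl//; first by rewrite mulVKf// gt_eqF.
  by apply: prob_integrable; split => //; exists k.
have L2 : linear_bounded Psi.
  split.
  - move=> f f' bf bf'; rewrite /Psi -ED; try by apply: bm_mul => //; exact: bK.
    by apply: eq_Rintegral => w _; rewrite -mulrDr ED.
  - move=> c f bf; rewrite /Psi -RintegralZl//; last first.
      by apply: prob_integrable; apply: bm_mul => //; exact: bK.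
    apply: eq_Rintegral => w _; rewrite RintegralZl//; first by rewrite mulrCA.
    exact: prob_integrable.
  - exists 1 => // f k mf fk; rewrite mul1r.
    have bf : bounded_measurable f by split => //; exists k.
    have bb : bounded_measurable (fun w => p (U w) * \int[K w]_y f y) by apply: bm_mul => //; exact: bK.
    apply: (le_trans (le_normr_Rintegral measurableT (prob_integrable P bb))).
    rewrite [leRHS](_ : _ = \int[P]_y k); last by rewrite Rintegral_cst// -[X in fine X]/(P setT) probability_setT mulr1.
    apply: le_Rintegral => //; last 2 first.
    - exact: (prob_integrable P (@bm_cst _ T R k)).
    - move=> w _; rewrite normrM -[k]mul1r ler_pM//.
      apply: (le_trans (le_normr_Rintegral measurableT (prob_integrable (K w) bf))).
      rewrite [leRHS](_ : _ = \int[K w]_y k); last by rewrite Rintegral_cst// -[X in fine X]/(K w setT) probability_setT mulr1.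
      apply: le_Rintegral => //; last exact: (prob_integrable (K w) (@bm_cst _ R R k)).
      exact: (integrable_norm (prob_integrable (K w) bf)).
    - exact: (integrable_norm (prob_integrable P bb)).
apply: (agree_on_indic L1 L2) => // B mB.
have bB : bounded_measurable (fun w => \1_B (W w) : R) by apply: bm_comp => //; exact: i1.
have bKB : bounded_measurable (fun w => \int[K w]_y \1_B y) by apply: bK; exact: bm_indic.
transitivity (\int[P]_w (p (U w) * \1_B (W w))).
  by apply: eq_Rintegral => w _; rewrite mulrC.
apply: (agree_on_indic (linear_bounded_integral mU (prob_integrable P bB))
                       (linear_bounded_integral mU (prob_integrable P bKB))) => // A mA.
rewrite [LHS]Rintegral_indic_comp [RHS]Rintegral_indic_comp.
have mUA : measurable (U @^-1` A) by rewrite -[U @^-1` A]setTI; exact: mU.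
transitivity (fine (P (U @^-1` A `&` W @^-1` B))).
  rewrite -Rintegral_prob1; last by apply: measurableI => //; rewrite -[W @^-1` B]setTI; exact: mW.
  rewrite setIC Rintegral_mkcondl; apply: eq_Rintegral => w _.
  rewrite patchE indicE; have -> : (w \in W @^-1` B) = (W w \in B) by apply/idP/idP; rewrite !inE.
  by case: ifP.
have [_ /(_ (U @^-1` A))] := HK mB.
move=> <-; last by exists A => //; rewrite setTI.
congr fine; apply: eq_integral => w _.
rewrite /Rintegral integral_indic// setIT fineK//.
exact: fin_num_measure.
Qed.

Lemma cov_disintegration (p h : R -> R) :
  measurable_fun setT p -> (forall x, `|p x| <= 1) ->
  measurable_fun setT h -> (forall y, `|h y| <= 1) ->
  \int[P]_w (p (U w) * h (W w)) - \int[P]_w p (U w) * \int[P]_w h (W w) =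
  \int[P]_w (p (U w) * (\int[K w]_y h y - \int[P]_v h (W v))).
Proof.
move=> mp p1 mh h1; rewrite disintegration//.
have bp : bounded_measurable (fun w => p (U w)) by exact: bm_comp.
rewrite -RintegralZr//; last exact: prob_integrable.
rewrite -EB; last 2 first.
- by apply: bm_mul => //; exact: bm_cond_integral.
- by apply: bm_mul => //; exact: bm_cst.
by apply: eq_Rintegral => w _; rewrite mulrBr.
Qed.

End disintegration.

(** * Covariances and dependence coefficients *)

(** th is the argument of z, and the right side is the real part of exp(- i th)
    z. *)
Lemma cmod_rotation (R : realType) (z : R[i]) :
  exists th : R, cmod z = cos th * complex.Re z + sin th * complex.Im z.
Proof.
rewrite cmodE; move: (complex.Re z) (complex.Im z) => x y.
set r := Num.sqrt _.
have r2 : r ^+ 2 = x ^+ 2 + y ^+ 2 by rewrite sqr_sqrtr// addr_ge0 ?sqr_ge0.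
have [r0|r0] := eqVneq r 0.
  have : x ^+ 2 + y ^+ 2 == 0 by rewrite -r2 r0 expr0n.
  rewrite paddr_eq0 ?sqr_ge0// !sqrf_eq0 => /andP[/eqP -> /eqP ->].
  by exists 0; rewrite r0 !mulr0 addr0.
have rp : 0 < r by rewrite lt_neqAle eq_sym r0 sqrtr_ge0.
have x1 : -1 <= x / r <= 1.
  rewrite -ler_norml normrM normfV (gtr0_norm rp) ler_pdivrMr// mul1r.
  by rewrite -sqrtr_sqr ler_wsqrtr// lerDl sqr_ge0.
have s1 : Num.sqrt (1 - (x / r) ^+ 2) = `|y| / r.
  rewrite -[RHS]ger0_norm; last by rewrite divr_ge0// ltW.
  rewrite -sqrtr_sqr; congr Num.sqrt; rewrite !expr_div_n real_normK ?num_real//.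
  by apply: (mulIf (_ : r ^+ 2 != 0)); rewrite ?sqrf_eq0// mulrBl !mulfVK ?sqrf_eq0// mul1r r2; ring.
have cK : cos (acos (x / r)) = x / r by rewrite acosK// in_itv.
have [y0|y0] := leP 0 y.
  exists (acos (x / r)); rewrite cK sin_acos// s1 ger0_norm//.
  by apply: (mulIf r0); rewrite -expr2 r2; field.
exists (- acos (x / r)); rewrite cosN sinN cK sin_acos// s1 ltr0_norm//.
by apply: (mulIf r0); rewrite -expr2 r2; field.
Qed.

Lemma expectation_le d (T : measurableType d) (R : realType) (P : probability T R)
    (f : T -> R) (S : T -> \bar R) : bounded_measurable f ->
  (forall w, (`|f w|%:E <= S w)%E) -> ((\int[P]_w f w)%:E <= \int[P]_w S w)%E.
Proof.
move=> bf fS; have fi := prob_integrable P bf.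
apply: (@le_trans _ _ (\int[P]_w `|f w|%:E)%E).
  rewrite -[leRHS]fineK; last first.
    by apply: integrable_fin_num => //; exact: (integrable_norm fi).
  by rewrite lee_fin (le_trans (ler_norm _))// le_normr_Rintegral.
by apply: le_integral_ge0.
Qed.

Lemma expectation_phase d (T : measurableType d) (R : realType) (P : probability T R)
    (Y : T -> R) (t c : R) : measurable_fun setT Y ->
  \int[P]_w cos (t * Y w - c) = cos c * Ecos P Y t + sin c * Esin P Y t /\
  \int[P]_w sin (t * Y w - c) = cos c * Esin P Y t - sin c * Ecos P Y t.
Proof.
move=> mY; have bc := bm_cos t mY; have bs := bm_sin t mY.
split; rewrite /Ecos /Esin -!RintegralZl//; try exact: prob_integrable.
  rewrite -ED; [|exact: bm_scale|exact: bm_scale].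
  by apply: eq_Rintegral => w _; rewrite cosB; ring.
rewrite -EB; [|exact: bm_scale|exact: bm_scale].
by apply: eq_Rintegral => w _; rewrite sinB; ring.
Qed.

Section dependence.
Context d (T : measurableType d) (R : realType) (P : probability T R).
Local Notation mu := (@lebesgue_measure R).

(** Rotated so as to be real, the covariance is Cov(cos(tU - th), cos(tW)) +
    Cov(sin(tU - th), sin(tW)). Disintegrating both terms and adding them
    gives, for each w, the integral of cos(ty - c(w)) against K_w minus the law
    of W, with c = tU - th. *)
Lemma ccov_phase (U W : {RV P >-> R}) (K : T -> probability R R) (t : R) :
  cond_distribution (sigma_RV U) W K ->
  exists (D c : T -> R), [/\ bounded_measurable D,
    cmod (ccov P (fun w => expi (t * U w)) (fun w => expi (t * W w))) = \int[P]_w D w &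
    forall w, D w = \int[K w]_y cos (t * y - c w) - \int[P]_v cos (t * W v - c w)].
Proof.
move=> HK; have mU : measurable_fun setT (U : T -> R) by [].
have mW : measurable_fun setT (W : T -> R) by [].
have mUW : measurable_fun setT (fun w => U w - W w) by exact: measurable_funB.
have [th] := cmod_rotation (ccov P (fun w => expi (t * U w)) (fun w => expi (t * W w))).
rewrite ccov_expi//= => ->.
have mi : measurable_fun setT (fun y : R => y) by [].
have mc := measurable_cos_scale t; have ms := measurable_sin_scale t.
have c1 (y : R) : `|cos (t * y)| <= 1 by exact: cos_max.
have s1 (y : R) : `|sin (t * y)| <= 1 by exact: sin_max.
pose p x := cos (t * x - th); pose q x := sin (t * x - th).
have cth := continuous_affine t (- th).
have mp : measurable_fun setT p.
  by apply: continuous_measurable_fun; exact: (continuous_comp_fun (@continuous_cos R) cth).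
have mq : measurable_fun setT q.
  by apply: continuous_measurable_fun; exact: (continuous_comp_fun (@continuous_sin R) cth).
have p1 x : `|p x| <= 1 by exact: cos_max.
have q1 x : `|q x| <= 1 by exact: sin_max.
pose kc w := \int[K w]_y cos (t * y) - \int[P]_v cos (t * W v).
pose ks w := \int[K w]_y sin (t * y) - \int[P]_v sin (t * W v).
have bp : bounded_measurable (fun w => p (U w)) by exact: bm_comp.
have bq : bounded_measurable (fun w => q (U w)) by exact: bm_comp.
have bkc : bounded_measurable kc by apply: bm_sub; [exact: (bm_cond_integral HK)|exact: bm_cst].
have bks : bounded_measurable ks by apply: bm_sub; [exact: (bm_cond_integral HK)|exact: bm_cst].
exists (fun w => p (U w) * kc w + q (U w) * ks w), (fun w => t * U w - th); split.
- by apply: bm_add; exact: bm_mul.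
- rewrite ED; [|exact: bm_mul|exact: bm_mul].
  rewrite -(cov_disintegration HK mp p1 mc c1) -(cov_disintegration HK mq q1 ms s1).
  have [PE QE] := expectation_phase P t th mU.
  have [PWE _] := expectation_phase P t th mUW.
  rewrite PE QE.
  have E : \int[P]_w cos (t * (U w - W w) - th) =
      \int[P]_w (p (U w) * cos (t * W w)) + \int[P]_w (q (U w) * sin (t * W w)).
    rewrite -ED; [|exact: (bm_mul bp (bm_cos t mW))|exact: (bm_mul bq (bm_sin t mW))].
    apply: eq_Rintegral => w _; rewrite /p /q -cosB; congr cos; ring.
  rewrite -/(Ecos P W t) -/(Esin P W t).
  by move: PWE; rewrite E => PWE; lra.
- move=> w.
  have [-> _] := expectation_phase (K w) t (t * U w - th) mi.
  have [-> _] := expectation_phase P t (t * U w - th) mW.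
  by rewrite /p /q /kc /ks /Ecos /Esin; ring.
Qed.

(** For each w, layer_bound is applied to the signed measure K_w minus the law
    of W. The factor 2^-1 stays on the left because the supremum under the
    integral need not be measurable in w. *)
Lemma ccov_le_beta (U W : {RV P >-> R}) (t : R) :
  ((2^-1 * cmod (ccov P (fun w => expi (t * U w)) (fun w => expi (t * W w))))%:E
   <= beta_coef (sigma_RV U) W)%E.
Proof.
apply: le_ereal_inf_tmp => _ [K HK <-].
have [D [c [bD -> DE]]] := ccov_phase t HK.
rewrite -RintegralZl//; last exact: prob_integrable.
apply: expectation_le => [|w]; first exact: bm_scale.
set S := ereal_sup _.
have mW : measurable_fun setT (W : T -> R) by [].
have SA (A : set R) : measurable A ->
    (`|\int[K w]_y \1_A y - \int[P]_v \1_A (W v)|%:E <= S)%E.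
  move=> mA; apply: ereal_sup_ubound; exists A => //.
  have -> : K w A = (\int[K w]_y \1_A y)%:E.
    by rewrite /Rintegral integral_indic// setIT fineK// fin_num_measure.
  have -> : distribution P W A = (\int[P]_v \1_A (W v))%:E.
    have mWA : measurable (W @^-1` A) by rewrite -[W @^-1` A]setTI; exact: mW.
    rewrite -[LHS]fineK ?fin_num_measure//; congr EFin.
    rewrite -[LHS](@Rintegral_prob1 _ _ _ P (W @^-1` A))// -Rintegral_indic_comp.
    by apply: eq_Rintegral => v _; rewrite mulr1.
  by [].
case SE : S => [r| |]; last 2 first.
- exact: leey.
- by have := SA set0 measurable0; rewrite SE leeNy_eq.
rewrite lee_fin DE.
pose Phi (h : R -> R) := \int[K w]_y (h y * 1) - \int[P]_v (h (W v) * 1).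
have PhiE h : Phi h = \int[K w]_y h y - \int[P]_v h (W v).
  by congr (_ - _); apply: eq_Rintegral => v _; rewrite mulr1.
have lP : linear_bounded Phi.
  apply: linear_bounded_sub.
    apply: (@linear_bounded_integral _ _ _ _ R (K w) (fun y : R => y)) => //.
    exact: (prob_integrable (K w) (@bm_cst _ R R 1)).
  by apply: linear_bounded_integral => //; exact: (prob_integrable P (@bm_cst _ T R 1)).
rewrite normrM gtr0_norm ?invr_gt0// ler_pdivrMl//.
rewrite -(PhiE (fun y => cos (t * y - c w))); apply: (layer_bound lP).
- by move=> A mA; rewrite PhiE -lee_fin -SE; exact: SA.
- by rewrite PhiE !Rintegral_prob1// !probability_setT subrr.
- apply: continuous_measurable_fun.
  exact: (continuous_comp_fun (@continuous_cos R) (continuous_affine t (- c w))).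
- by move=> x; exact: cos_max.
Qed.

(** cos(ty - c) / |t| is 1-Lipschitz. For t = 0 the exponentials are constant
    and their covariance vanishes. *)
Lemma ccov_le_tau (U W : {RV P >-> R}) (t : R) :
  ((cmod (ccov P (fun w => expi (t * U w)) (fun w => expi (t * W w))))%:E
   <= `|t|%:E * tau_coef (sigma_RV U) W)%E.
Proof.
have [->|t0] := eqVneq t 0.
  rewrite normr0 mul0e lee_fin ccov_expi// cmodE.
  have c0 Y : Ecos P Y 0 = 1.
    rewrite /Ecos; under eq_Rintegral do rewrite mul0r cos0.
    by rewrite Rintegral_prob1// probability_setT.
  have s0 Y : Esin P Y 0 = 0.
    rewrite /Esin; under eq_Rintegral do rewrite mul0r sin0.
    by rewrite /Rintegral integral0.
  by rewrite /= !c0 !s0 !(mulr1, mulr0, subr0, addr0, subrr) expr0n/= addr0 sqrtr0.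
have tp : 0 < `|t| by rewrite normr_gt0.
rewrite -lee_pdivrMl//; apply: le_ereal_inf_tmp => _ [K HK <-].
have [D [c [bD -> DE]]] := ccov_phase t HK.
rewrite -EFinM -RintegralZl//; last exact: prob_integrable.
apply: expectation_le => [|w]; first exact: bm_scale.
have mW : measurable_fun setT (W : T -> R) by [].
pose f (y : R) := `|t|^-1 * cos (t * y - c w).
have mc : measurable_fun setT (fun y : R => cos (t * y - c w)).
  apply: continuous_measurable_fun.
  exact: (continuous_comp_fun (@continuous_cos R) (continuous_affine t (- c w))).
have bc : bounded_measurable (fun y : R => cos (t * y - c w)).
  by split => //; exists 1 => y; exact: cos_max.
have bcW : bounded_measurable (fun v => cos (t * W v - c w)).
  by apply: (@bm_comp _ T R W (fun y => cos (t * y - c w))) => // y; exact: cos_max.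
have bf : bounded_measurable f by exact: bm_scale.
have bfW : bounded_measurable (fun v => f (W v)) by apply: bm_scale.
apply: ereal_sup_ubound; exists f.
  move=> [x y] _ /=; rewrite /self_sub/= mul1r /f -mulrBr normrM gtr0_norm ?invr_gt0//.
  rewrite ler_pdivrMl// (le_trans (cos_lipschitz _ _))// -normrM.
  by rewrite le_eqVlt; apply/orP; left; apply/eqP; congr (`|_|); ring.
rewrite integral_distribution; last 2 first.
- by apply/measurable_EFinP; case: bf.
- exact: prob_integrable bfW.
rewrite -[X in `|X - _|%E]fineK; last by apply: integrable_fin_num => //; exact: prob_integrable.
rewrite -[X in `|_ - X|%E]fineK; last by apply: integrable_fin_num => //; exact: prob_integrable bfW.
rewrite -EFinB /=; congr (`|_|%:E).
rewrite DE mulrBr -!RintegralZl//; exact: prob_integrable.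
Qed.

End dependence.

Section covariance_sums.
Context d (T : measurableType d) (R : realType) (P : probability T R).
Local Notation mu := (@lebesgue_measure R).
Variables (X : nat -> {RV P >-> R}) (n m : nat).
Let A : R := pi * m%:R.
Let A0 : 0 <= A. Proof. by rewrite mulr_ge0 ?pi_ge0. Qed.
Let pi_inv0 : 0 <= (pi : R)^-1. Proof. by rewrite invr_ge0 pi_ge0. Qed.

Lemma integral_norm_itv : (\int[mu]_(t in `[(- A)%R, A]) `|t|%:E = (A ^+ 2)%:E)%E.
Proof.
have cn : continuous (fun t : R => `|t|) by exact: norm_continuous.
rewrite -[LHS]fineK; last first.
  by apply: integrable_fin_num => //; exact: (continuous_integrable_itv _ _ cn).
congr EFin; rewrite -/(Rintegral mu `[- A, A] (fun t => `|t|)).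
rewrite (@Rintegral_itv_cat _ _ (- A) 0 A)// ?oppr_le0//.
have dF (k x : R) : is_derive x (1 : R) (fun t : R => k / 2 * (t * t)) (k * x).
  apply: is_derive_eq; rewrite /GRing.scale/=; lra.
have half (k a b : R) : a <= b -> \int[mu]_(t in `[a, b]) (k * t) = k / 2 * (b * b) - k / 2 * (a * a).
  by move=> ab; apply: (Rintegral_antiderivative (continuous_scale k) (dF k)).
have -> : \int[mu]_(t in `[- A, 0]) `|t| = \int[mu]_(t in `[- A, 0]) (-1 * t).
  apply: eq_Rintegral => t; rewrite inE/= in_itv/= => /andP[_ t0].
  by rewrite ler0_norm// mulN1r.
have -> : \int[mu]_(t in `[0, A]) `|t| = \int[mu]_(t in `[0, A]) (1 * t).
  apply: eq_Rintegral => t; rewrite inE/= in_itv/= => /andP[t0 _].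
  by rewrite ger0_norm// mul1r.
by rewrite !half// ?oppr_le0//; lra.
Qed.

Lemma R_le_sum (B : nat -> \bar R) (k : R) : 0 <= k ->
  (forall l, (0 <= B l)%E) ->
  (forall l, (\int[mu]_(t in `[(- A)%R, A])
    (cmod (ccov P (fun w => expi (t * X 0%N w)) (fun w => expi (t * X l w))))%:E <=
    (pi * k)%:E * B l)%E) ->
  (R_ X n m <= k%:E * \sum_(1 <= l < n) B l)%E.
Proof.
move=> k0 B0 HB.
have p0 : (pi : R) != 0 by rewrite gt_eqF// pi_gt0.
have -> : (k%:E = (pi^-1)%:E * (pi * k)%:E)%E by rewrite -EFinM mulKf.
rewrite -muleA; apply: lee_wpmul2l; first by rewrite lee_fin.
rewrite ge0_sume_distrr; last by move=> l _; exact: B0.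
by apply: lee_sum => l _; exact: HB.
Qed.

(** The band has length 2 pi m. *)
Lemma R_le_beta : (R_ X n m <= R_beta X n m)%E.
Proof.
have B0 l : (0 <= beta_X X l)%E.
  by apply: le_trans (ccov_le_beta (X 0%N) (X l) 0); rewrite lee_fin mulr_ge0// cmodE sqrtr_ge0.
apply: R_le_sum => // l.
apply: (@le_trans _ _ (\int[mu]_(t in `[(- A)%R, A]) (cst (2%:E * beta_X X l) t))%E).
  apply: le_integral_ge0 => t _; first by rewrite lee_fin cmodE sqrtr_ge0.
  rewrite /= -lee_pdivrMl// -EFinM; exact: ccov_le_beta.
rewrite integral_cst//= lebesgue_measure_itv/= lte_fin.
case: ifP => _; last by rewrite mule0 mule_ge0// lee_fin !mulr_ge0// pi_ge0.
rewrite -EFinB opprK muleAC -EFinM (_ : 2 * (A + A) = pi * (4 * m%:R))//.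
by rewrite /A; ring.
Qed.

(** The integral of |t| over the band is (pi m)^2. *)
Lemma R_le_tau : (R_ X n m <= R_tau X n m)%E.
Proof.
have B0 l : (0 <= tau_X X l)%E.
  have := ccov_le_tau (X 0%N) (X l) 1; rewrite normr1 mul1e; apply: le_trans.
  by rewrite lee_fin cmodE sqrtr_ge0.
apply: R_le_sum => // [|l]; first by rewrite mulr_ge0 ?pi_ge0 ?exprn_ge0.
apply: (@le_trans _ _ (\int[mu]_(t in `[(- A)%R, A]) (`|t|%:E * tau_X X l))%E).
  apply: le_integral_ge0 => t _; first by rewrite lee_fin cmodE sqrtr_ge0.
  exact: ccov_le_tau.
rewrite ge0_integralZr//; last first.
  by apply/measurable_EFinP; apply: measurable_funTS; apply: continuous_measurable_fun; exact: norm_continuous.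
by rewrite integral_norm_itv /A exprMn mulrA -expr2.
Qed.

End covariance_sums.

(** * The risk bound *)

Theorem proposition4p1 (d : measure_display) (T : measurableType d)
    (R : realType) (P : probability T R)
    (X eps : nat -> {RV P >-> R}) (g feps : R -> R)
    (n m kn : nat) (M2 : R) (gm : R -> R) (ghat : T -> R -> R) :
  strictly_stationary X ->
  (forall i, has_density (X i) g) ->
  mutually_independent eps ->
  (forall i, has_density (eps i) feps) ->
  independent_sigma P (sigma_seq X) (sigma_seq eps) ->
  (0 < n)%N -> (0 < kn)%N -> (0 < m)%N ->
  feps \in Lfun lebesgue_measure 2%:E ->
  (forall x, fourierR feps x != 0) ->
  g \in Lfun lebesgue_measure 2%:E ->
  0 < M2 ->
  (\int[lebesgue_measure]_x (x ^+ 2 * g x ^+ 2)%:E < M2%:E)%E ->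
  is_orth_proj (S_closed m) g gm ->
  (forall w, is_argmin (S_fin m kn)
     (gamma_n feps (fun i : 'I_n => X i w + eps i w)) (ghat w)) ->
  [/\ (\int[P]_w sqnorm (g \- ghat w)%R
        <= sqnorm (g \- gm)%R
           + (m%:R ^+ 2 * (M2 + 1) / kn%:R)%:E
           + (2 / n%:R)%:E * Delta feps m
           + (2 / n%:R)%:E * R_ X n m)%E,
      (R_ X n m <= R_beta X n m)%E &
      (\int[P]_w `|X 0%N w|%:E < +oo)%E ->
      (R_ X n m <= mine (R_beta X n m) (R_tau X n m))%E].
Proof.
move=> statX gX indE fE indXE n0 k0 m0 _ f0 g2 M20 gM2 gmP ghatP.
split; [|exact: R_le_beta|by move=> _; rewrite le_min R_le_beta R_le_tau].
have [_ g_ge0 _] := gX 0%N.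
have [g1 gi] := density_integral (gX 0%N); have [_ fi] := density_integral (fE 0%N).
have Lg := L2_Lfun g2.
have us := uniq_centered kn.
pose B : R := m%:R ^+ 2 * (M2 + 1) / kn%:R.
pose err w := \sum_(j <- centered kn)
  (coef_mean feps m n (fun i => X i w + eps i w) j
   - ip lebesgue_measure setT g (phi m j)) ^+ 2.
have err0 w : 0 <= err w by apply: sumr_ge0 => j _; exact: sqr_ge0.
have B0 : 0 <= B by rewrite divr_ge0// mulr_ge0 ?sqr_ge0// addr_ge0// ltW.
have risk w : (sqnorm (g \- ghat w)%R <= (sqnorm (g \- gm)%R + B%:E) + (err w)%:E)%E.
  rewrite (argmin_comb fi f0 m0 n0 (z := fun i => X i w + eps i w) (ghatP w)) -addeA -EFinD.
  apply: section_risk => // u uu du; apply: (@tail_coef _ m m0 g M2 kn u) => // j ju.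
  by have := du j ju; rewrite mem_centered -ltnNge.
have sq0 u : (0 <= sqnorm (u : R -> R))%E by apply: integral_ge0 => x _; rewrite lee_fin sqr_ge0.
have merr : measurable_fun setT (fun w => (err w)%:E).
  apply/measurable_EFinP; apply: measurable_sum => j; apply: measurable_funX.
  apply: measurable_funB => //; apply: measurable_funM => //; apply: measurable_sum => i.
  apply: (measurableT_comp (measurable_coef fi f0 m j)).
  by apply: measurable_funD.
apply: (@le_trans _ _ (\int[P]_w ((sqnorm (g \- gm)%R + B%:E) + (err w)%:E))%E).
  by apply: le_integral_ge0.
rewrite ge0_integralD//; [|by move=> w _; rewrite adde_ge0|by move=> w _; rewrite lee_fin].
rewrite integral_cst//= probability_setT mule1 -[leRHS]addeA; apply: leeD2l.
apply: (le_trans (expected_coefficient_error statX gX indE fE indXE fi f0 gi m0 n0 us)).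
have n1 : ((n%:R^-1)%:E <= (2 / n%:R)%:E :> \bar R)%E.
  by rewrite lee_fin ler_pMl ?invr_gt0 ?ltr0n// ler1n.
have D0 : (0 <= Delta feps m)%E.
  by rewrite mule_ge0 ?lee_fin ?invr_ge0 ?mulr_ge0 ?pi_ge0//; apply: integral_ge0 => x _; rewrite lee_fin invr_ge0 sqr_ge0.
have R0 : (0 <= R_ X n m)%E.
  rewrite mule_ge0 ?lee_fin ?invr_ge0 ?pi_ge0//; apply: sume_ge0 => l _.
  by apply: integral_ge0 => t _; rewrite lee_fin cmodE sqrtr_ge0.
by apply: leeD; apply: lee_wpmul2r.
Qed.
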